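(* There is a distribution-free PAC+MQ algorithm which, given any $\varepsilon > 0$, runs in time \[ \exp\left( \log^{O(1)}(ns) \right) \cdot \mathrm{poly}(\varepsilon^{-1}) \] and with probability at least $9/10$ learns any unknown $s$-term exact-DNF $f$ over $\{0,1\}^n$, under any unknown distribution $\mathcal{D}$ over $\{0,1\}^n$, to accuracy $\varepsilon$ (i.e., outputs a hypothesis $h$ with $\Pr_{\mathbf{x}\sim\mathcal{D}}[h(\mathbf{x}) \neq f(\mathbf{x})] \le \varepsilon$), using a hypothesis $h$ which is a DNF of size $O(s \log(1/\varepsilon))$.
   Context: A term is a conjunction of Boolean literals; a DNF is an OR of terms, and its size is its number of terms. An $s$-term DNF $f = T_1 \vee \cdots \vee T_s$ is an exact-DNF if there is some $1 \le k \le n$ such that every term $T_i$ contains exactly $k$ distinct literals. In the distribution-free PAC+MQ model the algorithm has access to a sample oracle returning independent labeled pairs $(\mathbf{x}, f(\mathbf{x}))$ with $\mathbf{x} \sim \mathcal{D}$, where $\mathcal{D}$ is an arbitrary unknown distribution over $\{0,1\}^n$, and to a membership-query oracle returning $f(x)$ on any queried $x \in \{0,1\}^n$. *)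

(* Defs.v *)
From mathcomp Require Import all_boot all_order all_algebra.
From mathcomp Require Import boolp reals sequences exp.

Set Implicit Arguments.
Unset Strict Implicit.
Unset Printing Implicit Defensive.

Import Order.TTheory GRing.Theory Num.Theory.

Definition cube (n : nat) := n.-tuple bool.

(* The literal (i, true) is x_i, and (i, false) is its negation.  A term may
   contain both; it is then unsatisfiable. *)
Definition literal (n : nat) := ('I_n * bool)%type.
Definition term (n : nat) := {set literal n}.
Definition dnf (n : nat) := seq (term n).

Definition lit_eval n (l : literal n) (x : cube n) : bool :=
  tnth x l.1 == l.2.
Definition term_eval n (T : term n) (x : cube n) : bool :=
  [forall l in T, lit_eval l x].
Definition dnf_eval n (F : dnf n) (x : cube n) : bool :=
  has (fun T => term_eval T x) F.

Definition exact_dnf n (F : dnf n) : Prop :=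
  exists k : nat, 1 <= k <= n /\ (forall T, T \in F -> #|T| = k).

(* Algorithms are programs of Jones's WHILE language (N. D. Jones,
   "Computability and Complexity from a Programming Perspective"), which
   computes on binary trees and is polynomial-time equivalent to Turing
   machines, extended with a fair coin and the two oracles. *)
Inductive tree := Leaf | Node of tree & tree.

Definition hd (t : tree) : tree := if t is Node a _ then a else Leaf.
Definition tl (t : tree) : tree := if t is Node _ b then b else Leaf.
Definition truthy (t : tree) : bool := if t is Node _ _ then true else false.

Inductive expr :=
| Var of nat
| Nil
| Cons of expr & expr
| Hd of expr
| Tl of expr.

Inductive cmd :=
| Assign of nat & expr
| Flip of nat
| Sample of nat
| Query of nat & expr
| Seq of cmd & cmd
| If of expr & cmd & cmd
| While of expr & cmd.

Definition store := nat -> tree.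

Definition upd (st : store) (v : nat) (t : tree) : store :=
  fun w => if w == v then t else st w.

Fixpoint expr_eval (e : expr) (st : store) : tree :=
  match e with
  | Var v => st v
  | Nil => Leaf
  | Cons e1 e2 => Node (expr_eval e1 st) (expr_eval e2 st)
  | Hd e1 => hd (expr_eval e1 st)
  | Tl e1 => tl (expr_eval e1 st)
  end.

Definition enc_bool (b : bool) : tree := if b then Node Leaf Leaf else Leaf.
Definition enc_list (s : seq tree) : tree := foldr Node Leaf s.
(* unary *)
Definition enc_nat (m : nat) : tree := enc_list (nseq m Leaf).
Definition enc_cube n (x : cube n) : tree := enc_list (map enc_bool x).
Definition enc_term n (T : term n) : tree :=
  enc_list [seq Node (enc_bool ((i, true) \in T)) (enc_bool ((i, false) \in T))
           | i <- enum 'I_n].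
Definition enc_dnf n (F : dnf n) : tree := enc_list (map (@enc_term n) F).

(* A left inverse of enc_cube, total so that every query is answered. *)
Definition dec_cube n (t : tree) : cube n :=
  [tuple truthy (hd (iter (val i) tl t)) | i < n].

(* Stack of commands still to be run, and the current store. *)
Definition config := (seq cmd * store)%type.

Inductive move (n : nat) :=
| Halted of store
| Step of config
| Coin of (bool -> config)
| Draw of (cube n -> config).

Definition transition n (f : cube n -> bool) (c : config) : move n :=
  let: (K, st) := c in
  match K with
  | [::] => Halted n st
  | Assign v e :: K' => Step n (K', upd st v (expr_eval e st))
  | Flip v :: K' => Coin n (fun b => (K', upd st v (enc_bool b)))
  | Sample v :: K' =>
      Draw (fun x => (K', upd st v (Node (enc_cube x) (enc_bool (f x)))))
  | Query v e :: K' =>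
      Step n (K', upd st v (enc_bool (f (dec_cube n (expr_eval e st)))))
  | Seq p q :: K' => Step n (p :: q :: K', st)
  | If e p q :: K' => Step n ((if truthy (expr_eval e st) then p else q) :: K', st)
  | While e p :: K' =>
      Step n (if truthy (expr_eval e st) then p :: While e p :: K' else K', st)
  end.

(* Worst case: at most t steps for every outcome of the coins and samples. *)
Fixpoint halts_within n (f : cube n -> bool) (t : nat) (c : config) : Prop :=
  match transition f c, t with
  | Halted _, _ => True
  | _, 0 => False
  | Step c', t'.+1 => halts_within f t' c'
  | Coin k, t'.+1 => forall b, halts_within f t' (k b)
  | Draw k, t'.+1 => forall x, halts_within f t' (k x)
  end.

Local Open Scope ring_scope.

Definition is_distr (R : realType) n (D : cube n -> R) : Prop :=
  (forall x, 0 <= D x) /\ \sum_x D x = 1.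

(* Probability, over fair coins and independent samples from D, of halting
   within t steps in a store satisfying good. *)
Fixpoint success_prob (R : realType) n (f : cube n -> bool) (D : cube n -> R)
    (good : store -> Prop) (t : nat) (c : config) : R :=
  match transition f c, t with
  | Halted st, _ => (`[< good st >])%:R
  | _, 0%N => 0
  | Step c', t'.+1 => success_prob f D good t' c'
  | Coin k, t'.+1 => (success_prob f D good t' (k true)
                      + success_prob f D good t' (k false)) / 2
  | Draw k, t'.+1 => \sum_x D x * success_prob f D good t' (k x)
  end.

Definition error (R : realType) n (D : cube n -> R) (f h : cube n -> bool) : R :=
  \sum_(x | h x != f x) D x.

(* The accuracy is handed to the program as the least integer >= 1/eps. *)
Definition init (R : realType) (P : cmd) (n s : nat) (eps : R) : config :=
  ([:: P], fun v => match v with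
                    | 0 => enc_nat n
                    | 1 => enc_nat s
                    | 2 => enc_nat `|Num.ceil eps^-1|%N
                    | _ => Leaf
                    end%N).

(* The output is read in variable 0.  The maximum with 1 gives O(s log(1/eps))
   its usual meaning when eps is not bounded away from 1. *)
Definition good_output (R : realType) n (F : dnf n) (s : nat) (eps : R)
    (D : cube n -> R) (C : R) (st : store) : Prop :=
  exists h : dnf n,
    [/\ st 0%N = enc_dnf h,
        error D (dnf_eval F) (dnf_eval h) <= eps
      & (size h)%:R <= C * s%:R * Num.max 1 (ln eps^-1)].

(* Main.v *)
Require Import Defs.
From mathcomp Require Import all_boot all_order all_algebra.
From mathcomp Require Import boolp reals sequences exp.
From mathcomp Require Import zify ring lra.

Import Order.TTheory GRing.Theory Num.Theory.
Local Open Scope ring_scope.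

(** Let all terms of [F] have width [k].  The learner grows a list [L] of terms
of width [k] from positive examples.  An attempt at an example [x] keeps a point
[y] and a term [A], initially [x] and the empty term.  In phases [j = a, ..., 1]
it flips each variable outside a chosen term ([A], or one already in [L])
with probability [2^-j], and replaces [A] by the literals of [y] whose flip
makes [F] false, found with membership queries.  Suppose [x] satisfies a term
[T0] of [F] that is not in [L].  With quasipolynomially small probability the
noise preserves [T0] while falsifying many literals of every term of [F] that is
far from [T0].  Terms of [L] are no obstacle: one that is far from [T0] differs
from it on many variables, because the widths agree, and a nearby one serves
itself as the protected term.  A few further bit flips then make almost all
literals of [T0] sensitive, so that each phase halves the distance to [T0], or
to a term of [L] close to it, and the last phase lets the attempt output [T0].

An output is kept if [F] holds on many random completions of it; a kept term
then lies within [log s] literals of a term of [F], so [L] stays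
quasipolynomial.  A greedy cover of the positive examples by kept terms that
are consistent with the negative ones reaches training error [O(1/N)], where
[N >= 1/eps], after [s] times [O(log N)] rounds, and an Occam bound over
hypotheses of this size turns it into error [eps]. *)

(** * A small probabilistic language compiled to WHILE *)

(** The noise rate [2^-j] balances two demands. Only [O(tau * 2^j)] variables of [T0] are
    unprotected in phase [j], so all of them survive with probability [2^-O(tau)]; a term with a
    suitable multiple of [tau * 2^j] literals exposed to the noise gets so many of them falsified
    that a union bound over fewer than [2^tau] terms still works given that [T0] survives. Terms
    closer than this cannot be killed, which is why one phase gains only a factor two. The learner
    knows neither the term to protect, nor the bits to flip, nor whether a phase should be skipped.
    It guesses all of them with coins, and the number of repetitions pays for the small success
    probability. Since the statement counts steps of WHILE programs, the learner is written in an
    expression language whose meaning is an expectation transformer. The probabilistic analysis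
    concerns these transformers only, and a single simulation theorem transfers it to machine
    runs. *)

Inductive prog :=
| EVar of nat
| ENil
| ECons of prog & prog
| EHd of prog
| ETl of prog
| EIf of prog & prog & prog
| ELet of nat & prog & prog
| ELoop of nat & prog & prog
| EFlip
| ESample
| EQuery of prog.

Definition env := nat -> tree.

(** The codomain is arbitrary because the same extension acts on value environments and on the
    address map of the compiler. *)
Definition bind_var {A : Type} (r : nat -> A) (x : nat) (v : A) : nat -> A :=
  fun y => if Nat.eqb y x then v else r y.

(* A loop iterates once per node of the tree stored in WHILE variable 3, so
   that doubling that tree squares the running time. *)
Fixpoint nodes (t : tree) : nat :=
  if t is Node a b then (nodes a + nodes b).+1 else 1%N.

(** Number of iterations left when [t] is the stack of subtrees still to be visited: a loop walks
    through its counter tree, popping one subtree per iteration and pushing its children. *)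
Fixpoint stack_nodes (t : tree) : nat :=
  if t is Node a b then (nodes a + stack_nodes b)%N else 0%N.

(** The answer type is arbitrary so that the same combinator serves expectations, with real answers,
    and the invariants of [must], with answers in [Prop]. *)
Fixpoint loopM {V R : Type} (m : nat) (g : V -> (V -> R) -> R) (v : V)
    (phi : V -> R) : R :=
  if m is m'.+1 then g v (fun v' => loopM m' g v' phi) else phi v.

Section Wp.
Context {R : realType} {n : nat}.
Variables (f : cube n -> bool) (D : cube n -> R) (B : nat).

(** Weakest preexpectation: the mean of [phi] at the result. Continuations avoid any explicit
    distribution on trees. *)
Fixpoint wp (e : prog) (r : env) (phi : tree -> R) : R :=
  match e with
  | EVar x => phi (r x)
  | ENil => phi Leaf
  | ECons a b => wp a r (fun u => wp b r (fun v => phi (Node u v)))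
  | EHd a => wp a r (fun v => phi (Defs.hd v))
  | ETl a => wp a r (fun v => phi (Defs.tl v))
  | EIf c a b => wp c r (fun v => if truthy v then wp a r phi else wp b r phi)
  | ELet x a b => wp a r (fun v => wp b (bind_var r x v) phi)
  | ELoop x a b => wp a r (fun v =>
      loopM B (fun v phi => wp b (bind_var r x v) phi) v phi)
  | EFlip => (phi (enc_bool true) + phi (enc_bool false)) / 2
  | ESample => \sum_x D x * phi (Node (enc_cube x) (enc_bool (f x)))
  | EQuery a => wp a r (fun v => phi (enc_bool (f (dec_cube n v))))
  end.

(* [post] holds of the result on every branch, whatever its probability. *)
Fixpoint must (e : prog) (r : env) (post : tree -> Prop) : Prop :=
  match e with
  | EVar x => post (r x)
  | ENil => post Leaf
  | ECons a b => must a r (fun u => must b r (fun v => post (Node u v)))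
  | EHd a => must a r (fun v => post (Defs.hd v))
  | ETl a => must a r (fun v => post (Defs.tl v))
  | EIf c a b => must c r (fun v => if truthy v then must a r post else must b r post)
  | ELet x a b => must a r (fun v => must b (bind_var r x v) post)
  | ELoop x a b => must a r (fun v =>
      loopM B (fun v post => must b (bind_var r x v) post) v post)
  | EFlip => forall b, post (enc_bool b)
  | ESample => forall x : cube n, post (Node (enc_cube x) (enc_bool (f x)))
  | EQuery a => must a r (fun v => post (enc_bool (f (dec_cube n v))))
  end.

Lemma must_mono e r (p q : tree -> Prop) :
  (forall v, p v -> q v) -> must e r p -> must e r q.
Proof.
elim: e r p q => [x||a ha b hb|a ha|a ha|c hc a ha b hb|x a ha b hb|x a ha b hb|||a ha]
  r p q h //=; try exact: h.
- by apply: ha => u; apply: hb => v; exact: h.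
- by apply: ha => u; exact: h.
- by apply: ha => u; exact: h.
- by apply: hc => v; case: truthy; [apply: ha|apply: hb].
- by apply: ha => u; apply: hb.
- apply: ha => v; elim: (B) v => [|m ih] v /=; first exact: h.
  by apply: hb.
- by move=> hp b; apply: h.
- by move=> hp b; apply: h.
- by apply: ha => u; exact: h.
Qed.

Lemma must_all e r (p : tree -> Prop) : (forall v, p v) -> must e r p.
Proof.
elim: e r p => [x||a ha b hb|a ha|a ha|c hc a ha b hb|x a ha b hb|x a ha b hb|||a ha]
  r p h //=.
- by apply: ha => u; apply: hb.
- exact: ha.
- exact: ha.
- by apply: hc => v; case: truthy; [apply: ha|apply: hb].
- by apply: ha => u; apply: hb.
- by apply: ha => v; elim: (B) v => [|m ih] v //=; apply: hb.
- exact: ha.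
Qed.

Fixpoint deterministic (e : prog) : bool :=
  match e with
  | EVar _ | ENil => true
  | ECons a b => deterministic a && deterministic b
  | EHd a | ETl a | EQuery a => deterministic a
  | EIf c a b => [&& deterministic c, deterministic a & deterministic b]
  | ELet _ a b | ELoop _ a b => deterministic a && deterministic b
  | EFlip | ESample => false
  end.

Lemma deterministic_value e r : deterministic e -> exists v,
  (forall phi, wp e r phi = phi v) /\ (forall post : tree -> Prop, post v -> must e r post).
Proof.
elim: e r => [x||a ha b hb|a ha|a ha|c hc a ha b hb|x a ha b hb|x a ha b hb|||a ha] r //=.
- by move=> _; exists (r x).
- by move=> _; exists Leaf.
- move=> /andP[/(ha r) [u [u1 u2]] /(hb r) [v [v1 v2]]]; exists (Node u v).
  by split=> [phi|q hq]; [rewrite u1 v1|apply/u2/v2].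
- move=> /(ha r) [u [u1 u2]]; exists (Defs.hd u).
  by split=> [phi|q hq]; [rewrite u1|apply/u2].
- move=> /(ha r) [u [u1 u2]]; exists (Defs.tl u).
  by split=> [phi|q hq]; [rewrite u1|apply/u2].
- move=> /and3P[/(hc r) [w [w1 w2]] /(ha r) [u [u1 u2]] /(hb r) [v [v1 v2]]].
  exists (if truthy w then u else v); split=> [phi|q hq].
    by rewrite w1 u1 v1; case: truthy.
  by apply: w2; move: hq; case: truthy; [exact: u2|exact: v2].
- move=> /andP[/(ha r) [u [u1 u2]] /(hb (bind_var r x u)) [v [v1 v2]]]; exists v.
  by split=> [phi|q hq]; [rewrite u1 v1|apply/u2/v2].
- move=> /andP[/(ha r) [u [u1 u2]] dh].
  suff [v [v1 v2]] : exists v, (forall phi, loopM B (fun v phi => wp b (bind_var r x v) phi) u phi = phi v)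
    /\ (forall post : tree -> Prop, post v ->
          loopM B (fun v post => must b (bind_var r x v) post) u post).
    by exists v; split=> [phi|q hq]; [rewrite u1 v1|apply/u2/v2].
  elim: (B) u {u1 u2} => [|m ih] u /=; first by exists u.
  have [v [v1 v2]] := hb (bind_var r x u) dh; have [w [w1 w2]] := ih v.
  by exists w; split=> [phi|q hq]; [rewrite v1 w1|apply/v2/w2].
- move=> /(ha r) [u [u1 u2]]; exists (enc_bool (f (dec_cube n u))).
  by split=> [phi|q hq]; [rewrite u1|apply/u2].
Qed.

(** Specifications are proved for [wp] only. For a deterministic program, testing [wp] against the
    indicator of its value carries them over to [must]. *)
Lemma must_value e r v (post : tree -> Prop) : deterministic e ->
  (forall phi, wp e r phi = phi v) -> post v -> must e r post.
Proof.
move=> /(deterministic_value e r) [u [u1 u2]] hv.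
suff -> : v = u by exact: u2.
have := hv (fun w => (`[< w = u >])%:R : R); rewrite u1 /= asboolT //.
by case: asboolP => // _ /esym/eqP; rewrite eq_sym oner_eq0.
Qed.
End Wp.

(* Names are placed at addresses below [d]; the result goes to address [d]. *)
Fixpoint compile (e : prog) (del : nat -> nat) (d : nat) : cmd :=
  match e with
  | EVar x => Assign d (Var (del x))
  | ENil => Assign d Defs.Nil
  | ECons a b =>
      Seq (compile a del d) (Seq (compile b del d.+1)
        (Assign d (Defs.Cons (Var d) (Var d.+1))))
  | EHd a => Seq (compile a del d) (Assign d (Hd (Var d)))
  | ETl a => Seq (compile a del d) (Assign d (Tl (Var d)))
  | EIf c a b => Seq (compile c del d) (If (Var d) (compile a del d) (compile b del d))
  | ELet x a b =>
      Seq (compile a del d) (Seq (compile b (bind_var del x d) d.+1)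
        (Assign d (Var d.+1)))
  | ELoop x a b =>
      Seq (compile a del d) (Seq (Assign d.+1 (Defs.Cons (Var 3) Defs.Nil))
        (While (Var d.+1)
          (Seq (Assign d.+2 (Hd (Var d.+1)))
          (Seq (Assign d.+1 (Tl (Var d.+1)))
          (Seq (If (Var d.+2)
                 (Assign d.+1 (Defs.Cons (Hd (Var d.+2))
                                (Defs.Cons (Tl (Var d.+2)) (Var d.+1))))
                 (Assign d.+2 Defs.Nil))
          (Seq (compile b (bind_var del x d) d.+2)
               (Assign d (Var d.+2))))))))
  | EFlip => Flip d
  | ESample => Sample d
  | EQuery a => Seq (compile a del d) (Query d (Var d))
  end.

(** The 10 in a loop counts the steps spent per iteration on the traversal of the counter tree. *)
Fixpoint cost (B : nat) (e : prog) : nat :=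
  match e with
  | EVar _ | ENil | EFlip | ESample => 1
  | ECons a b => cost B a + cost B b + 3
  | EHd a | ETl a | EQuery a => cost B a + 2
  | EIf c a b => cost B c + maxn (cost B a) (cost B b) + 2
  | ELet _ a b => cost B a + cost B b + 3
  | ELoop _ a b => cost B a + B * (cost B b + 10) + 4
  end%N.

(** The program is fixed, so its loop nesting is a constant, and each level contributes one factor
    of order [B.+1]. *)
Lemma cost_poly (e : prog) :
  exists c : nat, forall B : nat, (cost B e <= c * B.+1 ^ c)%N.
Proof.
have mono c c' B : (c <= c')%N -> (c * B.+1 ^ c <= c' * B.+1 ^ c')%N.
  by move=> h; apply: leq_mul => //; apply: leq_pexp2l.
have pos c B : (1 <= B.+1 ^ c)%N by rewrite expn_gt0.
have one (g : nat -> nat) : (forall B, g B <= 1)%N ->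
    exists c : nat, forall B, (g B <= c * B.+1 ^ c)%N.
  move=> h; exists 1%N => B; apply: leq_trans (h B) _; rewrite mul1n; lia.
have two (a b : prog) (g : nat -> nat) k :
    (exists c : nat, forall B, (cost B a <= c * B.+1 ^ c)%N) ->
    (exists c : nat, forall B, (cost B b <= c * B.+1 ^ c)%N) ->
    (forall B, g B <= (cost B a + cost B b + k) * B.+1)%N ->
    exists c : nat, forall B, (g B <= c * B.+1 ^ c)%N.
  move=> [c hc] [c' hc'] hg; exists (c + c' + k).+1%N => B.
  apply: leq_trans (hg B) _; rewrite expnSr mulnA leq_mul2r /=.
  apply: (@leq_trans ((c + c' + k) * B.+1 ^ (c + c' + k))); last first.
    by rewrite leq_mul2r leqnSn orbT.
  rewrite !mulnDl; apply: leq_add; first apply: leq_add.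
  - apply: leq_trans (hc B) _; apply: leq_mul => //.
    by apply: leq_pexp2l => //; lia.
  - apply: leq_trans (hc' B) _; apply: leq_mul => //.
    by apply: leq_pexp2l => //; lia.
  - by rewrite leq_pmulr.
elim: e => [x||a ha b hb|a ha|a ha|c hc a ha b hb|x a ha b hb|x a ha b hb|||a ha].
- exact: one.
- exact: one.
- by apply: (two _ _ _ 3%N ha hb) => B /=; rewrite leq_pmulr.
- by apply: (two _ _ _ 2%N ha ha) => B /=; nia.
- by apply: (two _ _ _ 2%N ha ha) => B /=; nia.
- have hcons : exists c' : nat, forall B,
      (cost B (ECons a b) <= c' * B.+1 ^ c')%N.
    by apply: (two _ _ _ 3%N ha hb) => B /=; rewrite leq_pmulr.
  apply: (two _ _ _ 2%N hc hcons) => B /=; nia.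
- by apply: (two _ _ _ 3%N ha hb) => B /=; rewrite leq_pmulr.
- by apply: (two _ _ _ 10%N ha hb) => B /=; nia.
- exact: one.
- exact: one.
- by apply: (two _ _ _ 2%N ha ha) => B /=; nia.
Qed.

(** * Simulation of the language by WHILE commands *)

Section Compile.
Context {R : realType} {n : nat}.
Variables (f : cube n -> bool) (D : cube n -> R).
Hypothesis hD : is_distr D.
Variable good : store -> Prop.

(** Worst-case halting and the bound on success travel together, since one simulation proves
    both. *)
Definition guar (t : nat) (c : config) (v : R) : Prop :=
  halts_within f t c /\ v <= success_prob f D good t c.

Lemma D_ge0 x : 0 <= D x. Proof. by case: hD. Qed.

Lemma guar_succ t c v : guar t c v -> guar t.+1 c v.
Proof.
elim: t c v => [|t ih] c v [].
  by rewrite /guar /=; case: (transition f c).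
rewrite /guar; set t1 := t.+1.
rewrite {1 2}/t1 /=; case: (transition f c) => [st|c'|k|k] //=.
- by move=> h1 h2; apply: (ih c').
- move=> h1 h2; split=> [b|].
    exact: (ih (k b) _ (conj (h1 b) (lexx _))).1.
  apply: le_trans h2 _; rewrite ler_pM2r ?invr_gt0 ?ltr0n //.
  by apply: lerD; [exact: (ih _ _ (conj (h1 true) (lexx _))).2
                  |exact: (ih _ _ (conj (h1 false) (lexx _))).2].
- move=> h1 h2; split=> [x|].
    exact: (ih (k x) _ (conj (h1 x) (lexx _))).1.
  apply: le_trans h2 _; apply: ler_sum => x _; apply: ler_wpM2l.
    exact: D_ge0.
  exact: (ih _ _ (conj (h1 x) (lexx _))).2.
Qed.

Lemma guar_leq t t' c v : (t <= t')%N -> guar t c v -> guar t' c v.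
Proof.
move=> /subnKC <-; elim: (t' - t)%N => [|m ih]; rewrite ?addn0 // addnS.
by move=> h; apply/guar_succ/ih.
Qed.

Lemma guar_step t c c' v :
  transition f c = Step n c' -> guar t c' v -> guar t.+1 c v.
Proof. by rewrite /guar /= => ->. Qed.

Lemma guar_flip t x K st (phi : tree -> R) :
  (forall b, guar t (K, upd st x (enc_bool b)) (phi (enc_bool b))) ->
  guar t.+1 (Flip x :: K, st) ((phi (enc_bool true) + phi (enc_bool false)) / 2).
Proof.
move=> h; split=> /= [b|]; first exact: (h b).1.
rewrite ler_pM2r ?invr_gt0 ?ltr0n //; apply: lerD.
- exact: (h true).2.
- exact: (h false).2.
Qed.

Lemma guar_sample t x K st (phi : tree -> R) :
  (forall y, guar t (K, upd st x (Node (enc_cube y) (enc_bool (f y))))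
               (phi (Node (enc_cube y) (enc_bool (f y))))) ->
  guar t.+1 (Sample x :: K, st)
    (\sum_y D y * phi (Node (enc_cube y) (enc_bool (f y)))).
Proof.
move=> h; split=> /= [y|]; first exact: (h y).1.
by apply: ler_sum => y _; apply: ler_wpM2l; [exact: D_ge0 | exact: (h y).2].
Qed.

Definition agree (d : nat) (st st' : store) := forall i, (i < d)%N -> st' i = st i.

Lemma upd_eq st x v : upd st x v x = v.
Proof. by rewrite /upd eqxx. Qed.

Lemma upd_neq st x v y : (y != x)%N -> upd st x v y = st y.
Proof. by rewrite /upd => /negbTE ->. Qed.

Definition located (del : nat -> nat) (d : nat) (st : store) (r : env) :=
  forall x, (del x < d)%N /\ st (del x) = r x.

Lemma located_put del d st st' r x v :
  located del d st r -> agree d st st' -> st' d = v ->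
  located (bind_var del x d) d.+1 st' (bind_var r x v).
Proof.
move=> hl ha hv y; rewrite /bind_var; case: ifP => _; first by rewrite ltnS.
by have [h1 h2] := hl y; rewrite ltnS (ltnW h1) ha.
Qed.

Lemma located_agree del d d' st st' r :
  (d <= d')%N -> agree d st st' -> located del d st r -> located del d' st' r.
Proof.
move=> hd ha hl y; have [h1 h2] := hl y.
by rewrite (leq_trans h1 hd) ha.
Qed.

Definition next (t : nat) (K : seq cmd) (d : nat) (st : store) (phi : tree -> R)
    (v : tree) :=
  forall st', st' d = v -> agree d st st' -> guar t (K, st') (phi v).

(** The rest of the run is the stack [K]; [must] provides its guarantee at every possible result, so
    sequencing is plain induction on [e]. The bound [3 < d] protects variable 3, hence the loop
    count is the same throughout. *)
Lemma compile_sound e del d st r K t phi :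
  (3 < d)%N -> located del d st r ->
  must f (nodes (st 3%N)) e r (next t K d st phi) ->
  guar (cost (nodes (st 3%N)) e + t) (compile e del d :: K, st)
    (wp f D (nodes (st 3%N)) e r phi).
Proof.
elim: e del d st r K t phi => [x||a ha b hb|a ha|a ha|c hc a ha b hb
   |x a ha b hb|x a ha b hb|||a ha] del d st r K t phi hd hl /= hn.
- rewrite add1n; apply: guar_step; first by [].
  have [h1 h2] := hl x; apply: hn; first by rewrite upd_eq.
  by move=> i hi; rewrite upd_neq //; lia.
- rewrite add1n; apply: guar_step; first by [].
  by apply: hn; [rewrite upd_eq|move=> i hi; rewrite upd_neq //; lia].
- apply: (@guar_leq (cost (nodes (st 3%N)) a +
            (1 + (cost (nodes (st 3%N)) b + (1 + t)))).+1); first lia.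
  apply: guar_step; first by [].
  apply: (ha _ _ _ r) => //; move: hn; apply: must_mono => u hn st1 hu ag1.
  apply: guar_step; first by [].
  have e3 : st1 3%N = st 3%N by apply: ag1.
  rewrite -e3.
  apply: (hb _ _ _ r); [lia| |].
    by apply: located_agree ag1 hl; lia.
  rewrite e3; move: hn; apply: must_mono => v hn st2 hv ag2; apply: guar_step; first by [].
  apply: hn; first by rewrite upd_eq /= hv ag2 ?hu.
  by move=> i hi; rewrite upd_neq ?ag2 ?ag1 //; lia.
- apply: (@guar_leq (cost (nodes (st 3%N)) a + (1 + t)).+1); first lia.
  apply: guar_step; first by [].
  apply: (ha _ _ _ r) => //; move: hn; apply: must_mono => u hn st1 hu ag1.
  apply: guar_step; first by [].
  apply: hn; first by rewrite upd_eq /= hu.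
  by move=> i hi; rewrite upd_neq ?ag1 //; lia.
- apply: (@guar_leq (cost (nodes (st 3%N)) a + (1 + t)).+1); first lia.
  apply: guar_step; first by [].
  apply: (ha _ _ _ r) => //; move: hn; apply: must_mono => u hn st1 hu ag1.
  apply: guar_step; first by [].
  apply: hn; first by rewrite upd_eq /= hu.
  by move=> i hi; rewrite upd_neq ?ag1 //; lia.
- apply: (@guar_leq (cost (nodes (st 3%N)) c + (1 +
     (maxn (cost (nodes (st 3%N)) a) (cost (nodes (st 3%N)) b) + t))).+1); first lia.
  apply: guar_step; first by [].
  apply: (hc _ _ _ r) => //; move: hn; apply: must_mono => u hn st1 hu ag1.
  apply: guar_step; first by [].
  have e3 : st1 3%N = st 3%N by apply: ag1.
  have hl1 : located del d st1 r by apply: located_agree hl.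
  have hn1 v : next t K d st phi v -> next t K d st1 phi v.
    by move=> h st2 hv ag2; apply: h => // i hi; rewrite ag2 ?ag1.
  rewrite /= hu; move: hn; rewrite -e3; case: (truthy u) => /(must_mono _ _ _ _ _ _ hn1) hn.
  + by apply: (@guar_leq (cost (nodes (st1 3%N)) a + t)); [lia|apply: ha].
  + by apply: (@guar_leq (cost (nodes (st1 3%N)) b + t)); [lia|apply: hb].
- apply: (@guar_leq (cost (nodes (st 3%N)) a +
            (1 + (cost (nodes (st 3%N)) b + (1 + t)))).+1); first lia.
  apply: guar_step; first by [].
  apply: (ha _ _ _ r) => //; move: hn; apply: must_mono => u hn st1 hu ag1.
  apply: guar_step; first by [].
  have e3 : st1 3%N = st 3%N by apply: ag1.
  rewrite -e3; apply: hb; [lia| |].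
    exact: located_put hl ag1 hu.
  rewrite e3; move: hn; apply: must_mono => v hn st2 hv ag2; apply: guar_step; first by [].
  apply: hn; first by rewrite upd_eq /= hv.
  by move=> i hi; rewrite upd_neq ?ag2 ?ag1 //; lia.
- set N := nodes (st 3%N).
  apply: (@guar_leq (cost N a + (1 + (1 + (N * (cost N b + 10) + (1 + t))))).+1); first lia.
  apply: guar_step; first by [].
  apply: (ha _ _ _ r) => //; move: hn; apply: must_mono => u hn st1 hu ag1.
  do 2 (apply: guar_step; first by []).
  set st2 := upd st1 _ _.
  have ag2 : agree d.+1 st1 st2.
    by move=> i hi; rewrite /st2 upd_neq //; lia.
  have e3 : st1 3%N = st 3%N by apply: ag1.
  have hst2 : stack_nodes (st2 d.+1) = N by rewrite /st2 upd_eq /= e3 addn0.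
  have hu2 : st2 d = u by rewrite ag2.
  have agu : agree d st st2 by move=> i hi; rewrite ag2 ?ag1 //; lia.
  (* The [While] loop is handled by induction on the number of nodes still on the stack, for an
     arbitrary loop state. *)
  suff main m : forall u' st', agree d st st' -> st' d = u' ->
      stack_nodes (st' d.+1) = m ->
      loopM m (fun v post => must f N b (bind_var r x v) post) u' (next t K d st phi) ->
      guar (m * (cost N b + 10) + (1 + t)) (While (Var d.+1)
          (Seq (Assign d.+2 (Hd (Var d.+1)))
          (Seq (Assign d.+1 (Tl (Var d.+1)))
          (Seq (If (Var d.+2)
                 (Assign d.+1 (Defs.Cons (Hd (Var d.+2))
                                (Defs.Cons (Tl (Var d.+2)) (Var d.+1))))
                 (Assign d.+2 Defs.Nil))
          (Seq (compile b (bind_var del x d) d.+2)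
               (Assign d (Var d.+2)))))) :: K, st')
        (loopM m (fun v phi => wp f D N b (bind_var r x v) phi) u' phi).
    exact: main.
  clear hn st1 ag1 hu e3 st2 ag2 hst2 hu2 agu u.
  elim: m => [|m ih] u st2 ag2 hu hs /= hn.
    rewrite mul0n add0n add1n; apply: guar_step; first by rewrite /=.
    have -> : truthy (expr_eval (Var d.+1) st2) = false.
      rewrite /=; case: (st2 d.+1) hs => //= [[|? ?] ?] /=; lia.
    exact: hn.
  have e3 : st2 3%N = st 3%N by apply: ag2.
  rewrite mulSn.
  have : exists x1 x2, st2 d.+1 = Node x1 x2.
    by case: (st2 d.+1) hs => //= x1 x2 _; exists x1, x2.
  move=> [x1 [x2 hst]].
  apply: (@guar_leq (9 + (cost N b + (1 + (m * (cost N b + 10) + (1 + t)))))%N); first lia.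
  rewrite !addSn add0n.
  apply: guar_step; first by rewrite /= hst.
  apply: guar_step; first by [].
  apply: guar_step; first by [].
  apply: guar_step; first by [].
  apply: guar_step; first by [].
  apply: guar_step; first by [].
  apply: guar_step; first by [].
  set st3 := upd (upd _ _ _) _ _.
  have h31 : st3 d.+1 = x2 by rewrite /st3 upd_eq /= upd_neq ?hst //; lia.
  have h32 : st3 d.+2 = x1.
    by rewrite /st3 upd_neq ?upd_eq /= ?hst //; lia.
  have ag3 : agree d.+1 st2 st3.
    by move=> i hi; rewrite /st3 !upd_neq //; lia.
  set c := (if _ then _ else _).
  have [st4 [tr hs4 ag4]] : exists st4, [/\
      forall K', transition f (c :: K', st3) = Step n (K', st4),
      stack_nodes (st4 d.+1) = m & agree d.+1 st3 st4].
    rewrite /c /= h32; case: x1 hst h32 {c} => [|y1 y2] hst h32 /=.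
      exists (upd st3 d.+2 Leaf); split => //.
        rewrite upd_neq ?h31; last lia.
        by move: hs; rewrite hst /=; lia.
      by move=> i hi; rewrite upd_neq //; lia.
    exists (upd st3 d.+1 (Node (Defs.hd (st3 d.+2)) (Node (Defs.tl (st3 d.+2)) (st3 d.+1)))).
    split => //.
      rewrite upd_eq h32 h31 /=.
      by move: hs; rewrite hst /=; lia.
    by move=> i hi; rewrite upd_neq //; lia.
  apply: guar_step; first exact: tr.
  apply: guar_step; first by [].
  have e4 : st4 3%N = st 3%N by rewrite ag4 ?ag3 //; lia.
  rewrite /N -e4; apply: hb; [lia| |].
    apply: (@located_agree _ d.+1 _ st4); [lia|by []|].
    apply: (located_put _ _ st); first exact: hl.
      by move=> i hi; rewrite ag4 ?ag3 ?ag2 //; lia.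
    by rewrite ag4 ?ag3.
  rewrite e4; move: hn; apply: must_mono => v hn st5 hv ag5; rewrite ?add1n ?add0n.
  apply: guar_step; first by [].
  apply: ih.
  - by move=> i hi; rewrite upd_neq ?ag5 ?ag4 ?ag3 ?ag2 //; lia.
  - by rewrite upd_eq /= hv.
  - by rewrite upd_neq ?ag5 //; lia.
  - exact: hn.
- rewrite add1n; apply: guar_flip => b.
  by apply: hn; [rewrite upd_eq|move=> i hi; rewrite upd_neq //; lia].
- rewrite add1n; apply: guar_sample => y.
  by apply: hn; [rewrite upd_eq|move=> i hi; rewrite upd_neq //; lia].
- apply: (@guar_leq (cost (nodes (st 3%N)) a + (1 + t)).+1); first lia.
  apply: guar_step; first by [].
  apply: (ha _ _ _ r) => //; move: hn; apply: must_mono => u hn st1 hu ag1.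
  apply: guar_step; first by [].
  apply: hn; first by rewrite upd_eq /= hu.
  by move=> i hi; rewrite upd_neq ?ag1 //; lia.
Qed.

End Compile.


(** * Library of the language *)

Notation "$ x" := (EVar x) (at level 5, x at level 0, format "$ x").

(* Name 0 holds the state of the innermost loop and name 1 the output of the
   innermost map; programs use larger names. *)
Definition EFold (x s : nat) (l s0 body : prog) : prog :=
  ETl (ELoop 0 (ECons l s0)
    (EIf (EHd $0)
       (ECons (ETl (EHd $0))
          (ELet x (EHd (EHd $0)) (ELet s (ETl $0) body)))
       $0)).

Definition etrue : prog := ECons ENil ENil.
Definition enot (b : prog) : prog := EIf b ENil etrue.
Definition erev (l : prog) : prog := EFold 12 13 l ENil (ECons $12 $13).
Definition emap (x : nat) (l body : prog) : prog :=
  erev (EFold x 1 l ENil (ECons body $1)).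
Definition ezip (l1 l2 : prog) : prog :=
  erev (ETl (EFold 14 15 l1 (ECons l2 ENil)
    (ECons (ETl (EHd $15)) (ECons (ECons $14 (EHd (EHd $15))) (ETl $15))))).
Definition eall (x : nat) (l body : prog) : prog :=
  EFold x 1 l etrue (EIf body $1 ENil).
Definition erare (j : prog) : prog :=
  EFold 16 17 j etrue (EIf EFlip $17 ENil).

Fixpoint foldM {X V R : Type} (g : X -> V -> (V -> R) -> R) (xs : seq X) (v : V)
    (phi : V -> R) : R :=
  if xs is x :: xs' then g x v (fun v' => foldM g xs' v' phi) else phi v.

Fixpoint mapM {X Y R : Type} (g : X -> (Y -> R) -> R) (xs : seq X)
    (phi : seq Y -> R) : R :=
  if xs is x :: xs' then g x (fun y => mapM g xs' (fun ys => phi (y :: ys)))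
  else phi [::].

Definition entab {n : nat} (g : 'I_n -> tree) : tree :=
  enc_list [seq g i | i <- enum 'I_n].

Lemma enc_cubeE {n : nat} (y : cube n) :
  enc_cube y = entab (fun i => enc_bool (tnth y i)).
Proof.
rewrite /enc_cube /entab; congr enc_list.
by rewrite -[in LHS](map_tnth_enum y) -map_comp.
Qed.

Lemma enc_cube_mktuple {n : nat} (g : 'I_n -> bool) :
  enc_cube [tuple g i | i < n] = entab (fun i => enc_bool (g i)).
Proof.
by rewrite enc_cubeE; congr enc_list; apply: eq_map => i; rewrite tnth_mktuple.
Qed.

Lemma dec_enc_cube {n : nat} (x : cube n) : dec_cube n (enc_cube x) = x.
Proof.
apply: eq_from_tnth => i; rewrite tnth_mktuple (tnth_nth false).
rewrite /enc_cube; set k := nat_of_ord i; rewrite -[val i]/k.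
have: (k < size x)%N by rewrite size_tuple ltn_ord.
move: k => k.
elim: (val x) k => [|b s ih] [|k]; [by []|by []| |].
  by move=> _; case: b.
by move=> hk; rewrite iterSr /= ih.
Qed.

Section Lib.
Context {R : realType} {n : nat}.
Variables (f : cube n -> bool) (D : cube n -> R) (B : nat).
Local Notation wp := (wp f D B).

Lemma wp_fold_take {X V : Type} (eX : X -> tree) (eV : V -> tree)
    (g : X -> V -> (V -> R) -> R) x s l s0 body r xs v0 phi :
  Nat.eqb 0 x = false ->
  (forall psi, wp l r psi = psi (enc_list (map eX xs))) ->
  (forall psi, wp s0 r psi = psi (eV v0)) ->
  (forall w t v psi,
     wp body (bind_var (bind_var (bind_var r 0 w) x (eX t)) s (eV v)) psi
     = g t v (fun v' => psi (eV v'))) ->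
  wp (EFold x s l s0 body) r phi = foldM g (take B xs) v0 (fun v => phi (eV v)).
Proof.
move=> hx hl hs hb; rewrite /EFold /= hl hs.
set h := (X in loopM _ X _ _).
have h0 v psi : h (Node Leaf v) psi = psi (Node Leaf v) by [].
have h1 t rest v psi : h (Node (Node (eX t) rest) (eV v)) psi
    = g t v (fun v' => psi (Node rest (eV v'))).
  rewrite /h /=.
  have e w u : bind_var (bind_var r 0 w) x u 0 = w by rewrite /bind_var hx.
  by rewrite e hb.
clearbody h; clear hl hs hb; elim: xs B v0 => [|t ts ih] m v0 /=.
  by elim: m => [|m ihm] //=; rewrite h0.
case: m => [//|m] /=; rewrite h1 //.
by congr (g t v0 _); apply/funext => v; apply: ih.
Qed.

Lemma wp_fold {X V : Type} (eX : X -> tree) (eV : V -> tree)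
    (g : X -> V -> (V -> R) -> R) x s l s0 body r xs v0 phi :
  Nat.eqb 0 x = false ->
  (forall psi, wp l r psi = psi (enc_list (map eX xs))) ->
  (forall psi, wp s0 r psi = psi (eV v0)) ->
  (size xs <= B)%N ->
  (forall w t v psi,
     wp body (bind_var (bind_var (bind_var r 0 w) x (eX t)) s (eV v)) psi
     = g t v (fun v' => psi (eV v'))) ->
  wp (EFold x s l s0 body) r phi = foldM g xs v0 (fun v => phi (eV v)).
Proof.
move=> hx hl hs hB hb.
by rewrite (wp_fold_take eX eV g _ _ _ _ _ _ xs v0) // take_oversize.
Qed.

Definition computes (e : prog) (r : env) (v : tree) : Prop :=
  forall phi, wp e r phi = phi v.

Lemma tl_computes e r v : computes e r v -> computes (ETl e) r (Defs.tl v).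
Proof. by move=> he phi; rewrite -(he (fun v => phi (Defs.tl v))). Qed.

Lemma fold_take_computes {X V : Type} (eX : X -> tree) (eV : V -> tree)
    (g : X -> V -> V) x s l s0 body r xs v0 :
  Nat.eqb 0 x = false ->
  computes l r (enc_list (map eX xs)) -> computes s0 r (eV v0) ->
  (forall w t v,
     computes body (bind_var (bind_var (bind_var r 0 w) x (eX t)) s (eV v))
       (eV (g t v))) ->
  computes (EFold x s l s0 body) r
    (eV (foldl (fun v t => g t v) v0 (take B xs))).
Proof.
move=> hx hl hs hb phi.
rewrite (wp_fold_take eX eV (fun t v psi => psi (g t v)) _ _ _ _ _ _ _ _ _ hx hl hs).
  by elim: (take B xs) (v0) => [|t ts ih] v //=; rewrite ih.
by [].
Qed.

Lemma fold_computes {X V : Type} (eX : X -> tree) (eV : V -> tree)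
    (g : X -> V -> V) x s l s0 body r xs v0 :
  Nat.eqb 0 x = false ->
  computes l r (enc_list (map eX xs)) -> computes s0 r (eV v0) ->
  (size xs <= B)%N ->
  (forall w t v,
     computes body (bind_var (bind_var (bind_var r 0 w) x (eX t)) s (eV v))
       (eV (g t v))) ->
  computes (EFold x s l s0 body) r (eV (foldl (fun v t => g t v) v0 xs)).
Proof.
move=> hx hl hs hB hb; have := fold_take_computes eX eV g _ _ _ _ _ _ _ _ hx hl hs hb.
by rewrite take_oversize.
Qed.

Lemma erev_computes l r ts :
  computes l r (enc_list ts) -> (size ts <= B)%N ->
  computes (erev l) r (enc_list (rev ts)).
Proof.
move=> hl hB.
have -> : rev ts = foldl (fun v t => t :: v) [::] ts.
  rewrite -[LHS]cats0; elim: ts [::] {hl hB} => [|t ts ih] v //=.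
  by rewrite -ih rev_cons cat_rcons.
apply: (fold_computes id enc_list (fun t v => t :: v)) => //.
by rewrite map_id.
Qed.

Lemma wp_erev l r phi : wp (erev l) r phi = wp l r (fun v =>
   wp (erev $0) (bind_var r 0 v) phi).
Proof. by []. Qed.

Lemma wp_map {X Y : Type} (eX : X -> tree) (eY : Y -> tree)
    (g : X -> (Y -> R) -> R) x l body r xs phi :
  Nat.eqb 0 x = false ->
  computes l r (enc_list (map eX xs)) ->
  (size xs <= B)%N ->
  (forall w w' t psi,
     wp body (bind_var (bind_var (bind_var r 0 w) x (eX t)) 1 w') psi
     = g t (fun v => psi (eY v))) ->
  wp (emap x l body) r phi = mapM g xs (fun ys => phi (enc_list (map eY ys))).
Proof.
move=> hx hl hB hb; rewrite /emap wp_erev.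
rewrite (wp_fold eX (fun ys => enc_list (map eY ys))
  (fun t ys psi => g t (fun v => psi (v :: ys))) _ _ _ _ _ _ _ [::] _ hx hl) //; last first.
  by move=> w t v psi /=; rewrite hb.
set W := (X in foldM _ _ _ X).
have hW ys : (size ys <= B)%N -> W ys = phi (enc_list (map eY (rev ys))).
  move=> hs; rewrite map_rev /W.
  by apply: (@erev_computes $0 _ (map eY ys)); rewrite ?size_map.
clearbody W; suff main ts ys : (size ts + size ys <= B)%N ->
  foldM (fun t ys psi => g t (fun v => psi (v :: ys))) ts ys W =
  mapM g ts (fun zs => phi (enc_list [seq eY i | i <- rev ys ++ zs])).
  by rewrite main ?addn0.
elim: ts ys => [|t ts ih] ys /= hs; first by rewrite cats0 hW.
congr (g t _); apply/funext => y; rewrite ih /=; last by lia.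
by congr (mapM g ts _); apply/funext => zs; rewrite rev_cons cat_rcons.
Qed.

Hypothesis nB : (n <= B)%N.

Lemma zip_computes (g1 g2 : 'I_n -> tree) l1 l2 r :
  computes l1 r (entab g1) -> computes l2 r (entab g2) ->
  computes (ezip l1 l2) r (entab (fun i => Node (g1 i) (g2 i))).
Proof.
move=> h1 h2; rewrite /ezip.
set hh := fun i => Node (g1 i) (g2 i).
have sz : (size (enum 'I_n) <= B)%N by rewrite size_enum_ord.
rewrite /entab -[map hh _]revK; apply: erev_computes; last first.
  by rewrite size_rev size_map.
pose eV (v : seq 'I_n * seq 'I_n) :=
  Node (enc_list (map g2 v.1)) (enc_list (map hh v.2)).
suff h : computes (EFold 14 15 l1 (ECons l2 ENil)
    (ECons (ETl (EHd $15)) (ECons (ECons $14 (EHd (EHd $15))) (ETl $15)))) r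
    (eV ([::], rev (enum 'I_n))).
  by rewrite -map_rev; exact: tl_computes h.
move=> phi.
have hw := wp_fold g1 (fun v : tree => v)
   (fun i v psi => psi (Node (tl (Defs.hd v)) (Node (Node (g1 i) (Defs.hd (Defs.hd v))) (tl v))))
   14 15 l1 (ECons l2 ENil) _ r (enum 'I_n) (eV (enum 'I_n, [::])) phi erefl h1.
rewrite hw //; last by move=> psi /=; rewrite h2.
clear hw; set g := (X in foldM X); rewrite -[in RHS](cats0 (rev _)).
suff main (js acc : seq 'I_n) :
    foldM g js (eV (js, acc)) phi = phi (eV ([::], rev js ++ acc)) by exact: main.
elim: js acc => [|i js ih] acc //.
by rewrite rev_cons cat_rcons -ih.
Qed.

Lemma eall_computes (g : 'I_n -> tree) (p : 'I_n -> bool) x l body r :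
  Nat.eqb 0 x = false ->
  computes l r (entab g) ->
  (forall w w' i, computes body
     (bind_var (bind_var (bind_var r 0 w) x (g i)) 1 w') (enc_bool (p i))) ->
  computes (eall x l body) r (enc_bool [forall i, p i]).
Proof.
move=> hx hl hb.
have -> : [forall i, p i] = foldl (fun v i => p i && v) true (enum 'I_n).
  have -> : [forall i, p i] = all p (enum 'I_n).
    apply/forallP/allP => h i; first by rewrite h.
    by apply: h; rewrite mem_enum.
  rewrite -[LHS]andbT; elim: (enum 'I_n) true => [|i s ih] v //=.
  by rewrite -ih; case: (p i); case: v; rewrite ?andbF.
apply: (fold_computes g enc_bool (fun i v => p i && v)) => //.
  by rewrite size_enum_ord.
by move=> w i v phi /=; rewrite hb; case: (p i); case: v.
Qed.

Lemma wp_rare j r m phi :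
  computes j r (enc_nat m) ->
  wp (erare j) r phi = (2^-1) ^+ minn m B * phi (enc_bool true)
    + (1 - (2^-1) ^+ minn m B) * phi (enc_bool false).
Proof.
move=> hj; rewrite /erare.
rewrite (wp_fold_take (fun _ : nat => Leaf) enc_bool
  (fun _ b psi => (psi b + psi false) / 2) _ _ _ _ _ _ (iota 0 m) true).
- have -> : minn m B = size (take B (iota 0 m)).
    by rewrite size_take size_iota /minn; case: ltngtP => //; lia.
  elim: (take B _) => [|k ks ih] /=.
    by rewrite expr0; ring.
  rewrite ih exprS.
  suff -> : foldM (fun (_ : nat) b (psi : bool -> R) => (psi b + psi false) / 2)
      ks false (fun v => phi (enc_bool v)) = phi (enc_bool false) by field.
  by elim: ks {ih} => //= k' ks ->; field.
- by [].
- move=> psi; rewrite hj /enc_nat; congr (psi (enc_list _)).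
  by rewrite -[RHS]/(map _ _); elim: (m) (0%N) => //= m' ih k; rewrite -ih.
- by [].
- by move=> w t v psi /=; case: v.
Qed.

End Lib.

Arguments bind_var {A} r x v y /.
Global Opaque EFold erev emap ezip eall erare.


(** * The learner *)

(* Names shared by all programs: 5 the parameter [a] in unary, 6 and 7 the
   numbers [n] and [s], 8 the number of greedy rounds per term, 9 the current
   width, 10 the empty term, 11 the sample, 33 the list being learnt.  A term is
   a list of pairs of flags, so that $21 zipped with a point $20 is scanned
   coordinatewise. *)
Definition emasked (p : prog) : prog := EIf (EHd p) etrue (EIf (ETl p) etrue ENil).

Definition enoise : prog :=
  emap 23 (ezip $21 $20)
    (EIf (emasked (EHd $23)) (ETl $23)
       (EIf (erare $22) (enot (ETl $23)) (ETl $23))).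

Definition eover : prog :=
  emap 23 (ezip $20 $21)
    (EIf (EHd (EHd $23)) etrue (EIf (ETl (EHd $23)) ENil (ETl $23))).

Definition esat : prog :=
  eall 23 (ezip $20 $21)
    (EIf (ETl $23) (enot (ETl (EHd $23))) (enot (EHd (EHd $23)))).

Definition eeqb (a b : prog) : prog := EIf a b (enot b).

Definition eeqt : prog :=
  eall 23 (ezip $20 $21)
    (EIf (eeqb (EHd (EHd $23)) (EHd (ETl $23)))
         (eeqb (ETl (EHd $23)) (ETl (ETl $23))) ENil).

Definition emem : prog :=
  EFold 20 26 $25 ENil (EIf (ELet 21 $24 eeqt) etrue $26).

(** A zipper: the state holds the reversed prefix, the remaining suffix and the output. The queried
    point is obtained by folding the prefix back onto the negated bit and the suffix. *)
Definition esens : prog :=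
  erev (ETl (ETl (EFold 23 24 $20 (ECons ENil (ECons $20 ENil))
    (ELet 25 (ETl (EHd (ETl $24)))
      (ECons (ECons $23 (EHd $24))
        (ECons $25
          (ECons (EIf (EQuery (EFold 26 27 (EHd $24)
                                 (ECons (enot $23) $25) (ECons $26 $27)))
                    (ECons ENil ENil) (ECons $23 (enot $23)))
             (ETl (ETl $24))))))))).

(** Each entry of the list overwrites the candidate with small probability, so the initial term and
    every entry are possible outcomes. *)
Definition epick : prog :=
  EFold 23 24 $29 $28 (EIf (erare $5) $23 $24).

Definition eflipbit (b : prog) : prog := EIf (erare $5) (enot b) b.

Definition eedit : prog :=
  emap 23 $20 (ECons (eflipbit (EHd $23)) (eflipbit (ETl $23))).

Definition ephase : prog :=
  EIf EFlip (ECons $31 $32)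
    (ELet 21 (ELet 28 $32 (ELet 29 $33 epick))
      (ELet 20 (ELet 20 $31 (ELet 22 $30 enoise))
        (ELet 20 (ELet 21 $10 (ELet 22 $5 enoise))
           (ECons $20 esens)))).

Definition eattempt : prog :=
  ELet 45 (EFold 41 42 $5 (ECons $5 (ECons $40 $10))
      (ECons (ETl (EHd $42))
         (ELet 30 (EHd $42) (ELet 31 (EHd (ETl $42))
            (ELet 32 (ETl (ETl $42)) ephase)))))
    (ELet 20 (ELet 28 (ETl (ETl $45)) (ELet 29 $33 epick)) eedit).

Definition ecount : prog :=
  EFold 23 24 $20 ENil
    (ELet 25 (EIf (EHd $23) (ECons ENil $24) $24)
       (EIf (ETl $23) (ECons ENil $25) $25)).

(** Truncated subtraction: what remains of [v] is truthy exactly when [u] is the shorter list. *)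
Definition eless (u v : prog) : prog := EFold 23 24 u v (ETl $24).

(** Each round queries the term completed by uniform bits: rate one half is the unary 1 bound to
    name 22. The unary [n] in name 6 doubles as the all-zero point, by [enc_zeros]. *)
Definition evalid : prog :=
  ELoop 51 etrue
    (EIf $51
      (EQuery (ELet 21 $50
        (ELet 20 (ELet 20 $50 (ELet 21 $6 eover)) (ELet 22 etrue enoise))))
      ENil).

Definition etrial : prog :=
  ELet 50 eattempt
    (ELet 52 (ELet 20 $50 ecount)
      (EIf (eless $52 $9) $33
        (EIf (eless $9 $52) $33
          (EIf (ELet 24 $50 (ELet 25 $33 emem)) $33
            (EIf evalid (ECons $50 $33) $33))))).

Definition elearn : prog :=
  EFold 61 62 $11 ENil
    (EIf (ETl $61) (ELet 40 (EHd $61) (ELoop 33 $62 etrial)) $62).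

(** The width is unknown, so a list is learnt for every width from 1 to [n], and the greedy cover
    draws on all of them. *)
Definition elearnall : prog :=
  EFold 9 64 (EFold 62 63 $6 ENil (ECons (ECons ENil (EHd $63)) $63)) ENil
    (ECons elearn $64).

Definition efilter (l t : prog) : prog :=
  EFold 65 66 l ENil
    (EIf (ELet 20 t (ELet 21 $65 esat)) $66 (ECons $65 $66)).

Definition elabel (b : bool) : prog :=
  EFold 67 68 $11 ENil
    (EIf (if b then ETl $67 else enot (ETl $67)) (ECons (EHd $67) $68) $68).

Definition econsistent (t : prog) : prog :=
  EFold 69 70 $72 etrue
    (EIf (ELet 20 t (ELet 21 $69 esat)) ENil $70).

Definition ebest : prog :=
  EFold 74 75 $71 (ECons $73 ENil)
    (EFold 76 77 $74 $75
      (EIf (econsistent $76)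
        (ELet 78 (efilter $73 $76)
           (EIf (eless $78 (EHd $77)) (ECons $78 (ECons $76 ENil)) $77))
        $77)).

Definition egreedy : prog :=
  EFold 80 81 $8 (ECons (elabel true) ENil)
    (EFold 82 83 $7 $81
      (ELet 73 (EHd $83)
        (ELet 84 ebest
          (EIf (ETl $84)
             (ECons (EHd $84) (ECons (EHd (ETl $84)) (ETl $83)))
             $83)))).

Definition emain : prog :=
  ELet 10 (emap 85 $6 (ECons ENil ENil))
    (ELet 11 (ELoop 86 ENil (ECons ESample $86))
      (ELet 72 (elabel false)
        (ELet 71 elearnall (ETl egreedy)))).

(** * Expectation transformers of the subroutines *)

Definition masked {n : nat} (A : term n) (i : 'I_n) : bool :=
  ((i, true) \in A) || ((i, false) \in A).

Definition override {n : nat} (T : term n) (x : cube n) : cube n :=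
  [tuple if (i, true) \in T then true else
         if (i, false) \in T then false else tnth x i | i < n].

Definition flipc {n : nat} (y : cube n) (i : 'I_n) : cube n :=
  [tuple if j == i then ~~ tnth y j else tnth y j | j < n].

Section Functional.
Context {R : realType} {n : nat}.
Variables (f : cube n -> bool) (D : cube n -> R) (B : nat).

Definition flip_weight (j : nat) (A : term n) (y : cube n) (i : 'I_n) (b : bool) : R :=
  if masked A i then (b == tnth y i)%:R
  else if b == tnth y i then 1 - 2^-1 ^+ j else 2^-1 ^+ j.

Definition noiseM (j : nat) (A : term n) (y : cube n) (phi : cube n -> R) : R :=
  \sum_z (\prod_i flip_weight j A y i (tnth z i)) * phi z.

Definition sens (y : cube n) : term n :=
  [set l : literal n | (l.2 == tnth y l.1) && ~~ f (flipc y l.1)].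

Definition rareM (a : nat) (phi : bool -> R) : R :=
  2^-1 ^+ a * phi true + (1 - 2^-1 ^+ a) * phi false.

Definition pickM (a : nat) (A : term n) (L : dnf n) (phi : term n -> R) : R :=
  foldM (fun T A phi => rareM a (fun b => phi (if b then T else A))) (take B L) A phi.

Definition bitM (a : nat) (b : bool) (phi : bool -> R) : R :=
  rareM a (fun c => phi (c (+) b)).

Definition term_of (bs : seq (bool * bool)) : term n :=
  [set l : literal n | let p := nth (false, false) bs l.1 in
                       if l.2 then p.1 else p.2].

Definition editM (a : nat) (T : term n) (phi : term n -> R) : R :=
  mapM (fun i phi => bitM a ((i, true) \in T) (fun b =>
                     bitM a ((i, false) \in T) (fun c => phi (b, c))))
    (enum 'I_n) (fun bs => phi (term_of bs)).

(** The leading [phi v] is the skipped phase. The second noise, at rate [2^-a] and with nothing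
    protected, stands for a guess of the few extra bit flips. *)
Definition phaseM (a j : nat) (L : dnf n) (v : cube n * term n)
    (phi : cube n * term n -> R) : R :=
  (phi v + pickM a v.2 L (fun A =>
     noiseM j A v.1 (fun y1 => noiseM a set0 y1 (fun y2 =>
       phi (y2, sens y2))))) / 2.

Fixpoint phasesM (a j : nat) (L : dnf n) (v : cube n * term n)
    (phi : cube n * term n -> R) : R :=
  if j is j'.+1 then phaseM a j L v (fun v' => phasesM a j' L v' phi)
  else phi v.

Definition attemptM (a : nat) (x : cube n) (L : dnf n) (phi : term n -> R) : R :=
  phasesM a a L (x, set0) (fun v => pickM a v.2 L (fun A => editM a A phi)).

Definition zeros : cube n := [tuple false | i < n].

Definition validM (T : term n) (phi : bool -> R) : R :=
  loopM B (fun v phi => if v then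
     noiseM 1 T (override T zeros) (fun z => phi (f z)) else phi false) true phi.

Definition trialM (a k : nat) (x : cube n) (L : dnf n) (phi : dnf n -> R) : R :=
  attemptM a x L (fun T =>
    if (#|T| == k) && (T \notin take B L)
    then validM T (fun b => phi (if b then T :: L else L)) else phi L).

Definition learnM (a k : nat) (S : seq (cube n * bool)) (phi : dnf n -> R) : R :=
  foldM (fun x L phi => if x.2 then loopM B (trialM a k x.1) L phi else phi L)
    S [::] phi.

Definition learnallM (a : nat) (S : seq (cube n * bool)) (phi : seq (dnf n) -> R) : R :=
  foldM (fun (i : 'I_n) Ls phi => learnM a i.+1 S (fun L => phi (L :: Ls)))
    (rev (enum 'I_n)) [::] phi.

(** [rev] and [take B] mirror the fold of [efilter], which reverses its input and reads at most [B]
    entries. *)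
Definition uncovered (T : term n) (U : seq (cube n)) : seq (cube n) :=
  rev [seq x <- take B U | ~~ term_eval T x].

Definition consistent (T : term n) (N : seq (cube n)) : bool :=
  ~~ has (term_eval T) N.

Definition better (N U : seq (cube n)) (v : seq (cube n) * seq (term n)) (T : term n) :=
  if consistent T N && (size (uncovered T U) < size v.1)%N
  then (uncovered T U, [:: T]) else v.

Definition best (N : seq (cube n)) (Ls : seq (dnf n)) (U : seq (cube n)) :=
  foldl (fun v L => foldl (better N U) v (take B L)) (U, [::]) Ls.

Definition greedy_step (N : seq (cube n)) (Ls : seq (dnf n))
    (v : seq (cube n) * dnf n) : seq (cube n) * dnf n :=
  if (best N Ls v.1).2 is T :: _ then ((best N Ls v.1).1, T :: v.2) else v.

Definition labelled (b : bool) (S : seq (cube n * bool)) : seq (cube n) :=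
  rev [seq x.1 | x <- S & x.2 == b].

Definition greedy (m : nat) (N : seq (cube n)) (Ls : seq (dnf n)) (U : seq (cube n)) :=
  iter m (greedy_step N Ls) (U, [::]).

Definition sampleM (m : nat) (phi : seq (cube n * bool) -> R) : R :=
  loopM m (fun S phi => \sum_x D x * phi ((x, f x) :: S)) [::] phi.

Definition mainM (a m : nat) (phi : dnf n -> R) : R :=
  sampleM B (fun S => learnallM a S (fun Ls =>
    phi (greedy m (labelled false S) Ls (labelled true S)).2)).
End Functional.


(** Fubini on the cube: it turns the coordinatewise sampling of the program into the product weights
    of [noiseM]. Induction on [n] splits off the first coordinate. *)
Lemma mapM_mapM_cube {R : realType} {n : nat} (w : 'I_n -> bool -> R)
    (phi : seq bool -> R) :
  mapM (fun i psi => \sum_b w i b * psi b) (enum 'I_n) phi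
  = \sum_(z : cube n) (\prod_i w i (tnth z i)) * phi z.
Proof.
have mapM_comp (X Y : Type) (t : Y -> X) (g : X -> (bool -> R) -> R) (ys : seq Y) psi :
    mapM g (map t ys) psi = mapM (fun y => g (t y)) ys psi.
  elim: ys psi => //= y ys ih psi; congr (g _ _); apply/funext => b; exact: ih.
elim: n w phi => [|n ih] w phi.
  have -> : enum 'I_0 = [::] by apply: size0nil; rewrite size_enum_ord.
  rewrite /= (eq_bigr (fun _ => phi [::])) => [|z _]; last first.
    by rewrite big_ord0 mul1r tuple0.
  by rewrite sumr_const card_tuple expn0.
rewrite enum_ordSl /=.
rewrite (eq_bigr (fun b => \sum_(z : cube n) (w ord0 b * (\prod_i w (lift ord0 i) (tnth z i)))
     * phi (b :: z))) => [|b _]; last first.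
  by rewrite mapM_comp ih mulr_sumr; apply: eq_bigr => z _; rewrite mulrA.
rewrite pair_big /=.
rewrite (reindex (fun p : bool * cube n => cons_tuple p.1 p.2)) /=; last first.
  exists (fun z : cube n.+1 => (thead z, behead_tuple z)) => [[b z]|z] _ /=.
    by congr pair; apply: val_inj.
  by rewrite [in RHS](tuple_eta z); apply: val_inj.
apply: eq_bigr => [[b z]] _ /=; rewrite big_ord_recl; congr (_ * _ * _).
by apply: eq_bigr => i _; rewrite !(tnth_nth false).
Qed.

Lemma enc_flipc {n : nat} (y : cube n) (i : 'I_n) :
  enc_list (map enc_bool (take i y ++ ~~ tnth y i :: drop i.+1 y))
  = enc_cube (flipc y i).
Proof.
rewrite /enc_cube; congr (enc_list (map _ _)).
have sy := size_tuple y; have hi := ltn_ord i.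
apply: (@eq_from_nth _ false) => [|j].
  by rewrite size_tuple size_cat /= size_take size_drop sy hi; lia.
rewrite size_cat /= size_take size_drop sy hi => hj.
have hj' : (j < n)%N by lia.
have -> : nth false (flipc y i) j = tnth (flipc y i) (Ordinal hj').
  by rewrite (tnth_nth false).
rewrite tnth_mktuple -val_eqE /= !(tnth_nth false) /=.
rewrite nth_cat size_take sy hi; case: ltngtP => h.
- by rewrite nth_take.
- have -> : (j - i = (j - i.+1).+1)%N by lia.
  by rewrite /= nth_drop; congr nth; lia.
- by rewrite h subnn.
Qed.

(** * Correctness of the subroutines on points and terms *)

Section Specs.
Context {R : realType} {n : nat}.
Variables (f : cube n -> bool) (D : cube n -> R) (B : nat).
Local Notation wp := (wp f D B).
Local Notation computes := (computes f D B).
Hypothesis nB : (n <= B)%N.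

Lemma wp_noise (r : env) j (A : term n) (y : cube n) phi :
  r 20%N = enc_cube y -> r 21%N = enc_term A -> r 22%N = enc_nat j ->
  wp enoise r phi = noiseM (minn j B) A y (fun z => phi (enc_cube z)).
Proof.
move=> hy hA hj; rewrite /enoise.
pose g1 i := Node (enc_bool ((i, true) \in A)) (enc_bool ((i, false) \in A)).
pose g2 i := enc_bool (tnth y i).
have hz : computes (ezip $21 $20) r (entab (fun i => Node (g1 i) (g2 i))).
  apply: zip_computes => // psi /=; first by rewrite hA.
  by rewrite hy enc_cubeE.
rewrite (wp_map f D B (fun i => Node (g1 i) (g2 i)) enc_bool
  (fun i psi => \sum_b flip_weight (minn j B) A y i b * psi b) 23 _ _ _ (enum 'I_n) phi erefl hz).
- by rewrite mapM_mapM_cube; apply: eq_bigr.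
- by rewrite size_enum_ord.
move=> w w' i psi /=; rewrite !big_bool /= /flip_weight /masked /g1 /g2.
case: (_ \in A) => /=; first by case: (tnth y i) => /=; ring.
case: (_ \in A) => /=; first by case: (tnth y i) => /=; ring.
rewrite (wp_rare f D B _ _ j) /=; last by move=> psi0 /=; rewrite hj.
by case: (tnth y i) => /=; ring.
Qed.

Lemma over_computes (r : env) (T : term n) (x : cube n) :
  r 20%N = enc_term T -> r 21%N = enc_cube x ->
  computes eover r (enc_cube (override T x)).
Proof.
move=> hT hx phi; rewrite /eover.
pose g1 i := Node (enc_bool ((i, true) \in T)) (enc_bool ((i, false) \in T)).
pose g2 i := enc_bool (tnth x i).
have hz : computes (ezip $20 $21) r (entab (fun i => Node (g1 i) (g2 i))).
  apply: zip_computes => // psi /=; first by rewrite hT.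
  by rewrite hx enc_cubeE.
rewrite (wp_map f D B (fun i => Node (g1 i) (g2 i)) enc_bool
  (fun i psi => psi (tnth (override T x) i)) 23 _ _ _ (enum 'I_n) phi erefl hz).
- rewrite enc_cubeE /entab map_comp.
  by elim: (enum 'I_n) phi => //= i s ih phi; rewrite (ih (fun t => phi (Node _ t))).
- by rewrite size_enum_ord.
move=> w w' i psi /=; rewrite tnth_mktuple.
by case: (_ \in T) => //=; case: (_ \in T).
Qed.

Lemma sat_computes (r : env) (T : term n) (x : cube n) :
  r 20%N = enc_term T -> r 21%N = enc_cube x ->
  computes esat r (enc_bool (term_eval T x)).
Proof.
move=> hT hx.
pose g1 i := Node (enc_bool ((i, true) \in T)) (enc_bool ((i, false) \in T)).
pose g2 i := enc_bool (tnth x i).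
have hz : computes (ezip $20 $21) r (entab (fun i => Node (g1 i) (g2 i))).
  apply: zip_computes => // psi /=; first by rewrite hT.
  by rewrite hx enc_cubeE.
have -> : term_eval T x = [forall i, (i, ~~ tnth x i) \notin T].
  apply/forall_inP/forallP => [h i|h [i b] hl].
    by apply/negP => /h; rewrite /lit_eval /=; case: (tnth x i).
  have := h i; rewrite /lit_eval /=; apply: contraR => hb.
  by move: hl hb; case: (tnth x i); case: b.
apply: (eall_computes f D B nB (fun i => Node (g1 i) (g2 i))) => // w w' i phi /=.
rewrite /g1 /g2 /=; case: (tnth x i) => /=; by case: (_ \in T).
Qed.

Lemma eqt_computes (r : env) (T T' : term n) :
  r 20%N = enc_term T -> r 21%N = enc_term T' ->
  computes eeqt r (enc_bool (T == T')).
Proof.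
move=> hT hT'.
pose g (T : term n) i := Node (enc_bool ((i, true) \in T)) (enc_bool ((i, false) \in T)).
have hz : computes (ezip $20 $21) r (entab (fun i => Node (g T i) (g T' i))).
  apply: zip_computes => // psi /=; first by rewrite hT.
  by rewrite hT'.
have -> : (T == T') = [forall i, (((i, true) \in T) == ((i, true) \in T')) &&
                              (((i, false) \in T) == ((i, false) \in T'))].
  apply/eqP/forallP => [-> i|h]; first by rewrite !eqxx.
  by apply/setP => [[i b]]; have /andP[/eqP h1 /eqP h2] := h i; case: b.
apply: (eall_computes f D B nB (fun i => Node (g T i) (g T' i))) => // w w' i phi /=.
rewrite /g /=; case: ((i, true) \in T); case: ((i, true) \in T');
  case: ((i, false) \in T); by case: ((i, false) \in T').
Qed.

Global Opaque enoise eover esat eeqt.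

Lemma mem_computes (r : env) (T : term n) (L : dnf n) :
  r 24%N = enc_term T -> r 25%N = enc_dnf L ->
  computes emem r (enc_bool (T \in take B L)).
Proof.
move=> hT hL.
have := fold_take_computes f D B (@enc_term n) enc_bool
  (fun T' b => (T' == T) || b) 20 26 $25 ENil
  (EIf (ELet 21 $24 eeqt) etrue $26) r L false erefl.
have -> : foldl (fun v t => (t == T) || v) false (take B L) = (T \in take B L).
  rewrite -[RHS]orbF; elim: (take B L) false => [|t ts ih] b //=.
  by rewrite ih in_cons orbA; congr (_ || _); rewrite orbC eq_sym.
apply=> [psi|//|w t v psi] /=; first by rewrite hL.
rewrite (eqt_computes _ t T) //=; by case: eqP.
Qed.

Lemma sens_computes (r : env) (y : cube n) :
  r 20%N = enc_cube y -> computes esens r (enc_term (sens f y)).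
Proof.
move=> hy.
pose h p b q : tree := if f (dec_cube n (enc_list (map enc_bool (p ++ ~~ b :: q))))
  then Node Leaf Leaf else Node (enc_bool b) (enc_bool (~~ b)).
(* [h p b q] is the output for a bit [b] between prefix [p] and suffix [q]; [srec] collects these
   along the point. *)
pose srec := fix srec (p q : seq bool) : seq tree :=
  if q is b :: q' then h p b q' :: srec (rcons p b) q' else [::].
have srecE p q : srec p q = mkseq (fun k => h (p ++ take k q) (nth false q k) (drop k.+1 q)) (size q).
  elim: q p => [|b q ih] p //=; rewrite ih /mkseq -[size q]/(size q) /=.
  rewrite ?take0 cats0 drop0; congr cons.
  rewrite (iotaDl 1 0) -map_comp; apply: eq_map => k /=.
  by rewrite cat_rcons.
have -> : enc_term (sens f y) = enc_list (srec [::] y).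
  rewrite /enc_term srecE size_tuple /mkseq -val_enum_ord -map_comp; congr enc_list.
  apply: eq_map => i /=; rewrite /h !inE /= -tnth_nth enc_flipc dec_enc_cube.
  by case: (f _) => /=; rewrite ?andbF ?andbT; case: (tnth y i).
pose eV (v : seq bool * (seq bool * seq tree)) := Node (enc_list (map enc_bool v.1))
  (Node (enc_list (map enc_bool v.2.1)) (enc_list v.2.2)).
pose g b (v : seq bool * (seq bool * seq tree)) := (b :: v.1, (behead v.2.1,
   h (rev v.1) b (behead v.2.1) :: v.2.2)).
have hg : foldl (fun v b => g b v) ([::], (val y, [::])) y
   = (rev y, ([::], rev (srec [::] y))).
  suff main p q out : foldl (fun v b => g b v) (rev p, (q, out)) q
      = (rev (p ++ q), ([::], rev (srec p q) ++ out)).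
    by have := main [::] y [::]; rewrite /= cats0.
  elim: q p out => [|b q ih] p out /=; first by rewrite cats0.
  rewrite {2}/g /= revK -rev_rcons ih cat_rcons rev_cons cat_rcons.
  by [].
rewrite /esens -[srec _ _]revK; apply: erev_computes; last first.
  by rewrite size_rev srecE size_mkseq size_tuple.
suff main : computes (EFold 23 24 $20 (ECons ENil (ECons $20 ENil))
    (ELet 25 (ETl (EHd (ETl $24)))
      (ECons (ECons $23 (EHd $24))
        (ECons $25
          (ECons (EIf (EQuery (EFold 26 27 (EHd $24)
                                 (ECons (enot $23) $25) (ECons $26 $27)))
                    (ECons ENil ENil) (ECons $23 (enot $23)))
             (ETl (ETl $24))))))) r
    (eV (rev y, ([::], rev (srec [::] y)))).
  by do 2 (apply: (@tl_computes _ _ _ _ _ _ _ (Node _ _))); exact: main.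
rewrite -hg.
(* The inner fold cuts the prefix at [B], so the loop is first identified in this truncated form;
   afterwards the length of the prefix shows that nothing is cut. *)
have inv : forall phi, wp (EFold 23 24 $20 (ECons ENil (ECons $20 ENil))
    (ELet 25 (ETl (EHd (ETl $24)))
      (ECons (ECons $23 (EHd $24))
        (ECons $25
          (ECons (EIf (EQuery (EFold 26 27 (EHd $24)
                                 (ECons (enot $23) $25) (ECons $26 $27)))
                    (ECons ENil ENil) (ECons $23 (enot $23)))
             (ETl (ETl $24))))))) r phi =
   foldM (fun b v psi => psi (b :: v.1, (behead v.2.1,
      (if f (dec_cube n (enc_list (map enc_bool (rev (take B v.1) ++ ~~ b :: behead v.2.1))))
       then Node Leaf Leaf else Node (enc_bool b) (enc_bool (~~ b))) :: v.2.2)))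
      (val y) ([::], (val y, [::])) (fun v => phi (eV v)).
  move=> phi; apply: (wp_fold f D B enc_bool eV) => //.
  - by move=> psi /=; rewrite hy.
  - by move=> psi /=; rewrite hy.
  - by rewrite size_tuple.
  move=> w b v psi /=.
  set r' := bind_var _ 25 _.
  have hq := fold_take_computes f D B enc_bool
    (fun s => enc_list (map enc_bool s)) (fun b s => b :: s) 26 27
     (EHd $24) (ECons (enot $23) $25) (ECons $26 $27) r' v.1 (~~ b :: behead v.2.1) erefl.
  rewrite hq; last by [].
  - have -> : foldl (fun v t => t :: v) (~~ b :: behead v.2.1) (take B v.1)
      = rev (take B v.1) ++ ~~ b :: behead v.2.1.
      elim: (take B v.1) (~~ b :: _) => [|c s ih] v' //=.
      by rewrite ih rev_cons cat_rcons.
    have e : Defs.tl (enc_list [seq enc_bool i | i <- v.2.1]) = enc_list [seq enc_bool i | i <- behead v.2.1].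
      by case: (v.2.1).
    by rewrite e; case: (f _) => //=; case: b {hq r'}.
  - by [].
  - move=> psi'; rewrite /r' /=.
    by case: (v.2.1) => [|c s] /=; case: b {hq r'}.
move=> phi; rewrite inv {inv}.
have sy : (size y <= B)%N by rewrite size_tuple.
suff main p q out : (size (p ++ q) <= B)%N ->
  foldM (fun b v psi => psi (b :: v.1, (behead v.2.1,
      (if f (dec_cube n (enc_list (map enc_bool (rev (take B v.1) ++ ~~ b :: behead v.2.1))))
       then Node Leaf Leaf else Node (enc_bool b) (enc_bool (~~ b))) :: v.2.2)))
      q (rev p, (q, out)) (fun v => phi (eV v)) =
  phi (eV (foldl (fun v b => g b v) (rev p, (q, out)) q)).
  exact: (main [::]).
elim: q p out => [|b q ih] p out hpq //=.
rewrite take_oversize; last by move: hpq; rewrite size_cat size_rev; lia.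
by rewrite -rev_rcons ih ?cat_rcons // rev_rcons.
Qed.

Global Opaque esens emem.
End Specs.


Lemma eq_mapM_size {X Y R : Type} (g : X -> (Y -> R) -> R) xs phi psi :
  (forall ys, size ys = size xs -> phi ys = psi ys) ->
  mapM g xs phi = mapM g xs psi.
Proof.
elim: xs phi psi => [|x xs ih] phi psi h /=; first exact: h.
congr (g x _); apply/funext => y; apply: ih => ys hys.
by apply: h => /=; rewrite hys.
Qed.

Lemma enc_term_of {n : nat} (bs : seq (bool * bool)) : size bs = n ->
  enc_term (term_of bs : term n)
  = enc_list (map (fun p => Node (enc_bool p.1) (enc_bool p.2)) bs).
Proof.
move=> hs; rewrite /enc_term; congr enc_list.
apply: (@eq_from_nth _ Leaf) => [|k].
  by rewrite size_map size_enum_ord size_map hs.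
rewrite size_map size_enum_ord => hk.
rewrite (nth_map (Ordinal hk)) ?size_enum_ord // (nth_map (false, false)) ?hs //.
by rewrite !inE /= nth_enum_ord.
Qed.

Lemma enc_zeros {n : nat} : enc_cube (zeros : cube n) = enc_nat n.
Proof.
rewrite enc_cube_mktuple /entab /enc_nat; congr enc_list.
by rewrite -[X in nseq X](size_enum_ord n); elim: (enum 'I_n) => //= i s <-.
Qed.

Lemma card_term {n : nat} (T : term n) :
  #|T| = (\sum_i (((i, true) \in T) + ((i, false) \in T)))%N.
Proof.
rewrite -sum1_card big_mkcond /=.
rewrite (eq_bigr (fun l : literal n => ((l.1, l.2) \in T) : nat)) => [|[i b] _].
  rewrite -(pair_bigA _ (fun i b => ((i, b) \in T) : nat)) /=.
  by apply: eq_bigr => i _; rewrite big_bool.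
by case: (_ \in T).
Qed.

Lemma enc_nat_map {X : Type} (xs : seq X) :
  enc_nat (size xs) = enc_list (map (fun _ => Leaf) xs).
Proof. by rewrite /enc_nat; congr enc_list; elim: xs => //= x xs <-. Qed.

Lemma loopM_enc {U V R : Type} (eV : V -> U) (h : U -> (U -> R) -> R)
    (g : V -> (V -> R) -> R) m v phi :
  (forall v psi, h (eV v) psi = g v (fun v' => psi (eV v'))) ->
  loopM m h (eV v) phi = loopM m g v (fun v' => phi (eV v')).
Proof.
move=> hg; elim: m v => //= m ih v; rewrite hg; congr (g v _).
by apply/funext => v'; exact: ih.
Qed.

(** * Correctness of attempts, trials and list learning *)

Section Specs.
Context {R : realType} {n : nat}.
Variables (f : cube n -> bool) (D : cube n -> R) (B : nat).
Local Notation wp := (wp f D B).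
Local Notation computes := (computes f D B).
Hypothesis nB : (n <= B)%N.
Hypothesis n2B : (2 * n <= B)%N.
Variable a : nat.
Hypothesis aB : (a <= B)%N.

Lemma wp_pick (r : env) (A : term n) (L : dnf n) phi :
  r 5%N = enc_nat a -> r 28%N = enc_term A -> r 29%N = enc_dnf L ->
  wp epick r phi = pickM B a A L (fun T => phi (enc_term T)).
Proof.
move=> ha hA hL; rewrite /epick.
apply: (wp_fold_take f D B (@enc_term n) (@enc_term n)) => //.
- by move=> psi /=; rewrite hL.
- by move=> psi /=; rewrite hA.
move=> w t v psi /=; rewrite (wp_rare f D B _ _ a) ?(minn_idPl aB) //=.
by move=> psi' /=; rewrite ha.
Qed.

Lemma wp_flipbit (r : env) b c phi :
  r 5%N = enc_nat a -> computes b r (enc_bool c) ->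
  wp (eflipbit b) r phi = bitM a c (fun c' => phi (enc_bool c')).
Proof.
move=> ha hb /=; rewrite (wp_rare f D B _ _ a) ?(minn_idPl aB) //=.
  by rewrite !hb /bitM /rareM; case: c {hb}.
by move=> psi' /=; rewrite ha.
Qed.

Global Opaque epick eflipbit.

Lemma wp_edit (r : env) (T : term n) phi :
  r 5%N = enc_nat a -> r 20%N = enc_term T ->
  wp eedit r phi = editM a T (fun T' => phi (enc_term T')).
Proof.
move=> ha hT; rewrite /eedit.
pose eY p := Node (enc_bool p.1) (enc_bool p.2).
rewrite (wp_map f D B (fun i => Node (enc_bool ((i, true) \in T)) (enc_bool ((i, false) \in T)))
   eY (fun i phi => bitM a ((i, true) \in T) (fun b =>
                     bitM a ((i, false) \in T) (fun c => phi (b, c)))) _ _ _ _ (enum 'I_n)) //.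
- rewrite /editM; apply: eq_mapM_size => ys; rewrite size_enum_ord => hs.
  by rewrite enc_term_of.
- by move=> psi /=; rewrite hT.
- by rewrite size_enum_ord.
move=> w w' i psi /=.
rewrite (wp_flipbit _ _ ((i, true) \in T)) //=.
by do !f_equal; apply/funext => b; rewrite (wp_flipbit _ _ ((i, false) \in T)).
Qed.

Global Opaque eedit.

Lemma wp_phase (r : env) j y (A : term n) (L : dnf n) phi :
  r 5%N = enc_nat a -> r 10%N = enc_term (set0 : term n) -> r 30%N = enc_nat j ->
  r 31%N = enc_cube y -> r 32%N = enc_term A -> r 33%N = enc_dnf L ->
  wp ephase r phi
  = phaseM f B a (minn j B) L (y, A) (fun v => phi (Node (enc_cube v.1) (enc_term v.2))).
Proof.
move=> ha h0 hj hy hA hL /=; rewrite hy hA /phaseM /=; congr ((_ + _) / _).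
rewrite (wp_pick _ A L) //; congr (pickM _ _ _ _ _); apply/funext => A'.
rewrite (wp_noise f D B nB _ j A' y) //; congr (noiseM _ _ _ _); apply/funext => y1.
rewrite (wp_noise f D B nB _ a set0 y1) ?(minn_idPl aB) //; congr (noiseM _ _ _ _); apply/funext => y2.
by rewrite (sens_computes f D B nB _ y2).
Qed.

Global Opaque ephase.

Lemma wp_attempt (r : env) x (L : dnf n) phi :
  r 5%N = enc_nat a -> r 10%N = enc_term (set0 : term n) ->
  r 40%N = enc_cube x -> r 33%N = enc_dnf L ->
  wp eattempt r phi = attemptM f B a x L (fun T => phi (enc_term T)).
Proof.
move=> ha h0 hx hL; rewrite /eattempt.
pose eV (v : nat * (cube n * term n)) :=
  Node (enc_nat v.1) (Node (enc_cube v.2.1) (enc_term v.2.2)).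
pose g (_ : nat) (v : nat * (cube n * term n)) psi :=
  phaseM f B a (minn v.1 B) L v.2 (fun v' => psi (v.1.-1, v')) : R.
rewrite /= (wp_fold f D B (fun _ => Leaf) eV g _ _ _ _ _ _ (iota 0 a)
  (a, (x, set0))) //.
- rewrite /attemptM -[X in phasesM _ _ _ X](size_iota 0 a).
  rewrite -[X in foldM _ _ (X, _)](size_iota 0 a).
  have : (size (iota 0 a) <= B)%N by rewrite size_iota.
  elim: (iota 0 a) (x, set0) => [|k ks ih] v hs /=.
    rewrite (wp_pick _ v.2 L) //; congr (pickM _ _ _ _ _); apply/funext => A.
    by rewrite (wp_edit _ A).
  rewrite {1}/g (minn_idPl _) //=; congr (phaseM _ _ _ _ _ _ _).
  by apply/funext => v'; rewrite ih // ltnW.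
- by move=> psi /=; rewrite ha -enc_nat_map size_iota.
- by move=> psi /=; rewrite ha hx h0.
- by rewrite size_iota.
move=> w t v psi /=; rewrite (wp_phase _ v.1 v.2.1 v.2.2 L) //=.
rewrite /g -surjective_pairing; congr (phaseM _ _ _ _ _ _ _).
by apply/funext => v'; rewrite /eV /=; case: (v.1).
Qed.

Global Opaque eattempt.

Lemma count_computes (r : env) (T : term n) :
  r 20%N = enc_term T -> computes ecount r (enc_nat #|T|).
Proof.
move=> hT.
have -> : #|T| = foldl (fun m i => (m + ((i, true) \in T) + ((i, false) \in T))%N)
    0%N (enum 'I_n).
  rewrite card_term -big_enum /=; set c := (X in foldl X).
  suff main js m : foldl c m js
      = (m + \sum_(i <- js) (((i, true) \in T) + ((i, false) \in T)))%N.
    by rewrite main add0n.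
  elim: js m => [|i js ih] m; first by rewrite big_nil addn0.
  by rewrite big_cons /= ih /c !addnA.
apply: (fold_computes f D B (fun i => Node (enc_bool ((i, true) \in T)) (enc_bool ((i, false) \in T)))
  enc_nat (fun i m => (m + ((i, true) \in T) + ((i, false) \in T))%N)) => //.
- by move=> psi /=; rewrite hT.
- by rewrite size_enum_ord.
move=> w i v psi /=; do 2 case: (_ \in T) => /=; by rewrite ?addn0 ?addn1.
Qed.

Lemma card_term_leq (T : term n) : (#|T| <= 2 * n)%N.
Proof.
by apply: leq_trans (max_card _) _; rewrite card_prod card_ord card_bool mulnC.
Qed.

Lemma less_computes u v (r : env) us ts :
  computes u r (enc_list us) -> computes v r (enc_list ts) ->
  (size us <= B)%N -> computes (eless u v) r (enc_list (drop (size us) ts)).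
Proof.
move=> hu hv hs.
have -> : drop (size us) ts = foldl (fun v _ => behead v) ts us.
  elim: us ts {hu hv hs} => [|u' us ih] ts /=; first by rewrite drop0.
  by rewrite -ih; case: ts => [|t ts] //=; case: (size us).
apply: (fold_computes f D B id enc_list (fun _ v => behead v)) => //.
  by rewrite map_id.
by move=> w t w' psi /=; case: w'.
Qed.

Lemma truthy_drop m ts : truthy (enc_list (drop m ts)) = (m < size ts)%N.
Proof.
rewrite -subn_gt0 -size_drop; by case: (drop m ts).
Qed.

Global Opaque ecount eless.

Lemma wp_valid (r : env) (T : term n) phi :
  r 6%N = enc_nat n -> r 50%N = enc_term T -> (1 <= B)%N ->
  wp evalid r phi = validM f B T (fun b => phi (enc_bool b)).
Proof.
move=> hn hT B1; rewrite /evalid /= /validM -[Node Leaf Leaf]/(enc_bool true).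
apply: loopM_enc => b psi; case: b => //=.
rewrite (over_computes f D B nB _ T zeros) //=; last by rewrite enc_zeros.
rewrite (wp_noise f D B nB _ 1 T (override T zeros)) // (minn_idPl B1).
by congr (noiseM _ _ _ _); apply/funext => z; rewrite dec_enc_cube.
Qed.

Global Opaque evalid.

Lemma wp_trial (r : env) k x (L : dnf n) phi :
  r 5%N = enc_nat a -> r 6%N = enc_nat n -> r 10%N = enc_term (set0 : term n) ->
  r 40%N = enc_cube x -> r 33%N = enc_dnf L -> r 9%N = enc_nat k -> (k <= B)%N ->
  (1 <= B)%N ->
  wp etrial r phi = trialM f B a k x L (fun L => phi (enc_dnf L)).
Proof.
move=> ha hn h0 hx hL hk kB B1; rewrite /etrial /=.
rewrite (wp_attempt _ x L) //; congr (attemptM _ _ _ _ _ _); apply/funext => T.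
rewrite (count_computes _ T) //=.
have hc (r' : env) : r' 52%N = enc_nat #|T| -> computes $52 r' (enc_nat #|T|).
  by move=> h psi /=; rewrite h.
have hc' (r' : env) : r' 9%N = enc_nat k -> computes $9 r' (enc_nat k).
  by move=> h psi /=; rewrite h.
have sT : (#|T| <= B)%N by apply: leq_trans (card_term_leq T) n2B.
rewrite (less_computes _ _ _ _ _ (hc _ _) (hc' _ _)) ?size_nseq //.
rewrite (less_computes _ _ _ _ _ (hc' _ _) (hc _ _)) ?size_nseq //.
rewrite !truthy_drop !size_nseq eqn_leq.
case: ltnP => h1; rewrite ?andbF ?andbT /= ?hL //.
case: ltnP => h2; rewrite /= ?hL //.
rewrite (mem_computes f D B nB _ T L) //; case: (T \in _) => //=.
rewrite (wp_valid _ T) //; congr (validM _ _ _ _); apply/funext => b.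
by case: b => /=; rewrite ?hL.
Qed.

Global Opaque etrial.

Definition enc_example (x : cube n * bool) : tree :=
  Node (enc_cube x.1) (enc_bool x.2).

Lemma wp_learn (r : env) k (S : seq (cube n * bool)) phi :
  r 5%N = enc_nat a -> r 6%N = enc_nat n -> r 10%N = enc_term (set0 : term n) ->
  r 11%N = enc_list (map enc_example S) -> r 9%N = enc_nat k -> (k <= B)%N ->
  (1 <= B)%N -> (size S <= B)%N ->
  wp elearn r phi = learnM f B a k S (fun L => phi (enc_dnf L)).
Proof.
move=> ha hn h0 hS hk kB B1 SB; rewrite /elearn.
apply: (wp_fold f D B enc_example (@enc_dnf n)) => //.
  by move=> psi /=; rewrite hS.
move=> w [x b] L psi /=; case: b => //=.
apply: (loopM_enc (@enc_dnf n)) => L' psi'.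
by rewrite (wp_trial _ k x L').
Qed.

Global Opaque elearn.

Lemma wp_learnall (r : env) (S : seq (cube n * bool)) phi :
  r 5%N = enc_nat a -> r 6%N = enc_nat n -> r 10%N = enc_term (set0 : term n) ->
  r 11%N = enc_list (map enc_example S) ->
  (1 <= B)%N -> (size S <= B)%N ->
  wp elearnall r phi
  = learnallM f B a S (fun Ls => phi (enc_list (map (@enc_dnf n) Ls))).
Proof.
move=> ha hn h0 hS B1 SB; rewrite /elearnall.
apply: (wp_fold f D B (fun i : 'I_n => enc_nat i.+1) (fun Ls => enc_list (map (@enc_dnf n) Ls))) => //.
- have hk := fold_computes f D B (fun _ => Leaf) (fun ks => enc_list (map enc_nat ks))
    (fun _ ks => (head 0%N ks).+1 :: ks) 62 63 $6 ENil (ECons (ECons ENil (EHd $63)) $63) r (enum 'I_n) [::].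
  have -> : [seq enc_nat (i : 'I_n).+1 | i <- rev (enum 'I_n)]
      = map enc_nat (foldl (fun ks _ => (head 0%N ks).+1 :: ks) [::] (enum 'I_n)).
    rewrite (map_comp enc_nat (fun i : 'I_n => i.+1)); congr map.
    rewrite map_rev (map_comp succn (@nat_of_ord n)) val_enum_ord.
    rewrite -[X in iota 0 X](size_enum_ord n).
    elim/last_ind: (enum 'I_n) => // s i ih.
    rewrite foldl_rcons size_rcons -ih -addn1 iotaD map_cat rev_cat /= add0n.
    congr ((_.+1) :: _); case: (size s) => // m.
    by rewrite -[X in iota 0 X]addn1 iotaD map_cat rev_cat /= add0n.
  apply: hk => //.
  + by move=> psi /=; rewrite hn -enc_nat_map size_enum_ord.
  + by rewrite size_enum_ord.
  + by move=> w t v psi /=; case: v.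
- by rewrite size_rev size_enum_ord.
move=> w i v psi /=; rewrite (wp_learn _ i.+1 S) //.
by apply: leq_trans nB.
Qed.

Global Opaque elearnall.
End Specs.


(** * Correctness of the greedy cover and of the whole program *)

Section Specs.
Context {R : realType} {n : nat}.
Variables (f : cube n -> bool) (D : cube n -> R) (B : nat).
Local Notation wp := (wp f D B).
Local Notation computes := (computes f D B).
Hypothesis nB : (n <= B)%N.
Hypothesis n2B : (2 * n <= B)%N.
Variable a : nat.
Hypothesis aB : (a <= B)%N.
Local Notation enc_cubes U := (enc_list (map (@enc_cube n) U)).

Lemma filter_computes (r : env) l t (T : term n) (U : seq (cube n)) :
  computes l r (enc_cubes U) ->
  (forall w u v, computes t (bind_var (bind_var (bind_var r 0 w) 65 u) 66 v) (enc_term T)) ->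
  computes (efilter l t) r (enc_cubes (uncovered B T U)).
Proof.
move=> hl ht.
have -> : uncovered B T U
   = foldl (fun v x => if term_eval T x then v else x :: v) [::] (take B U).
  rewrite /uncovered -[LHS]cats0; elim: (take B U) [::] => [|x s ih] v //=.
  by rewrite -ih; case: term_eval => //=; rewrite rev_cons cat_rcons.
apply: (fold_take_computes f D B (@enc_cube n) (fun U => enc_cubes U)
  (fun x v => if term_eval T x then v else x :: v)) => //.
move=> w x v psi /=; rewrite (ht _ _ _) (sat_computes f D B nB _ T x) //=.
by case: term_eval.
Qed.

Lemma label_computes (r : env) b (S : seq (cube n * bool)) :
  r 11%N = enc_list (map enc_example S) -> (size S <= B)%N ->
  computes (elabel b) r (enc_cubes (labelled b S)).
Proof.
move=> hS SB.
have -> : labelled b S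
   = foldl (fun v x => if x.2 == b then x.1 :: v else v) [::] S.
  rewrite /labelled -[LHS]cats0; elim: S [::] {hS SB} => [|x s ih] v //=.
  by rewrite -ih; case: eqP => //=; rewrite rev_cons cat_rcons.
apply: (fold_computes f D B enc_example (fun U => enc_cubes U)
  (fun x v => if x.2 == b then x.1 :: v else v)) => //.
  by move=> psi /=; rewrite hS.
by move=> w [x c] v psi; case: b => /=; case: c.
Qed.

Lemma consistent_computes (r : env) t (T : term n) (N : seq (cube n)) :
  r 72%N = enc_cubes N -> (size N <= B)%N ->
  (forall w u v, computes t (bind_var (bind_var (bind_var r 0 w) 69 u) 70 v) (enc_term T)) ->
  computes (econsistent t) r (enc_bool (consistent T N)).
Proof.
move=> hN NB ht.
have -> : consistent T N
   = foldl (fun v x => if term_eval T x then false else v) true N.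
  rewrite /consistent -[LHS]andTb; elim: N true {hN NB} => [|x s ih] v //=.
    by rewrite andbT.
  by rewrite -ih; case: term_eval => //=; rewrite andbF.
apply: (fold_computes f D B (@enc_cube n) enc_bool
  (fun x v => if term_eval T x then false else v)) => //.
  by move=> psi /=; rewrite hN.
move=> w x v psi /=; rewrite (ht _ _ _) (sat_computes f D B nB _ T x) //=.
by case: term_eval.
Qed.

Global Opaque efilter elabel econsistent.

Definition enc_state (v : seq (cube n) * dnf n) : tree :=
  Node (enc_cubes v.1) (enc_dnf v.2).

Lemma best_computes (r : env) (U N : seq (cube n)) (Ls : seq (dnf n)) :
  r 71%N = enc_list (map (@enc_dnf n) Ls) -> r 72%N = enc_cubes N ->
  r 73%N = enc_cubes U -> (size N <= B)%N -> (size Ls <= B)%N ->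
  computes ebest r (enc_state (best B N Ls U)).
Proof.
move=> hLs hN hU NB LsB; rewrite /ebest /best.
apply: (fold_computes f D B (@enc_dnf n) enc_state
  (fun L v => foldl (better B N U) v (take B L))) => //.
- by move=> psi /=; rewrite hLs.
- by move=> psi /=; rewrite hU.
move=> w L v.
apply: (fold_take_computes f D B (@enc_term n) enc_state (fun T v => better B N U v T)) => //.
move=> w' T v' psi /=.
rewrite (consistent_computes _ $76 T N) //= /better.
case: consistent => //=.
set r' := bind_var _ 77 _.
rewrite (filter_computes r' $73 $76 T U) //; last by move=> psi'; rewrite /r' /= hU.
have hs : (size (uncovered B T U) <= B)%N.
  rewrite size_rev size_filter; apply: leq_trans (count_size _ _) _.
  by rewrite size_take; case: ltnP => // /ltnW.
set r'' := bind_var r' 78 _.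
rewrite (less_computes f D B $78 (EHd $77) r''
   (map (@enc_cube n) (uncovered B T U)) (map (@enc_cube n) v'.1)) ?size_map //.
by rewrite truthy_drop size_map; case: ltnP.
Qed.

Global Opaque ebest.

Lemma iter_foldl {X V : Type} (g : V -> V) (xs : seq X) v :
  foldl (fun v _ => g v) v xs = iter (size xs) g v.
Proof. by elim: xs v => //= x xs ih v; rewrite ih -iterSr. Qed.

Lemma greedy_computes (r : env) (S : seq (cube n * bool)) (Ls : seq (dnf n)) p q N :
  r 11%N = enc_list (map enc_example S) -> (size S <= B)%N ->
  r 71%N = enc_list (map (@enc_dnf n) Ls) -> r 72%N = enc_cubes N ->
  r 8%N = enc_nat p -> r 7%N = enc_nat q ->
  (size N <= B)%N -> (size Ls <= B)%N -> (p <= B)%N -> (q <= B)%N ->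
  computes egreedy r (enc_state (greedy B (p * q) N Ls (labelled true S))).
Proof.
move=> hS SB hLs hN hp hq NB LsB pB qB.
have -> : greedy B (p * q) N Ls (labelled true S)
  = foldl (fun v (_ : nat) => foldl (fun v (_ : nat) => greedy_step B N Ls v) v (iota 0 q))
     (labelled true S, [::]) (iota 0 p).
  rewrite iter_foldl size_iota /greedy; elim: p {hp pB} => //= p <-.
  by rewrite iter_foldl size_iota mulSn iterD.
apply: (fold_computes f D B (fun _ => Leaf) enc_state
  (fun (_ : nat) v => foldl (fun v (_ : nat) => greedy_step B N Ls v) v (iota 0 q))) => //.
- by move=> psi /=; rewrite hp -enc_nat_map size_iota.
- by move=> psi /=; rewrite (label_computes _ true S).
- by rewrite size_iota.
move=> w t v.
apply: (fold_computes f D B (fun _ => Leaf) enc_state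
  (fun (_ : nat) v => greedy_step B N Ls v)) => //.
- by move=> psi /=; rewrite hq -enc_nat_map size_iota.
- by rewrite size_iota.
move=> w' t' v' psi /=; rewrite (best_computes _ v'.1 N Ls) //= /greedy_step.
by case: (best _ _ _ _) => U' [|T s].
Qed.

Global Opaque egreedy.

Lemma mapM_ret {X Y : Type} (g : X -> Y) xs (phi : seq Y -> R) :
  mapM (fun x psi => psi (g x)) xs phi = phi (map g xs).
Proof. by elim: xs phi => //= x xs ih phi; rewrite ih. Qed.

Lemma empty_computes (r : env) : r 6%N = enc_nat n ->
  computes (emap 85 $6 (ECons ENil ENil)) r (enc_term (set0 : term n)).
Proof.
move=> hn phi.
rewrite (wp_map f D B (fun _ => Leaf) id (fun (_ : 'I_n) psi => psi (Node Leaf Leaf))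
   85 _ _ _ (enum 'I_n)) //.
- rewrite mapM_ret map_id /enc_term; congr (phi (enc_list _)).
  by apply: eq_map => i; rewrite !inE.
- by move=> psi /=; rewrite hn -enc_nat_map size_enum_ord.
- by rewrite size_enum_ord.
Qed.

Lemma wp_sample (r : env) phi :
  wp (ELoop 86 ENil (ECons ESample $86)) r phi
  = sampleM f D B (fun S => phi (enc_list (map enc_example S))).
Proof.
rewrite /= /sampleM.
exact: (loopM_enc (fun S : seq (cube n * bool) => enc_list (map enc_example S))
  _ _ _ [::]).
Qed.

Lemma eq_sampleM m (phi psi : seq (cube n * bool) -> R) :
  (forall S, size S = m -> phi S = psi S) ->
  sampleM f D m phi = sampleM f D m psi.
Proof.
rewrite /sampleM; set g := (X in loopM _ X).
suff main S : (forall S', size S' = (m + size S)%N -> phi S' = psi S') ->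
    loopM m g S phi = loopM m g S psi.
  by move=> h; apply: main => S' hS'; apply: h; rewrite hS' addn0.
elim: m S => [|m ih] S h /=; first exact: h.
apply: eq_bigr => x _; congr (_ * _); apply: ih => S' hS'; apply: h.
by rewrite hS' /= addnS.
Qed.

(** Continuations have to agree only on reachable states. With the length of the accumulator as
    invariant, this shows that exactly [n] lists reach the greedy cover, so its fold over them is
    not cut. *)
Lemma eq_foldM_inv {X V : Type} (P : V -> nat -> Prop) (g : X -> V -> (V -> R) -> R)
    xs v (phi psi : V -> R) :
  (forall x v m p1 p2, P v m -> (forall v', P v' m.+1 -> p1 v' = p2 v') ->
     g x v p1 = g x v p2) ->
  (forall v', P v' (size xs) -> phi v' = psi v') -> P v 0%N ->
  foldM g xs v phi = foldM g xs v psi.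
Proof.
move=> hg h hv; suff main m : (forall v', P v' (m + size xs)%N -> phi v' = psi v') ->
    P v m -> foldM g xs v phi = foldM g xs v psi by exact: (main 0%N).
elim: xs v m {h hv} => [|x xs ih] v m /= h hv; first by apply: h; rewrite addn0.
by apply: (hg _ _ m) => // v' hv'; apply: ih hv' => v'' h''; apply: h; rewrite -addSnnS.
Qed.

Lemma eq_learnallM (S : seq (cube n * bool)) (phi psi : seq (dnf n) -> R) :
  (forall Ls, size Ls = n -> phi Ls = psi Ls) ->
  learnallM f B a S phi = learnallM f B a S psi.
Proof.
move=> h; apply: (eq_foldM_inv (fun Ls m => size Ls = m)) => //.
- move=> i Ls m p1 p2 hs hp; congr (learnM _ _ _ _ _ _); apply/funext => L.
  by apply: hp => /=; rewrite hs.
- by move=> Ls; rewrite size_rev size_enum_ord; exact: h.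
Qed.

Lemma labelled_size b (S : seq (cube n * bool)) : (size (labelled b S) <= size S)%N.
Proof. by rewrite size_rev size_map size_filter count_size. Qed.

Lemma wp_let x e1 e2 r phi :
  wp (ELet x e1 e2) r phi = wp e1 r (fun v => wp e2 (bind_var r x v) phi).
Proof. by []. Qed.

Lemma wp_main (r : env) p q phi :
  r 5%N = enc_nat a -> r 6%N = enc_nat n -> r 7%N = enc_nat q -> r 8%N = enc_nat p ->
  (1 <= B)%N -> (p <= B)%N -> (q <= B)%N ->
  wp emain r phi = mainM f D B a (p * q) (fun H => phi (enc_dnf H)).
Proof.
move=> ha hn hq hp B1 pB qB; rewrite /emain wp_let empty_computes // wp_let wp_sample.
apply: eq_sampleM => S hS; rewrite wp_let (label_computes _ false S) ?hS //.
rewrite wp_let (wp_learnall f D B nB n2B a aB _ S) ?hS //.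
apply: eq_learnallM => Ls hLs.
set r' := bind_var _ 71 _.
have hg := greedy_computes r' S Ls p q (labelled false S).
rewrite -[LHS]/(wp egreedy r' (fun v => phi (Defs.tl v))) hg ?hS ?hLs //.
by rewrite -hS labelled_size.
Qed.

End Specs.


(** * Sensitive literals and nearby terms *)

Section Falsified.
Context {n : nat}.
Implicit Types (T : term n) (y z : cube n) (Z : {set 'I_n}).

Definition fals (z : cube n) (T : term n) : nat :=
  (\sum_(i : 'I_n) ((i, ~~ tnth z i) \in T))%N.

(** Contradictory terms are legal but never fire. For the others the number of literals equals the
    number of variables, by [card_vars]. *)
Definition satisfiable (T : term n) : bool :=
  [forall i : 'I_n, ~~ (((i, true) \in T) && ((i, false) \in T))].

Definition vars (T : term n) : {set 'I_n} := [set i | masked T i].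

Definition flips (y : cube n) (Z : {set 'I_n}) : cube n :=
  [tuple (i \in Z) (+) tnth y i | i < n].

Lemma tnth_flips y Z i : tnth (flips y Z) i = (i \in Z) (+) tnth y i.
Proof. by rewrite tnth_mktuple. Qed.

Lemma tnth_flipc y i j : tnth (flipc y i) j = (j == i) (+) tnth y j.
Proof. by rewrite tnth_mktuple; case: eqP. Qed.

Lemma flips0 y : flips y set0 = y.
Proof. by apply: eq_from_tnth => i; rewrite tnth_flips inE. Qed.

Lemma flipsU y Z1 Z2 : [disjoint Z1 & Z2] ->
  flips (flips y Z1) Z2 = flips y (Z1 :|: Z2).
Proof.
move=> /pred0P h; apply: eq_from_tnth => i; rewrite !tnth_flips inE.
by have := h i; rewrite /= ; do 2 case: (_ \in _).
Qed.

Lemma flipc_flips y Z i : i \notin Z -> flipc (flips y Z) i = flips y (i |: Z).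
Proof.
move=> h; apply: eq_from_tnth => j; rewrite tnth_flipc !tnth_flips !inE.
by case: eqP => [->|_]; rewrite ?(negbTE h).
Qed.

Lemma in_vars T l : l \in T -> l.1 \in vars T.
Proof. by case: l => i [] h; rewrite inE /masked h ?orbT. Qed.

Lemma term_evalP T z : reflect (forall l, l \in T -> l.2 = tnth z l.1) (term_eval T z).
Proof.
apply: (iffP forall_inP) => h l hl; first by rewrite -(eqP (h l hl)).
by rewrite /lit_eval h.
Qed.

Lemma term_eval_fals T z : term_eval T z = (fals z T == 0%N).
Proof.
rewrite /fals sum_nat_eq0; apply/term_evalP/forall_inP => [h i _|h [i b] hl] /=.
  by rewrite eqb0; apply/negP => /h /=; case: (tnth z i).
by have := h i isT; rewrite eqb0; apply: contraNeq; move: hl;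
  case: b; case: (tnth z i).
Qed.

Lemma satisfiable_eval T z : term_eval T z -> satisfiable T.
Proof.
move=> /term_evalP h; apply/forallP => i; apply/negP => /andP[/h /= h1 /h /= h2].
by rewrite -h1 in h2.
Qed.

Lemma satisfiable_lit T i b : satisfiable T -> (i, b) \in T -> (i, ~~ b) \notin T.
Proof.
move=> /forallP /(_ i); case: b; rewrite negb_and => /orP[] h1 h2 //=.
- by rewrite h2 in h1.
- by rewrite h2 in h1.
Qed.

Lemma fals_flipc T z i :
  (fals (flipc z i) T + ((i, ~~ tnth z i) \in T) = fals z T + ((i, tnth z i) \in T))%N.
Proof.
rewrite /fals (bigD1 i) //= [in RHS](bigD1 i) //= tnth_flipc eqxx addTb negbK.
rewrite (eq_bigr (fun j => ((j, ~~ tnth z j) \in T) : nat)) => [|j /negbTE hj].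
  by rewrite addnAC [in RHS]addnAC; congr (_ + _)%N; rewrite addnC.
by rewrite tnth_flipc hj.
Qed.

Lemma fals_flips T z Z : (fals z T <= fals (flips z Z) T + #|Z|)%N.
Proof.
rewrite /fals -sum1_card [X in (_ <= _ + X)%N]big_mkcond -big_split /=.
apply: leq_sum => i _; rewrite tnth_flips; case: (i \in Z) => /=.
  by rewrite addn1; case: (_ \in T).
by rewrite addn0.
Qed.

Lemma card_vars T : satisfiable T -> #|vars T| = #|T|.
Proof.
move=> hT; rewrite card_term -sum1_card big_mkcond /=; apply: eq_bigr => i _.
rewrite inE /masked; have /forallP /(_ i) := hT.
by do 2 case: (_ \in T).
Qed.

End Falsified.

Section Local.
Context {n : nat}.
Variables (Fc : {set term n}) (k : nat).
Hypothesis Fk : forall T, T \in Fc -> #|T| = k.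
Hypothesis Fsat : forall T, T \in Fc -> satisfiable T.
Variable f : cube n -> bool.
Hypothesis fE : forall x, f x = [exists T in Fc, term_eval T x].
Variable tau : nat.
Hypothesis Ftau : (#|Fc| < 2 ^ tau)%N.

Lemma f_sat T x : T \in Fc -> term_eval T x -> f x.
Proof. by move=> hT hx; rewrite fE; apply/exists_inP; exists T. Qed.

(** Equal width makes the distance symmetric. Otherwise a term could have hardly any literal outside
    [T0], hence resist all noise that preserves [T0], and yet miss most of [T0]. *)
Lemma cardD_sym (T T' : term n) : T \in Fc -> T' \in Fc -> #|T :\: T'| = #|T' :\: T|.
Proof.
move=> hT hT'; apply/eqP; rewrite -(eqn_add2l #|T :&: T'|) cardsID Fk //.
by rewrite setIC cardsID Fk.
Qed.

Section Chain.
Variables (T0 : term n) (y : cube n) (J : {set term n}) (nu : nat).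
Hypothesis T0F : T0 \in Fc.
Hypothesis yT0 : term_eval T0 y.
Hypothesis JF : J \subset Fc.
Hypothesis Jnear : forall T, T \in J -> (#|T0 :\: T| <= nu)%N.
Hypothesis Jfar : forall T, T \in Fc -> T \notin J -> (tau < fals y T)%N.

Definition insensitive (z : cube n) : term n := [set l in T0 | f (flipc z l.1)].

Definition potential (z : cube n) : rat := \sum_(T in J) (4^-1) ^+ fals z T.

(** Averaging over the unflipped insensitive literals of [T0]. A flip divides the summand of [T] by
    4 if the literal is in [T], and multiplies it by at most 4 otherwise. The latter happens for at
    most [nu] of more than [16 * nu] literals, so the mean factor is at most [1/4 + 4/16 = 1/2]. *)
Lemma potential_descent (Z : {set 'I_n}) :
  Z \subset vars T0 -> (#|Z| <= tau)%N ->
  (16 * nu + tau < #|insensitive (flips y Z)|)%N ->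
  exists2 l, l \in insensitive (flips y Z) & (l.1 \notin Z) /\
    potential (flipc (flips y Z) l.1) <= potential (flips y Z) / 2.
Proof.
move=> hZ hZt; set z := flips y Z => hN.
pose N' := [set l in insensitive z | l.1 \notin Z].
have T0lit l : l \in T0 -> l = (l.1, tnth y l.1).
  by move=> hl; rewrite [LHS]surjective_pairing (elimT (term_evalP _ _) yT0 _ hl).
(* At most [#|Z| <= tau] insensitive literals have already been flipped, one for each variable of
   [Z]. *)
have hN' : (16 * nu < #|N'|)%N.
  have hinj : (#|[set l in insensitive z | l.1 \in Z]| <= #|Z|)%N.
    rewrite -(card_in_imset (f := fst)).
      by apply/subset_leq_card/subsetP => i /imsetP[l + ->]; rewrite inE => /andP[].
    move=> l l'; rewrite !inE => /andP[/andP[h _] _] /andP[/andP[h' _] _] e.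
    by rewrite (T0lit _ h) (T0lit _ h') e.
  have : (#|insensitive z| <= #|N'| + #|[set l in insensitive z | l.1 \in Z]|)%N.
    rewrite -(cardsID [set l | l.1 \notin Z] (insensitive z)) leq_add //.
      by apply/subset_leq_card/subsetP => l; rewrite !inE => /andP[-> ->].
    by apply/subset_leq_card/subsetP => l; rewrite !inE negbK => /andP[-> ->].
  lia.
have hsum : \sum_(l in N') potential (flipc z l.1) <= #|N'|%:R * (potential z / 2).
  rewrite /potential exchange_big /= mulr_suml mulr_sumr; apply: ler_sum => T hT.
  have TF := subsetP JF _ hT.
  have hbound l : l \in N' -> (4^-1 : rat) ^+ fals (flipc z l.1) T
      <= (4^-1) ^+ fals z T * (4^-1 + (l \notin T)%:R * 4).
    rewrite inE => /andP[]; rewrite inE => /andP[lT0 _] lZ.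
    have zl : tnth z l.1 = l.2.
      by rewrite tnth_flips (negbTE lZ) (elimT (term_evalP _ _) yT0 _ lT0).
    have := fals_flipc T z l.1; rewrite zl -surjective_pairing.
    have p0 m : (0 : rat) <= (4^-1) ^+ m by apply: exprn_ge0.
    case hl : (l \in T) => /=.
      have -> : ((l.1, ~~ l.2) \in T) = false.
        by apply/negbTE/satisfiable_lit; [exact: Fsat|rewrite -surjective_pairing].
      rewrite addn0 addn1 => ->; rewrite exprSr mul0r addr0.
      exact: lexx.
    rewrite addn0; case: (_ \in T) => /= e.
      by rewrite -e addn1 exprSr mul1r; have := p0 (fals (flipc z l.1) T); lra.
    by rewrite -e addn0 mul1r; have := p0 (fals (flipc z l.1) T); lra.
  apply: le_trans (ler_sum _ hbound) _; rewrite -mulr_sumr mulrCA ler_wpM2l ?exprn_ge0 //.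
  rewrite big_split /= -mulr_suml sumr_const -mulr_natl -natr_sum.
  have : (\sum_(l in N') (l \notin T) <= nu)%N.
    apply: leq_trans (Jnear _ hT); rewrite -sum1_card big_mkcond [X in (_ <= X)%N]big_mkcond /=.
    apply: leq_sum => l _; rewrite !inE.
    by case: (l \in T0) => //=; case: (l \in T); case: (f _); case: (_ \in Z).
  rewrite -(ler_nat rat) => h; have : (16 * nu)%:R <= #|N'|%:R :> rat.
    by rewrite ler_nat ltnW.
  rewrite natrM; lra.
have [l hl hle] : exists2 l, l \in N' & potential (flipc z l.1) <= potential z / 2.
  apply/exists_inP; apply: contraTT hsum; rewrite negb_exists_in => /forall_inP h.
  rewrite -ltNge -sum1_card natr_sum mulr_suml.
  have /card_gt0P [l0 hl0] : (0 < #|N'|)%N by lia.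
  rewrite (bigD1 l0) //= [X in _ < X](bigD1 l0) //=; apply: ltr_leD.
    by rewrite mul1r ltNge h.
  by apply: ler_sum => l /andP[hl _]; rewrite mul1r ltW // ltNge h.
by move: hl; rewrite inE => /andP[h1 h2]; exists l.
Qed.

(* Flipping an insensitive literal of [T0] kills most nearby terms, so after
   fewer than [tau] flips almost all literals of [T0] have become sensitive. *)
Lemma sensitive_chain : exists2 Z : {set 'I_n},
  Z \subset vars T0 /\ (#|Z| <= tau)%N &
  f (flips y Z) /\ (#|insensitive (flips y Z)| <= 16 * nu + tau)%N.
Proof.
(* Terms outside [J] start with more than [tau] false literals and [tau] flips cannot repair them
   all. The term that makes [f] true is therefore in [J] and contributes 1. *)
have pos_pot (Z : {set 'I_n}) : (#|Z| <= tau)%N -> f (flips y Z) -> 1 <= potential (flips y Z).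
  move=> hZ; rewrite fE => /exists_inP[T hT hTz].
  have TJ : T \in J.
    apply: contraTT hTz => hTJ; have := Jfar _ hT hTJ; have := fals_flips T y Z.
    rewrite term_eval_fals; lia.
  rewrite /potential (bigD1 T) //= (eqP (etrans (esym (term_eval_fals _ _)) hTz)) expr0.
  by rewrite lerDl sumr_ge0 // => T' _; rewrite exprn_ge0.
(* The potential starts below [2 ^ tau] and halves with every flip, so after [tau] flips it would be
   less than 1, against [pos_pot]. *)
suff main m (Z : {set 'I_n}) : (m + #|Z| = tau)%N -> Z \subset vars T0 -> f (flips y Z) ->
    potential (flips y Z) <= #|Fc|%:R / 2 ^+ #|Z| ->
    exists2 Z : {set 'I_n}, Z \subset vars T0 /\ (#|Z| <= tau)%N &
      f (flips y Z) /\ (#|insensitive (flips y Z)| <= 16 * nu + tau)%N.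
  apply: (main tau set0).
  - by rewrite cards0 addn0.
  - exact: sub0set.
  - by rewrite flips0; apply: f_sat yT0.
  - rewrite cards0 expr0 divr1 /potential.
    apply: (@le_trans _ _ (\sum_(T in J) 1)).
      by apply: ler_sum => T _; rewrite exprn_ile1.
    by rewrite sumr_const ler_nat subset_leq_card.
elim: m Z => [|m ih] Z hm hZ hf hpot.
  have := pos_pot Z _ hf; rewrite -hm add0n leqnn => /(_ isT) h1.
  have : 1 <= #|Fc|%:R / 2 ^+ #|Z| :> rat by apply: le_trans hpot.
  rewrite ler_pdivlMr ?exprn_gt0 // mul1r -natrX ler_nat.
  by move: hm; rewrite add0n => ->; rewrite leqNgt Ftau.
have hZt : (#|Z| <= tau)%N by lia.
case: (leqP #|insensitive (flips y Z)| (16 * nu + tau)) => hN; first by exists Z.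
have [l hl [lZ hle]] := potential_descent Z hZ hZt hN.
move: hl; rewrite inE => /andP[lT0 hfl].
rewrite flipc_flips // in hfl hle.
have hc : #|l.1 |: Z| = #|Z|.+1 by rewrite cardsU1 lZ.
apply: (ih (l.1 |: Z)) => //.
- by rewrite hc addnS.
- by rewrite subUset hZ andbT sub1set in_vars.
- rewrite hc exprSr invfM mulrA; apply: le_trans hle _.
  by rewrite ler_pM2r.
Qed.

Lemma sens_sub (T : term n) (z : cube n) : T \in Fc -> term_eval T z -> sens f z \subset T.
Proof.
move=> hT hz; apply/subsetP => [[i b]]; rewrite !inE /= => /andP[/eqP ->].
apply: contraR => hi; apply: (f_sat _ _ hT).
move: hz; rewrite !term_eval_fals => /eqP hz; have := fals_flipc T z i.
by rewrite hz (negbTE hi) addn0; lia.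
Qed.

(** The flips may falsify [T0] itself, so progress is measured against whichever [T1] in [J] is true
    at the end. Its insensitive literals are at most [nu] outside [T0] plus the [16 * nu + tau] left
    by the chain. *)
Lemma sensitive_term : exists Z : {set 'I_n}, exists2 T1 : term n,
  [/\ Z \subset vars T0, (#|Z| <= tau)%N & T1 \in J] &
  [/\ term_eval T1 (flips y Z), sens f (flips y Z) \subset T1 &
      (#|T1 :\: sens f (flips y Z)| <= 17 * nu + tau)%N].
Proof.
have [Z [hZ hZt] [hf hN]] := sensitive_chain.
exists Z; move: (hf); rewrite fE => /exists_inP[T1 T1F hT1].
have T1J : T1 \in J.
  apply: contraTT hT1 => hTJ; have := Jfar _ T1F hTJ; have := fals_flips T1 y Z.
  rewrite term_eval_fals; lia.
exists T1; split => //; first exact: sens_sub.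
have : (#|T1 :\: sens f (flips y Z)| <= #|T1 :\: T0| + #|insensitive (flips y Z)|)%N.
  rewrite -(cardsID T0 (T1 :\: sens f (flips y Z))) addnC leq_add //.
    by apply/subset_leq_card/subsetP => l; rewrite !inE => /and3P[-> _ ->].
  apply/subset_leq_card/subsetP => l; rewrite !inE => /andP[/andP[h lT1] lT0].
  rewrite lT0 /=; move: h; rewrite negb_and negbK.
  by rewrite (elimT (term_evalP _ _) hT1 _ lT1) eqxx.
rewrite (cardD_sym T1 T0) //; have := Jnear _ T1J; lia.
Qed.

End Chain.

End Local.

(* Some assignment of one variable of [V] falsifies a sixteenth of the
   family, because every member constrains a quarter of [V]. *)
Lemma hitting_assignment {n : nat} (V : {set 'I_n}) (r m : nat) (U0 : {set 'I_n})
    (Bad : {set term n}) :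
  (#|V| <= r)%N -> (8 * (#|U0| + m) <= r)%N ->
  (forall T, T \in Bad -> r <= 4 * #|vars T :&: V|)%N ->
  (#|Bad| * 15 ^ m < 16 ^ m)%N ->
  exists U : {set 'I_n}, exists2 u : cube n,
    [/\ U \subset V, [disjoint U & U0] & (#|U| <= m)%N] &
    forall T, T \in Bad -> exists2 i, i \in U & (i, ~~ tnth u i) \in T.
Proof.
move=> Vr; elim: m U0 Bad => [|m ih] U0 Bad hU0 hV hB.
  exists set0, (zeros : cube n).
    by rewrite sub0set cards0 disjoints_subset sub0set.
  move=> T hT; move: hB; rewrite !expn0 muln1 ltnS leqn0 cards_eq0 => /eqP h.
  by move: hT; rewrite h inE.
have [B0|/card_gt0P [T1 hT1]] := posnP #|Bad|.
  exists set0, (zeros : cube n).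
    by rewrite sub0set cards0 disjoints_subset sub0set.
  by move=> T hT; move/cards0_eq: B0 => h; move: hT; rewrite h inE.
pose cnt (i : 'I_n) b := #|[set T in Bad | (i, b) \in T]|.
(* Double counting: each member keeps at least [r / 8] of its variables in [V] once [U0] is removed,
   and at most [2 * r] literals are available, so some literal lies in a sixteenth of [Bad]. *)
have [i [b [hi hiU hc]]] : exists i, exists b,
    [/\ i \in V, i \notin U0 & (#|Bad| <= 16 * cnt i b)%N].
  apply: contrapT => hno.
  have hlt i b : i \in V :\: U0 -> (16 * cnt i b < #|Bad|)%N.
    rewrite inE => /andP[h1 h2]; rewrite ltnNge; apply/negP => h3.
    by apply: hno; exists i, b.
  have h1 : (\sum_(i in V :\: U0) (cnt i true + cnt i false) * 8 < r * #|Bad|)%N.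
    have r0 : (0 < r)%N by lia.
    have B0 : (0 < #|Bad|)%N by apply/card_gt0P; exists T1.
    apply: (@leq_ltn_trans (\sum_(i in V :\: U0) (#|Bad| - 1))%N).
      apply: leq_sum => i hiV; have := hlt i true hiV; have := hlt i false hiV; lia.
    rewrite sum_nat_const.
    have : (#|V :\: U0| <= r)%N by apply: leq_trans Vr; rewrite subset_leq_card // subsetDl.
    nia.
  have h2 : (\sum_(T in Bad) #|vars T :&: (V :\: U0)|
       <= \sum_(i in V :\: U0) (cnt i true + cnt i false))%N.
    rewrite (eq_bigr (fun T => \sum_(i in V :\: U0) (masked T i))%N) => [|T _]; last first.
      rewrite -sum1_card big_mkcond [RHS]big_mkcond /=; apply: eq_bigr => i _.
      by rewrite in_setI [i \in vars T]inE andbC; case: (i \in V :\: U0) => //=; case: (masked T i).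
    rewrite exchange_big /=; apply: leq_sum => i _.
    rewrite /cnt -!sum1_card !(big_mkcond (mem [set _ in _ | _])) /= -big_split /=.
    rewrite big_mkcond /=; apply: leq_sum => T _; rewrite !inE /masked.
    by case: (T \in Bad) => //=; do 2 case: (_ \in T).
  have h3 : (\sum_(T in Bad) r <= \sum_(T in Bad) 8 * #|vars T :&: (V :\: U0)|)%N.
    apply: leq_sum => T hT; have := hV T hT.
    have : (#|vars T :&: V| <= #|vars T :&: (V :\: U0)| + #|U0|)%N.
      rewrite -(cardsID U0 (vars T :&: V)) addnC leq_add //.
        by apply/subset_leq_card/subsetP => i; rewrite !inE => /and3P[-> -> ->].
      by apply/subset_leq_card/subsetIr.
    lia.
  move: h1 h2 h3; rewrite sum_nat_const -big_distrr -big_distrl /= [(r * _)%N]mulnC.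
  lia.
pose Bad' := [set T in Bad | (i, b) \notin T].
have hB' : (#|Bad'| + cnt i b = #|Bad|)%N.
  rewrite -(cardsID [set T : term n | (i, b) \in T] Bad) addnC; congr (_ + _)%N;
    by apply: eq_card => T; rewrite !inE andbC.
have [|T hT| |U [u [hUV hUU hUm] hu]] := ih (i |: U0) Bad'.
- rewrite cardsU1 hiU; lia.
- by apply: hV; move: hT; rewrite inE => /andP[].
- move: hB; rewrite !expnS; set p := (15 ^ m)%N; set q := (16 ^ m)%N => hB.
  have : (16 * #|Bad'| <= 15 * #|Bad|)%N by lia.
  nia.
have iU : i \notin U.
  by apply/negP => /(disjointFr hUU); rewrite !inE eqxx.
exists (i |: U), [tuple if j == i then ~~ b else tnth u j | j < n].
  split.
  - by rewrite subUset sub1set hi.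
  - rewrite disjoint_sym disjoints_subset; apply/subsetP => j hj; rewrite !inE negb_or.
    apply/andP; split; first by apply: contraNneq hiU => <-.
    by rewrite (disjointFl hUU) // inE hj orbT.
  - by rewrite cardsU1 iU ltnS.
move=> T hT; case hib : ((i, b) \in T).
  by exists i; rewrite ?setU11 // tnth_mktuple eqxx negbK.
have [|j hj hjT] := hu T; first by rewrite inE hT hib.
exists j; first by rewrite inE hj orbT.
by rewrite tnth_mktuple; case: eqP => // e; move: iU; rewrite -e hj.
Qed.


(** * Success probabilities of one attempt *)

(** The outcome lies in [S] with probability at least [c], expressed through nonnegative test
    functions; such bounds multiply along [reach_bind]. *)
Definition reach {R : realType} {V : Type} (c : R) (S : V -> Prop)
    (M : (V -> R) -> R) : Prop :=
  forall (phi : V -> R) (u : R), (forall v, 0 <= phi v) -> 0 <= u ->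
    (forall v, S v -> u <= phi v) -> c * u <= M phi.

(** * Noise that preserves one term and falsifies the exposed ones *)

Section Noise.
Context {R : realType} {n : nat}.
Implicit Types (T A : term n) (y z : cube n).

Lemma sum_prod_cube (w : 'I_n -> bool -> R) :
  \sum_(z : cube n) \prod_i w i (tnth z i) = \prod_i \sum_b w i b.
Proof.
have := mapM_mapM_cube w (fun _ => 1).
under [in X in _ = X -> _]eq_bigr do rewrite mulr1.
move=> <-; rewrite -[RHS]big_enum /=; elim: (enum 'I_n) => [|i s ih] /=.
  by rewrite big_nil.
by rewrite ih big_cons mulr_suml.
Qed.

(** Where a literal of [T] can be false while [T0] holds: either the variable is free to flip, or
    [T0] already forces the opposite value. *)
Definition exposed (A T0 T : term n) : {set 'I_n} :=
  [set i | masked (T :\: T0) i && (~~ masked A i || masked T0 i)].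

Lemma term_eval_agree T y z : term_eval T y ->
  term_eval T z = [forall i, masked T i ==> (tnth z i == tnth y i)].
Proof.
move=> /term_evalP hy; apply/term_evalP/forallP => [hz i|h [i b] hl].
  apply/implyP; rewrite /masked => /orP[] hi.
    by rewrite -(hy _ hi) -(hz _ hi).
  by rewrite -(hy _ hi) -(hz _ hi).
have /implyP := h i; rewrite -[i]/((i, b).1) -in_set -/(vars T) in_vars // => /(_ isT) /eqP.
by rewrite /= => ->; exact: (hy _ hl).
Qed.

Lemma prod_nat_pow (c : R) (I : finType) (e : I -> nat) :
  c ^+ (\sum_i e i)%N = \prod_i c ^+ e i.
Proof. by rewrite -expr_sum. Qed.

Lemma flip_weight_ge0 j A y i b : (1 <= j)%N -> 0 <= flip_weight j A y i b :> R.
Proof.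
move=> hj; rewrite /flip_weight; case: masked; first exact: ler0n.
have h1 : (2^-1 : R) ^+ j <= 1 by apply: exprn_ile1; lra.
case: eqP => _; first by lra.
by apply: exprn_ge0; lra.
Qed.

Lemma half_pow (j : nat) : (1 <= j)%N -> (2^-1 : R) ^+ j <= 2^-1.
Proof.
case: j => // j _; rewrite exprS -[X in _ <= X]mulr1 ler_wpM2l //; first lra.
by apply: exprn_ile1; lra.
Qed.

(** One coordinate of the generating function, at 1/2, of the number of false literals of [T],
    restricted to [T0] being true. On an exposed variable of [T0] the literal is false and the
    factor 1/2 is below [1 - q / 2]; on an exposed variable outside [T0] the mean is [1 - q / 2] or
    [(1 + q) / 2], and the latter is no larger because [q <= 1/2]. *)
Lemma flip_weight_bound j A y T0 T i : (1 <= j)%N -> term_eval T0 y ->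
  \sum_b flip_weight j A y i b * (masked T0 i ==> (b == tnth y i))%:R
      * 2^-1 ^+ ((i, ~~ b) \in T)
  <= (if masked T0 i && ~~ masked A i then 1 - 2^-1 ^+ j else 1)
     * (if i \in exposed A T0 T then 1 - 2^-1 ^+ j / 2 else 1) :> R.
Proof.
move=> hj hy; set q : R := 2^-1 ^+ j.
have q0 : 0 <= q by apply: exprn_ge0; lra.
have q1 : q <= 2^-1 by exact: half_pow.
pose E b : R := 2^-1 ^+ ((i, ~~ b) \in T).
have E1 b : 0 <= E b <= 1 by rewrite /E; case: (_ \in T); rewrite ?expr0 ?expr1; lra.
have Eh b : (i, ~~ b) \in T -> E b = 2^-1 by rewrite /E => ->; rewrite expr1.
have -> : \sum_b flip_weight j A y i b * (masked T0 i ==> (b == tnth y i))%:R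
      * 2^-1 ^+ ((i, ~~ b) \in T)
   = (if masked A i then 1 else 1 - q) * E (tnth y i)
     + (if masked A i || masked T0 i then 0 else q) * E (~~ tnth y i) :> R.
  rewrite big_bool /= /flip_weight -/q -/(E true) -/(E false).
  by case: (masked A i); case: (masked T0 i); case: (tnth y i) => /=; ring.
have := E1 (tnth y i); have := E1 (~~ tnth y i).
have -> : (i \in exposed A T0 T)
    = masked (T :\: T0) i && (~~ masked A i || masked T0 i) by rewrite inE.
case: (boolP (masked T0 i)) => hT0.
  rewrite !orbT andbT /= => _ hE; rewrite mul0r addr0.
  have -> : (if ~~ masked A i then 1 - q else 1) = (if masked A i then 1 else 1 - q).
    by case: masked.
  apply: ler_wpM2l; first by case: ifP => _; lra.
  case: ifP => [h|_]; last by case/andP: hE.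
  rewrite Eh; first by clear -q0 q1; lra.
  have hb b : (i, b) \in T :\: T0 -> (i, ~~ tnth y i) \in T.
    rewrite inE => /andP[h1 h2]; suff -> : ~~ tnth y i = b by [].
    move: hT0; rewrite /masked => /orP[] h3;
      rewrite -(elimT (term_evalP _ _) hy _ h3) /=;
      by case: b h1 {h2} => //; rewrite h3.
  by move: h; rewrite /masked => /orP[] /hb.
rewrite orbF /= mul1r; case: (masked A i); rewrite /= ?andbF ?andbT.
  by clear; lra.
have -> : masked (T :\: T0) i = masked T i.
  move: hT0; rewrite /masked !inE negb_or => /andP[/negbTE -> /negbTE ->] //.
case: ifP => [|_]; last by clear -q0 q1; nra.
have hb b : (i, b) \in T -> E (tnth y i) = 2^-1 \/ E (~~ tnth y i) = 2^-1.
  case hby : (b == tnth y i); move=> h; [right|left]; apply: Eh.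
    by rewrite negbK -(eqP hby).
  by move: hby h; case: b; case: (tnth y i).
by rewrite /masked => /orP[] /hb [] ->; clear -q0 q1; nra.
Qed.

(** Chernoff and union bound relative to the event that [T0] survives: the weights factor over
    coordinates, so the survival probability comes out as a common factor and at most half of it is
    lost to terms of [K]. *)
Lemma noise_reach j A y T0 (K : {set term n}) (w t : nat) :
  (1 <= j)%N -> term_eval T0 y ->
  (forall T, T \in K -> (w <= #|exposed A T0 T|)%N) ->
  #|K|%:R * (2 ^+ t * (1 - 2^-1 ^+ j / 2) ^+ w) <= 2^-1 :> R ->
  reach ((1 - 2^-1 ^+ j) ^+ #|[set i | masked T0 i && ~~ masked A i]| / 2)
    (fun z => term_eval T0 z /\ forall T, T \in K -> (t <= fals z T)%N)
    (noiseM (R := R) j A y).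
Proof.
move=> hj hy hK hsmall phi u phi0 u0 hphi.
set q : R := 2^-1 ^+ j.
have q0 : 0 <= q by apply: exprn_ge0; lra.
have q1 : q <= 2^-1 by exact: half_pow.
pose W (z : cube n) : R := \prod_i flip_weight j A y i (tnth z i).
have W0 z : 0 <= W z by apply: prodr_ge0 => i _; exact: flip_weight_ge0.
pose g i b : R := flip_weight j A y i b * (masked T0 i ==> (b == tnth y i))%:R.
have hg z : W z * (term_eval T0 z)%:R = \prod_i g i (tnth z i).
  rewrite big_split /= -/(W z); congr (_ * _); rewrite (term_eval_agree _ _ _ hy).
  case: forallP => [h|/forallP]; first by rewrite big1 // => i _; rewrite h.
  by rewrite negb_forall => /existsP[i hi]; rewrite (bigD1 i) //= (negbTE hi) mul0r.
pose e i : R := if masked T0 i && ~~ masked A i then 1 - q else 1.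
have he i : \sum_b g i b = e i.
  rewrite big_bool /g /e /flip_weight -/q; case: (masked A i); case: (masked T0 i);
    case: (tnth y i) => /=; ring.
have P0 : \prod_i e i = (1 - q) ^+ #|[set i | masked T0 i && ~~ masked A i]|.
  rewrite -prodr_const [RHS]big_mkcond /=; apply: eq_bigr => i _.
  by rewrite inE.
have hT T : T \in K -> \sum_z W z * (term_eval T0 z)%:R * 2^-1 ^+ fals z T
     <= \prod_i e i * (1 - q / 2) ^+ w.
  move=> TK.
  rewrite (eq_bigr (fun z => \prod_i (g i (tnth z i) * 2^-1 ^+ ((i, ~~ tnth z i) \in T)))); last first.
    by move=> z _; rewrite hg prod_nat_pow -big_split.
  rewrite (sum_prod_cube (fun i b => g i b * 2^-1 ^+ ((i, ~~ b) \in T))).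
  apply: (@le_trans _ _ (\prod_i e i * \prod_(i in exposed A T0 T) (1 - q / 2))).
    rewrite [X in _ * X]big_mkcond -big_split /=; apply: ler_prod => i _.
    apply/andP; split.
      apply: sumr_ge0 => b _; rewrite /g !mulr_ge0 ?flip_weight_ge0 ?ler0n //.
      by apply: exprn_ge0; lra.
    exact: flip_weight_bound.
  rewrite prodr_const ler_wpM2l //.
    by apply: prodr_ge0 => i _; rewrite /e; case: ifP => _; lra.
  by apply: ler_wiXn2l; [lra|lra|exact: hK].
have P0ge : 0 <= \prod_i e i.
  by apply: prodr_ge0 => i _; rewrite /e; case: ifP => _; lra.
have hsum0 : \sum_z W z * (term_eval T0 z)%:R = \prod_i e i.
  by rewrite (eq_bigr _ (fun z _ => hg z)) sum_prod_cube; apply: eq_bigr.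
rewrite -P0.
(* The factor [1 - \sum_T 2^(t - fals z T)] is a lower bound for the indicator that every [T] in [K]
   has at least [t] false literals. *)
apply: (@le_trans _ _ (\sum_z W z * (term_eval T0 z)%:R
          * (1 - \sum_(T in K) 2 ^+ t * 2^-1 ^+ fals z T) * u)).
  rewrite -mulr_suml ler_wpM2r //.
  rewrite (eq_bigr (fun z => W z * (term_eval T0 z)%:R - W z * (term_eval T0 z)%:R
     * \sum_(T in K) 2 ^+ t * 2^-1 ^+ fals z T)); last by move=> z _; rewrite mulrBr mulr1.
  rewrite sumrB hsum0.
  have : \sum_z W z * (term_eval T0 z)%:R * \sum_(T in K) 2 ^+ t * 2^-1 ^+ fals z T
     <= \prod_i e i * 2^-1.
    rewrite (eq_bigr _ (fun z _ => mulr_sumr _ _ _ _)) exchange_big /=.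
    apply: (@le_trans _ _ (\sum_(T in K) 2 ^+ t * (\prod_i e i * (1 - q / 2) ^+ w))).
      apply: ler_sum => T TK; rewrite (eq_bigr _ (fun z _ => mulrCA _ _ _)).
      by rewrite -mulr_sumr ler_wpM2l ?hT // exprn_ge0.
    rewrite sumr_const -[_ *+ #|_|]mulr_natl [2 ^+ t * _]mulrCA [#|_|%:R * _]mulrCA.
    by rewrite ler_wpM2l.
  lra.
rewrite /noiseM; apply: ler_sum => z _; rewrite -/(W z) -!mulrA ler_wpM2l //.
case hz : (term_eval T0 z); last by rewrite mul0r.
rewrite mul1r; case: (boolP [forall T in K, (t <= fals z T)%N]) => [/forall_inP hf|].
  apply: le_trans (hphi z _); last by split.
  rewrite ler_piMl // gerBl sumr_ge0 // => T _.
  by rewrite mulr_ge0 // exprn_ge0 //; lra.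
rewrite negb_forall_in => /exists_inP[T TK]; rewrite -ltnNge => hlt.
apply: le_trans (phi0 z); apply: mulr_le0_ge0 => //; rewrite subr_le0.
rewrite (bigD1 T) //= -[X in X <= _]addr0; apply: lerD.
  rewrite -(subnK (ltnW hlt)) exprD -mulrA -exprMn divff ?pnatr_eq0 // expr1n mulr1.
  by apply: exprn_ege1; lra.
rewrite sumr_ge0 // => T' _.
by rewrite mulr_ge0 // exprn_ge0 //; lra.
Qed.
End Noise.


(** * Calculus of expectations and hitting probabilities *)

Section Expectation.
Context {R : realType}.

(** Monotonicity and translation by constants are combined in one clause, which is stable under
    composition; every randomized subroutine inherits it. *)
Definition expectation {V : Type} (M : (V -> R) -> R) : Prop :=
  (forall phi psi c, (forall v, phi v + c <= psi v) -> M phi + c <= M psi)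
  /\ M (fun=> 0) = 0.

Lemma expectation_le {V} (M : (V -> R) -> R) phi psi :
  expectation M -> (forall v, phi v <= psi v) -> M phi <= M psi.
Proof.
move=> [h _] hle; have := h phi psi 0; rewrite addr0; apply=> v.
by rewrite addr0.
Qed.

Lemma expectation_ge0 {V} (M : (V -> R) -> R) phi :
  expectation M -> (forall v, 0 <= phi v) -> 0 <= M phi.
Proof. by move=> hM h; case: (hM) => _ <-; apply: expectation_le. Qed.

Lemma expectation_ret {V} (v : V) : expectation (fun phi => phi v).
Proof. by split. Qed.

Lemma expectation_bind {V W} (M : (V -> R) -> R) (N : V -> (W -> R) -> R) :
  expectation M -> (forall v, expectation (N v)) ->
  expectation (fun phi => M (fun v => N v phi)).
Proof.
move=> [h1 h2] hN; split=> [phi psi c h|].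
  by apply: h1 => v; apply: (hN v).1.
by rewrite -[RHS]h2; congr M; apply/funext => v; apply: (hN v).2.
Qed.

Lemma expectation_mix {V} (c : R) (M N : (V -> R) -> R) : 0 <= c <= 1 ->
  expectation M -> expectation N ->
  expectation (fun phi => c * M phi + (1 - c) * N phi).
Proof.
move=> /andP[c0 c1] [M1 M2] [N1 N2]; split=> [phi psi d h|].
  by have := M1 _ _ _ h; have := N1 _ _ _ h; nra.
by rewrite M2 N2; ring.
Qed.

Lemma expectation_loop {V} (M : V -> (V -> R) -> R) m v :
  (forall v, expectation (M v)) -> expectation (loopM m M v).
Proof.
move=> h; elim: m v => [|m ih] v; first exact: expectation_ret.
exact: (expectation_bind (M v) (loopM m M)).
Qed.

Lemma expectation_fold {X V} (M : X -> V -> (V -> R) -> R) xs v :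
  (forall x v, expectation (M x v)) -> expectation (foldM M xs v).
Proof.
move=> h; elim: xs v => [|x xs ih] v; first exact: expectation_ret.
exact: (expectation_bind (M x v) (foldM M xs)).
Qed.

Lemma expectation_map {X Y} (M : X -> (Y -> R) -> R) xs :
  (forall x, expectation (M x)) -> expectation (mapM M xs).
Proof.
move=> h; elim: xs => [|x xs ih]; first exact: expectation_ret.
apply: (expectation_bind (M x) (fun y phi => mapM M xs (fun ys => phi (y :: ys)))) => // y.
exact: (expectation_bind _ (fun ys phi => phi (y :: ys)) ih).
Qed.

Lemma expectation_sum {I : finType} {V} (w : I -> R) (t : I -> V) :
  (forall i, 0 <= w i) -> \sum_i w i = 1 ->
  expectation (fun phi => \sum_i w i * phi (t i)).
Proof.
move=> w0 w1; split=> [phi psi c h|]; last by rewrite big1 // => i _; rewrite mulr0.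
rewrite -[X in _ + X]mul1r -w1 mulr_suml -big_split /=; apply: ler_sum => i _.
by rewrite -mulrDr ler_wpM2l.
Qed.

Lemma reach_bind {V W} c1 c2 (S1 : V -> Prop) (S2 : W -> Prop)
    (M : (V -> R) -> R) (N : V -> (W -> R) -> R) :
  0 <= c2 -> reach c1 S1 M -> (forall v, S1 v -> reach c2 S2 (N v)) ->
  (forall v, expectation (N v)) ->
  reach (c1 * c2) S2 (fun phi => M (fun v => N v phi)).
Proof.
move=> c20 hM hN hE phi u phi0 u0 hu; rewrite -mulrA; apply: hM.
- by move=> v; apply: expectation_ge0.
- exact: mulr_ge0.
- by move=> v hv; apply: hN.
Qed.

Lemma reach_ret {V} (S : V -> Prop) v : S v -> reach (1 : R) S (fun phi => phi v).
Proof. by move=> hv phi u _ _ h; rewrite mul1r; exact: h. Qed.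

Lemma reach_le {V} c1 c2 (S : V -> Prop) (M : (V -> R) -> R) :
  c2 <= c1 -> reach c1 S M -> reach c2 S M.
Proof.
move=> hc h phi u phi0 u0 hu; apply: le_trans (h phi u phi0 u0 hu).
by rewrite ler_wpM2r.
Qed.

Lemma reach_sub {V} c (S1 S2 : V -> Prop) (M : (V -> R) -> R) :
  (forall v, S1 v -> S2 v) -> reach c S1 M -> reach c S2 M.
Proof. by move=> hS h phi u phi0 u0 hu; apply: h => // v /hS; exact: hu. Qed.

Lemma reach_map {X Y} (M : X -> (Y -> R) -> R) (t : X -> Y) (c : X -> R) xs :
  (forall x, 0 <= c x) -> (forall x, expectation (M x)) ->
  (forall x, reach (c x) (eq (t x)) (M x)) ->
  reach (\prod_(x <- xs) c x) (eq (map t xs)) (mapM M xs).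
Proof.
move=> c0 hE h; elim: xs => [|x xs ih]; first by rewrite big_nil; exact: reach_ret.
rewrite big_cons.
apply: (reach_bind _ _ (eq (t x)) (eq (map t (x :: xs))) (M x)
   (fun y phi => mapM M xs (fun ys => phi (y :: ys)))).
- exact: prodr_ge0.
- exact: h.
- move=> y <- phi u phi0 u0 hu; apply: ih => // ys <-; exact: hu.
- move=> y; apply: (expectation_bind _ (fun ys phi => phi (y :: ys))) => [|ys].
    exact: expectation_map.
  exact: expectation_ret.
Qed.

Lemma bernoulli (x : R) m : 0 <= x -> 1 + m%:R * x <= (1 + x) ^+ m.
Proof.
move=> x0; elim: m => [|m ih]; first by rewrite expr0; lra.
rewrite exprS; apply: (@le_trans _ _ ((1 + x) * (1 + m%:R * x))); last first.
  by rewrite ler_wpM2l //; lra.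
have : 0 <= m%:R * x * x by rewrite !mulr_ge0 // ler0n.
by rewrite -natr1; lra.
Qed.

(** Bernoulli gives [(1 + q) ^ (1 / q) >= 2], and the product with [(1 - q) ^ (1 / q)] is at most
    1. *)
Lemma pow2_compl_le (j : nat) : (1 - 2^-1 ^+ j) ^+ (2 ^ j) <= 2^-1 :> R.
Proof.
set q : R := 2^-1 ^+ j; have q0 : 0 <= q by apply: exprn_ge0; lra.
have q1 : q <= 1 by apply: exprn_ile1; lra.
have h2 : 2 <= (1 + q) ^+ (2 ^ j).
  apply: le_trans (bernoulli _ _ q0).
  rewrite natrX /q -exprMn divff ?pnatr_eq0 // expr1n; lra.
have h1 : (1 - q) ^+ (2 ^ j) * (1 + q) ^+ (2 ^ j) <= 1.
  rewrite -exprMn; apply: exprn_ile1; nra.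
have : 0 <= (1 - q) ^+ (2 ^ j) by apply: exprn_ge0; lra.
nra.
Qed.

(** The sequence increases from its value 1/4 at [j = 1], since [(1 - q / 2) ^ 2 >= 1 - q]. *)
Lemma pow2_compl_ge (j : nat) : (1 <= j)%N -> 4^-1 <= (1 - 2^-1 ^+ j) ^+ (2 ^ j) :> R.
Proof.
case: j => // j _; elim: j => [|j ih]; first by rewrite expr1 expn1 expr2; lra.
apply: le_trans ih _; rewrite [(2 ^ j.+2)%N]expnS exprM.
have q0 : 0 <= 2^-1 ^+ j.+1 :> R by apply: exprn_ge0; lra.
have q1 : 2^-1 ^+ j.+1 <= 2^-1 :> R by exact: half_pow.
apply: lerXn2r; rewrite ?nnegrE; [lra|exact: sqr_ge0|].
rewrite [2^-1 ^+ j.+2]exprS expr2; nra.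
Qed.

Lemma pow_compl_ge (j m c : nat) : (1 <= j)%N -> (m <= c * 2 ^ j)%N ->
  4^-1 ^+ c <= (1 - 2^-1 ^+ j) ^+ m :> R.
Proof.
move=> hj hm; have q1 : 2^-1 ^+ j <= 2^-1 :> R by exact: half_pow.
have q0 : 0 <= 2^-1 ^+ j :> R by apply: exprn_ge0; lra.
apply: (@le_trans _ _ ((1 - 2^-1 ^+ j) ^+ (c * 2 ^ j))); last first.
  by apply: ler_wiXn2l => //; lra.
rewrite mulnC exprM; apply: lerXn2r; rewrite ?nnegrE; [lra| |exact: pow2_compl_ge].
by apply: exprn_ge0; lra.
Qed.

End Expectation.

(** * Random choices of a term, of bit flips and of edits *)

Section Primitives.
Context {R : realType} {n : nat}.
Variables (B a : nat).
Hypothesis a1 : (1 <= a)%N.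
Implicit Types (T A : term n) (y z : cube n) (L : dnf n).
Let q : R := 2^-1 ^+ a.

Lemma rate_ge0 : 0 <= q. Proof. by apply: exprn_ge0; lra. Qed.
Lemma rate_le : q <= 2^-1. Proof. exact: half_pow. Qed.

Lemma expectation_rare j : expectation (rareM (R := R) j).
Proof.
apply: (expectation_mix _ (fun phi => phi true) (fun phi => phi false)).
- apply/andP; split; first by apply: exprn_ge0; lra.
  by apply: exprn_ile1; lra.
- exact: expectation_ret.
- exact: expectation_ret.
Qed.

Lemma reach_rare b : reach (if b then q else 1 - q) (eq b) (rareM (R := R) a).
Proof.
move=> phi u phi0 u0 hu; rewrite /rareM -/q.
have q0 := rate_ge0; have q1 := rate_le.
by have := phi0 true; have := phi0 false; case: b hu => hu; have := hu _ erefl; nra.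
Qed.

Lemma expectation_pick A L : expectation (pickM (R := R) B a A L).
Proof.
apply: expectation_fold => T A'.
apply: (expectation_bind _ (fun b phi => phi (if b then T else A'))).
  exact: expectation_rare.
by move=> b; exact: expectation_ret.
Qed.

Let pick1 A T (phi : term n -> R) : R := rareM a (fun b => phi (if b then T else A)).

Lemma pick_step A T :
  reach (1 - q) (eq A) (fun phi => rareM (R := R) a (fun b => phi (if b then T else A))) /\
  reach q (eq T) (fun phi => rareM (R := R) a (fun b => phi (if b then T else A))).
Proof.
split=> phi u phi0 u0 hu.
- by apply: (reach_rare false) => // b <-; apply: hu.
- by apply: (reach_rare true) => // b <-; apply: hu.
Qed.

(** Among at most [2 ^ a] coins of bias [2^-a] none succeeds with probability at least 1/4; hence
    the need to keep lists shorter than [2 ^ a]. *)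
Lemma reach_pick0 A L : (size (take B L) <= 2 ^ a)%N ->
  reach (4^-1) (eq A) (pickM (R := R) B a A L).
Proof.
move=> hs; apply: (reach_le ((1 - q) ^+ size (take B L))).
  by rewrite -[4^-1]expr1; apply: pow_compl_ge; rewrite ?mul1n.
rewrite /pickM; elim: (take B L) {hs} => [|T s ih]; first by rewrite expr0; exact: reach_ret.
rewrite /= exprS; have q1 := rate_le; have q0 := rate_ge0.
pose N (A : term n) (phi : term n -> R) :=
  foldM (fun T A phi => rareM a (fun b => phi (if b then T else A))) s A phi.
apply: (reach_bind _ _ (eq A) _ (pick1 A T) N).
- by apply: exprn_ge0; lra.
- exact: (pick_step A T).1.
- by move=> _ <-.
- move=> v; apply: expectation_fold => T' A'.
  apply: (expectation_bind _ (fun b phi => phi (if b then T' else A'))).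
    exact: expectation_rare.
  by move=> b; exact: expectation_ret.
Qed.

Lemma reach_pick A L T : (size (take B L) <= 2 ^ a)%N -> T \in take B L ->
  reach (q / 4) (eq T) (pickM (R := R) B a A L).
Proof.
move=> hs hT; have q1 := rate_le; have q0 := rate_ge0.
have hfold (s : seq (term n)) A' : expectation (foldM (fun T A (phi : term n -> R) =>
    rareM a (fun b => phi (if b then T else A))) s A').
  apply: expectation_fold => T' A''.
  apply: (expectation_bind _ (fun b phi => phi (if b then T' else A''))).
    exact: expectation_rare.
  by move=> b; exact: expectation_ret.
apply: (reach_le (q * (1 - q) ^+ size (take B L))).
  by rewrite ler_wpM2l // -[4^-1]expr1; apply: pow_compl_ge; rewrite ?mul1n.
rewrite /pickM; elim: (take B L) A {hs} hT => [//|T' s ih] A.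
rewrite in_cons; case: (boolP (T \in s)) => [hs _|_].
  rewrite /= exprS mulrCA.
  pose N (A : term n) (phi : term n -> R) :=
    foldM (fun T A phi => rareM a (fun b => phi (if b then T else A))) s A phi.
  apply: (reach_bind _ _ (eq A) _ (pick1 A T') N).
  - by rewrite mulr_ge0 // exprn_ge0 //; lra.
  - exact: (pick_step A T').1.
  - by move=> A' _; exact: ih.
  - by move=> v; exact: hfold.
rewrite orbF => /eqP <- /=.
have h0 (s' : seq (term n)) A' : reach ((1 - q) ^+ size s') (eq A')
    (foldM (fun T A (phi : term n -> R) => rareM a (fun b => phi (if b then T else A))) s' A').
  elim: s' => [|T'' s' ih']; first by rewrite expr0; exact: reach_ret.
  rewrite /= exprS; pose N (A : term n) (phi : term n -> R) :=
    foldM (fun T A phi => rareM a (fun b => phi (if b then T else A))) s' A phi.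
  apply: (reach_bind _ _ (eq A') _ (fun phi => rareM a (fun b => phi (if b then T'' else A'))) N).
  - by apply: exprn_ge0; lra.
  - exact: (pick_step A' T'').1.
  - by move=> _ <-.
  - by move=> v; exact: hfold.
pose N (A : term n) (phi : term n -> R) :=
    foldM (fun T A phi => rareM a (fun b => phi (if b then T else A))) s A phi.
apply: (@reach_le _ _ (q * (1 - q) ^+ size s)).
  rewrite ler_wpM2l // exprS ler_piMl //; last lra.
  by apply: exprn_ge0; lra.
apply: (reach_bind _ _ (eq T) _ (pick1 A T) N).
- by apply: exprn_ge0; lra.
- exact: (pick_step A T).2.
- by move=> _ <-; exact: h0.
- by move=> v; exact: hfold.
Qed.

Lemma expectation_noise j A y : (1 <= j)%N -> expectation (noiseM (R := R) j A y).
Proof.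
move=> hj; apply: (expectation_sum _ id) => [z|].
  by apply: prodr_ge0 => i _; exact: flip_weight_ge0.
rewrite (sum_prod_cube (flip_weight j A y)) big1 // => i _.
by rewrite big_bool /flip_weight; case: masked; case: (tnth y i) => /=; ring.
Qed.

Lemma reach_flips y (Z : {set 'I_n}) e : (n <= 2 ^ a)%N -> (#|Z| <= e)%N ->
  reach (q ^+ e / 4) (eq (flips y Z)) (noiseM (R := R) a set0 y).
Proof.
move=> hn he phi u phi0 u0 hu; have q1 := rate_le; have q0 := rate_ge0.
rewrite /noiseM (bigD1 (flips y Z)) //=.
set W := \prod_i _.
have hW : q ^+ e / 4 <= W.
  apply: (@le_trans _ _ (q ^+ #|Z| * (1 - q) ^+ n)).
    apply: ler_pM; first by apply: exprn_ge0; lra.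
    - lra.
    - by apply: ler_wiXn2l => //; lra.
    - by rewrite -[4^-1]expr1; apply: pow_compl_ge; rewrite ?mul1n.
  rewrite -prodr_const -[X in _ ^+ X](card_ord n) -prodr_const /W.
  rewrite [X in X * _]big_mkcond /= -big_split /=; apply: ler_prod => i _.
  rewrite /flip_weight /masked !inE /= tnth_flips -/q.
  by apply/andP; split; case: (i \in Z); case: (tnth y i) => /=; nra.
rewrite -[X in X <= _]addr0; apply: lerD.
  by apply: ler_pM => //; [apply: mulr_ge0; [apply: exprn_ge0|]; lra|exact: hu].
apply: sumr_ge0 => z _; apply: mulr_ge0 => //.
by apply: prodr_ge0 => i _; exact: flip_weight_ge0.
Qed.

Lemma expectation_edit T : expectation (editM (R := R) a T).
Proof.
rewrite /editM.
apply: (expectation_bind _ (fun bs phi => phi (term_of bs))) => [|bs]; last first.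
  exact: expectation_ret.
apply: expectation_map => i.
have hbit c : expectation (bitM (R := R) a c).
  apply: (expectation_bind _ (fun b phi => phi (b (+) c))).
    exact: expectation_rare.
  by move=> b; exact: expectation_ret.
apply: (expectation_bind _ (fun b phi => bitM a ((i, false) \in T) (fun c => phi (b, c)))) => // b.
by apply: (expectation_bind _ (fun c phi => phi (b, c))) => // c; exact: expectation_ret.
Qed.

(** All [2 * n] flags must come out right: at most [e] change, each at rate [q], and the rest stay
    put with probability at least 1/4 altogether. *)
Lemma reach_edit T T' e : (2 * n <= 2 ^ a)%N ->
  (#|T :\: T'| + #|T' :\: T| <= e)%N ->
  reach (q ^+ e / 4) (eq T') (editM (R := R) a T).
Proof.
move=> hn he; have q1 := rate_le; have q0 := rate_ge0.
pose d i b : bool := ((i, b) \in T) (+) ((i, b) \in T').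
pose p i b : R := if d i b then q else 1 - q.
have p0 i b : 0 <= p i b by rewrite /p; case: ifP; lra.
have hbit c c' : reach (if c (+) c' then q else 1 - q) (eq c') (bitM (R := R) a c).
  move=> phi u phi0 u0 hu; apply: (reach_rare (c (+) c')) => // b <-.
  by apply: hu; case: c; case: c'.
have hexp c : expectation (bitM (R := R) a c).
  apply: (expectation_bind _ (fun b phi => phi (b (+) c))).
    exact: expectation_rare.
  by move=> b; exact: expectation_ret.
have h := reach_map (fun i (phi : bool * bool -> R) => bitM a ((i, true) \in T) (fun b =>
                     bitM a ((i, false) \in T) (fun c => phi (b, c))))
  (fun i => ((i, true) \in T', (i, false) \in T')) (fun i => p i true * p i false) (enum 'I_n).
apply: (@reach_le _ _ (\prod_(i <- enum 'I_n) (p i true * p i false))).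
  rewrite big_enum /=.
  have hD : (\sum_(i : 'I_n) (d i true + d i false) = #|T :\: T'| + #|T' :\: T|)%N.
    rewrite !card_term -big_split /=; apply: eq_bigr => i _; rewrite /d !inE.
    by do 4 case: (_ \in _).
  apply: (@le_trans _ _ (q ^+ (\sum_(i : 'I_n) (d i true + d i false))%N * (1 - q) ^+ (2 * n))).
    apply: ler_pM; first by apply: exprn_ge0; lra.
    - lra.
    - by apply: ler_wiXn2l; [lra|lra|rewrite hD].
    - by rewrite -[4^-1]expr1; apply: pow_compl_ge; rewrite ?mul1n.
  rewrite prod_nat_pow exprM -[X in _ ^+ X](card_ord n) -prodr_const -big_split /=.
  apply: ler_prod => i _; rewrite /p; apply/andP; split.
    by rewrite mulr_ge0 // exprn_ge0 //; nra.
  rewrite exprD expr2; case: (d i true); case: (d i false); rewrite ?expr0 ?expr1 /=; nra.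
move=> phi u phi0 u0 hu; rewrite /editM; apply: h => //.
- by move=> i; rewrite mulr_ge0.
- move=> i.
  apply: (expectation_bind _ (fun b phi => bitM a ((i, false) \in T) (fun c => phi (b, c)))) => // b.
  by apply: (expectation_bind _ (fun c phi => phi (b, c))) => // c; exact: expectation_ret.
- move=> i; apply: (reach_bind _ _ (eq ((i, true) \in T')) _ _
    (fun b phi => bitM a ((i, false) \in T) (fun c => phi (b, c)))) => //.
  + exact: hbit.
  + by move=> b <- psi u' psi0 u'0 hu'; apply: hbit => // c <-; apply: hu'.
  + by move=> b; apply: (expectation_bind _ (fun c phi => phi (b, c))) => // c; exact: expectation_ret.
move=> bs <-; apply: hu; apply/setP => [[i b]]; rewrite inE /=.
rewrite (nth_map i) ?size_enum_ord // nth_ord_enum.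
by case: b.
Qed.

End Primitives.


(** * One phase: halving the distance to a term not yet found *)

Section Phase.
Context {R : realType} {n : nat}.
Variables (Fc : {set term n}) (k : nat).
Hypothesis Fk : forall T, T \in Fc -> #|T| = k.
Hypothesis Fsat : forall T, T \in Fc -> satisfiable T.
Variable f : cube n -> bool.
Hypothesis fE : forall x, f x = [exists T in Fc, term_eval T x].
Variable tau : nat.
Hypothesis Ftau : (#|Fc| < 2 ^ tau)%N.
Variables (B a : nat) (L : dnf n).
Hypothesis a1 : (1 <= a)%N.
Hypothesis na : (2 * n <= 2 ^ a)%N.
Hypothesis La : (size (take B L) <= 2 ^ a)%N.

Definition found : {set term n} := [set T in Fc | T \in take B L].

(** Chosen so that [scale * 2 ^ j = 8 * w j], with [w j] the exposure at which the noise of phase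
    [j] kills a term. *)
Definition scale : nat := (16 * (13 * tau + 3))%N.

(* The invariant of phase [j]: the current term is a large part of an unknown
   term [T0], or a term found earlier is close to [T0]. *)
Definition near_miss (j : nat) (v : cube n * term n) : Prop :=
  exists T0, [/\ T0 \in Fc, T0 \notin found, term_eval T0 v.1 &
    (v.2 \subset T0 /\ (#|T0 :\: v.2| <= 36 * (scale * 2 ^ j))%N) \/
    (exists2 T', T' \in found & (2 * #|T' :\: T0| < scale * 2 ^ j)%N)].

Lemma satisfiable_sub (T T' : term n) : T \subset T' -> satisfiable T' -> satisfiable T.
Proof.
move=> /subsetP h /forallP h'; apply/forallP => i; have := h' i.
by apply: contra => /andP[/h -> /h ->].
Qed.

Lemma masked_setD (T A : term n) i : masked T i -> ~~ masked A i -> masked (T :\: A) i.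
Proof.
rewrite /masked !inE negb_or => /orP[] h /andP[/negbTE -> /negbTE ->];
by rewrite h ?orbT.
Qed.

Lemma masked_sub (T T' : term n) i : T \subset T' -> masked T i -> masked T' i.
Proof. by move=> /subsetP h /orP[] /h h'; rewrite /masked h' ?orbT. Qed.

Lemma card_unmasked (T0 A : term n) : satisfiable T0 ->
  (#|[set i | masked T0 i && ~~ masked A i]| <= #|T0 :\: A|)%N.
Proof.
move=> h; rewrite -card_vars; last by apply: satisfiable_sub h; exact: subsetDl.
apply/subset_leq_card/subsetP => i; rewrite !inE => /andP[h1 h2].
exact: masked_setD.
Qed.

(** Exposure [2 ^ j.+1] halves the generating function once. The [13 * tau + 3] halvings pay for
    [tau] in the union bound, [12 * tau + 2] false literals per killed term, and one factor 1/2. Of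
    these false literals, the deliberate flips that follow can repair at most [11 * tau], and more
    than [tau] must remain for the chain. *)
Let w (j : nat) : nat := ((13 * tau + 3) * 2 ^ j.+1)%N.

Definition killed (j : nat) (A T0 : term n) : {set term n} :=
  [set T in Fc | (w j <= #|exposed A T0 T|)%N].

Lemma wE j : (8 * w j = scale * 2 ^ j)%N.
Proof. rewrite /w /scale expnS; lia. Qed.

Lemma tau_le_w j : (tau <= w j)%N.
Proof.
rewrite /w; apply: (@leq_trans (13 * tau + 3)); first by clear; lia.
by rewrite leq_pmulr // expn_gt0.
Qed.

Lemma noise_phase j (A : term n) (y : cube n) (T0 : term n) : (1 <= j)%N -> T0 \in Fc -> term_eval T0 y ->
  (#|T0 :\: A| <= 36 * (scale * 2 ^ j))%N ->
  reach (4^-1 ^+ (36 * scale) / 2 : R)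
    (fun z => term_eval T0 z /\
       forall T, T \in killed j A T0 -> (12 * tau + 2 <= fals z T)%N)
    (noiseM j A y).
Proof.
move=> hj T0F hy hA; apply: (@reach_le _ _
  ((1 - 2^-1 ^+ j) ^+ #|[set i | masked T0 i && ~~ masked A i]| / 2)).
  rewrite ler_pM2r ?invr_gt0 ?ltr0n //; apply: pow_compl_ge => //.
  apply: leq_trans (card_unmasked _ _ (Fsat _ T0F)) _.
  by rewrite -mulnA.
apply: (noise_reach _ _ _ _ _ (w j)) => //.
  by move=> T; rewrite inE => /andP[].
have h1 : (1 - 2^-1 ^+ j / 2) ^+ w j <= 2^-1 ^+ (13 * tau + 3) :> R.
  have -> : 1 - 2^-1 ^+ j / 2 = 1 - 2^-1 ^+ j.+1 :> R by rewrite exprSr.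
  rewrite /w mulnC exprM; apply: lerXn2r; rewrite ?nnegrE; last exact: pow2_compl_le.
    have h : 2^-1 ^+ j.+1 <= 2^-1 :> R by apply: half_pow.
    by apply: exprn_ge0; lra.
  by lra.
have h2 : #|killed j A T0|%:R <= 2 ^+ tau :> R.
  rewrite -natrX ler_nat; apply: leq_trans (ltnW Ftau).
  by apply/subset_leq_card/subsetP => T; rewrite inE => /andP[].
apply: (@le_trans _ _ (2 ^+ tau * (2 ^+ (12 * tau + 2) * 2^-1 ^+ (13 * tau + 3)))).
  apply: ler_pM => //.
    apply: mulr_ge0; apply: exprn_ge0; first lra.
    have h : 2^-1 ^+ j <= 2^-1 :> R by apply: half_pow.
    lra.
  by rewrite ler_wpM2l // exprn_ge0.
have -> : (13 * tau + 3 = tau + (12 * tau + 2) + 1)%N by clear; lia.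
rewrite !exprD expr1 exprVn exprVn.
have p0 m : (2 : R) ^+ m != 0 by rewrite expf_eq0 pnatr_eq0 andbF.
rewrite le_eqVlt; apply/orP; left; apply/eqP; field.
by rewrite !p0.
Qed.

Lemma near_missS j (T1 : term n) (z : cube n) : (1 <= j)%N -> T1 \in Fc -> T1 \notin found ->
  term_eval T1 z -> sens f z \subset T1 ->
  (#|T1 :\: sens f z| <= 18 * (scale * 2 ^ j))%N ->
  near_miss j.-1 (z, sens f z).
Proof.
case: j => // j _ h1 h2 h3 h4 h5; exists T1; split => //; left; split => //=.
by apply: leq_trans h5 _; rewrite expnS; clear; lia.
Qed.

(** Since [A] is part of [T0], every literal outside [T0] is exposed. Surviving terms are thus
    within [w j] of [T0], while found ones are at least [4 * w j] away, so the term produced by the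
    chain is new. *)
Lemma phase_far j (A : term n) (y : cube n) (T0 : term n) : (1 <= j)%N -> T0 \in Fc -> T0 \notin found ->
  term_eval T0 y -> A \subset T0 -> (#|T0 :\: A| <= 36 * (scale * 2 ^ j))%N ->
  (forall T, T \in found -> scale * 2 ^ j <= 2 * #|T :\: T0|)%N ->
  reach (4^-1 ^+ (36 * scale) / 2 : R)
    (fun y1 => exists Z : {set 'I_n}, (#|Z| <= 12 * tau)%N /\
        near_miss j.-1 (flips y1 Z, sens f (flips y1 Z)))
    (noiseM j A y).
Proof.
move=> hj T0F T0G hy hA hAc hG; apply: reach_sub (noise_phase _ _ _ _ hj T0F hy hAc).
move=> y1 [hT0 hkill].
have hexp T : T \in Fc -> #|exposed A T0 T| = #|T :\: T0|.
  move=> TF; rewrite -[RHS]card_vars; last first.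
    by apply: satisfiable_sub (Fsat _ TF); exact: subsetDl.
  apply: eq_card => i; rewrite !inE; case hm : (masked A i); last by rewrite andbT.
  by rewrite (masked_sub _ _ _ hA hm) andbT.
pose J := Fc :\: killed j A T0.
have hJ T : T \in J -> (#|T :\: T0| < w j)%N.
  rewrite !inE negb_and -ltnNge => /andP[/orP[/negP //|h] TF]; by rewrite -hexp.
have JF : J \subset Fc by exact: subsetDl.
have Jn T : T \in J -> (#|T0 :\: T| <= w j)%N.
  move=> TJ; have TF := subsetP JF _ TJ.
  by rewrite (cardD_sym Fc k Fk T0 T) //; exact: ltnW (hJ _ TJ).
have Jf T : T \in Fc -> T \notin J -> (tau < fals y1 T)%N.
  by move=> TF; rewrite in_setD TF andbT negbK => /hkill; clear; lia.
have [Z [T1 [hZ hZt T1J] [hT1 hs hc]]] :=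
  sensitive_term Fc k Fk Fsat f fE tau Ftau T0 y1 J (w j) T0F hT0 JF Jn Jf.
exists Z; split; first by apply: leq_trans hZt _; rewrite leq_pmull.
apply: (near_missS _ T1) => //; first exact: (subsetP JF).
  by apply/negP => /hG; rewrite -wE; have := hJ _ T1J; clear; lia.
by apply: leq_trans hc _; rewrite -wE; have := tau_le_w j; clear; lia.
Qed.

(** With 11 steps per unit of [tau], [hitting_assignment] exhausts fewer than [2 ^ tau] terms; 11 is
    the least exponent that works. *)
Lemma pow_15_16 : (2 * 15 ^ 11 <= 16 ^ 11)%N.
Proof. lia. Qed.

Lemma leq_exp_base m m' e : (m <= m')%N -> (m ^ e <= m' ^ e)%N.
Proof. by move=> h; elim: e => // e ih; rewrite !expnS leq_mul. Qed.

(** The nearest found term [T'] contains all but [r] literals of [T0], with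
    [2 * w j <= r < 4 * w j], so protecting it protects most of [T0]. The price is that literals on
    [V], the variables of [T'] outside [T0], escape the noise and found terms may survive there.
    Every surviving found term has many variables in [V], because none is closer to [T0] than [T'],
    and a few deliberate flips inside [V] falsify them all. *)
Lemma phase_near j (y : cube n) (T0 T' : term n) : (1 <= j)%N -> T0 \in Fc -> T0 \notin found ->
  term_eval T0 y -> T' \in found ->
  (forall T, T \in found -> #|T' :\: T0| <= #|T :\: T0|)%N ->
  (scale * 2 ^ j <= 4 * #|T' :\: T0|)%N -> (2 * #|T' :\: T0| < scale * 2 ^ j)%N ->
  reach (4^-1 ^+ (36 * scale) / 2 : R)
    (fun y1 => exists Z : {set 'I_n}, (#|Z| <= 12 * tau)%N /\
        near_miss j.-1 (flips y1 Z, sens f (flips y1 Z)))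
    (noiseM j T' y).
Proof.
move=> hj T0F T0G hy T'G hmin hlo hhi.
have T'F : T' \in Fc by move: T'G; rewrite inE => /andP[].
set r := #|T' :\: T0|.
have hTc : #|T0 :\: T'| = r by rewrite (cardD_sym Fc k Fk).
apply: reach_sub (noise_phase _ _ _ _ hj T0F hy _); last by rewrite hTc /r; clear -hhi; lia.
move=> y1 [hT0 hkill].
pose V := vars T' :\: vars T0.
have Vr : (#|V| <= r)%N.
  rewrite /r -card_vars; last by apply: satisfiable_sub (Fsat _ T'F); exact: subsetDl.
  apply/subset_leq_card/subsetP => i; rewrite !inE => /andP[h1 h2].
  exact: masked_setD.
pose J := Fc :\: killed j T' T0.
have JF : J \subset Fc by exact: subsetDl.
have hJe T : T \in J -> (#|exposed T' T0 T| < w j)%N.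
  by rewrite !inE negb_and -ltnNge => /andP[/orP[/negP //|h] TF].
have hcov T : T \in Fc -> (#|T :\: T0| <= #|exposed T' T0 T| + #|vars T :&: V|)%N.
  move=> TF; rewrite -card_vars; last first.
    by apply: satisfiable_sub (Fsat _ TF); exact: subsetDl.
  rewrite -(cardsID (exposed T' T0 T) (vars (T :\: T0))) leq_add //.
    by apply/subset_leq_card/subsetIr.
  apply/subset_leq_card/subsetP => i; rewrite !inE => /andP[h1 h2].
  move: h1; rewrite h2 /= negb_or negbK => /andP[-> ->].
  by rewrite (masked_sub _ _ _ (subsetDl _ _) h2).
have hJn T : T \in J -> (#|T0 :\: T| <= w j + r)%N.
  move=> TJ; have TF := subsetP JF _ TJ.
  rewrite (cardD_sym Fc k Fk) //; apply: leq_trans (hcov _ TF) _.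
  apply: leq_add; first exact: ltnW (hJe _ TJ).
  by apply: leq_trans Vr; apply/subset_leq_card/subsetIr.
have hw := wE j.
(* A found term in [J] has at least [r] literals outside [T0] and fewer than [w j <= r / 2] exposed
   variables, so more than [r / 2] of its variables lie in [V], twice what is asked. *)
have [|T| |U [u [hUV _ hUm] hu]] := hitting_assignment V r (11 * tau) set0 (found :&: J) Vr.
- rewrite cards0 add0n; have : (2 <= 2 ^ j)%N by rewrite -[X in (X <= _)%N]expn1 leq_exp2l.
  by move: hlo; rewrite -/r /scale; set p := (2 ^ j)%N; clear; nia.
- rewrite inE => /andP[TG TJ]; have := hmin _ TG; have := hcov _ (subsetP JF _ TJ).
  by have := hJe _ TJ; rewrite -/r; move: hlo hw; rewrite -/r; clear; lia.
- apply: (@leq_ltn_trans (#|Fc| * 15 ^ (11 * tau))).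
    rewrite leq_mul2r; apply/orP; right; apply: leq_trans (subset_leq_card JF).
    exact/subset_leq_card/subsetIr.
  apply: (@leq_trans (2 ^ tau * 15 ^ (11 * tau))).
    by rewrite ltn_mul2r expn_gt0 Ftau.
  have -> : (16 ^ (11 * tau) = (16 ^ 11) ^ tau)%N by rewrite -expnM.
  have -> : (15 ^ (11 * tau) = (15 ^ 11) ^ tau)%N by rewrite -expnM.
  by rewrite -expnMn; apply: leq_exp_base; exact: pow_15_16.
have {}hu T : T \in found -> T \in J -> exists2 i, i \in U & (i, ~~ tnth u i) \in T.
  by move=> h1 h2; apply: hu; rewrite inE h1.
(* These flips bring the bits of [U] to the values of [u]. They avoid the variables of [T0], so [T0]
   stays true, and the chain, which flips only variables of [T0], cannot undo them. *)
pose Z0 := [set i in U | tnth y1 i != tnth u i].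
have Z0V : Z0 \subset V.
  by apply/subsetP => i; rewrite inE => /andP[/(subsetP hUV)].
have Z0m : (#|Z0| <= 11 * tau)%N.
  by apply: leq_trans hUm; apply/subset_leq_card/subsetP => i; rewrite inE => /andP[].
pose y2 := flips y1 Z0.
have hy2 : term_eval T0 y2.
  apply/term_evalP => l hl; rewrite tnth_flips.
  have -> : (l.1 \in Z0) = false.
    apply/negbTE/negP => /(subsetP Z0V); rewrite inE => /andP[/negP h _].
    by apply: h; exact: in_vars.
  exact: (elimT (term_evalP _ _) hT0).
have Jf T : T \in Fc -> T \notin J -> (tau < fals y2 T)%N.
  move=> TF; rewrite in_setD TF andbT negbK => /hkill.
  by have := fals_flips T y1 Z0; rewrite -/y2; move: Z0m; clear; lia.
have [Z [T1 [hZ hZt T1J] [hT1 hs hc]]] :=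
  sensitive_term Fc k Fk Fsat f fE tau Ftau T0 y2 J (w j + r) T0F hy2 JF hJn Jf.
have hdis : [disjoint Z0 & Z].
  rewrite disjoints_subset; apply/subsetP => i /(subsetP Z0V); rewrite !inE => /andP[h _].
  by apply: contra h => /(subsetP hZ); rewrite inE.
have e : flips y2 Z = flips y1 (Z0 :|: Z) by rewrite flipsU.
exists (Z0 :|: Z); rewrite -e; split.
  by apply: leq_trans (leq_card_setU _ _) _; move: Z0m hZt; clear; lia.
apply: (near_missS _ T1) => //; first exact: (subsetP JF).
  apply/negP => T1G; have [i iU hi] := hu _ T1G T1J.
  have := elimT (term_evalP _ _) hT1 _ hi; rewrite /= !tnth_flips.
  have iV : i \in V by exact: (subsetP hUV).
  have -> : (i \in Z) = false.
    apply/negbTE/negP => /(subsetP hZ) h; move: iV; rewrite inE => /andP[/negP hn _].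
    exact: hn.
  rewrite inE iU /=; by case: (tnth y1 i); case: (tnth u i).
by move: hhi hc; rewrite -/r -hw; have := tau_le_w j; clear; lia.
Qed.

(** Exponent of the success probability: [72 * scale] for the survival of [T0], [12 * tau * a] for
    guessing the flips, [a] for guessing the protected term, and 6 for the constant factors
    including the coin. *)
Definition phase_exp : nat := (12 * tau * a + 72 * scale + a + 6)%N.

Lemma expectation_tail (y : cube n) : expectation
  (fun phi => noiseM (R := R) a set0 y (fun y2 : cube n => phi (y2, sens f y2))).
Proof.
apply: (expectation_bind _ (fun y2 phi => phi (y2, sens f y2))).
  exact: expectation_noise.
by move=> y2; exact: expectation_ret.
Qed.

Lemma expectation_base j (y : cube n) (A : term n) : (1 <= j)%N -> expectation
  (fun phi => noiseM (R := R) j A y (fun y1 =>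
     noiseM a set0 y1 (fun y2 : cube n => phi (y2, sens f y2)))).
Proof.
move=> hj; apply: (expectation_bind _ (fun y1 phi =>
     noiseM a set0 y1 (fun y2 : cube n => phi (y2, sens f y2)))).
  exact: expectation_noise.
exact: expectation_tail.
Qed.

Lemma expectation_phase j v : (1 <= j)%N ->
  expectation (phaseM (R := R) f B a j L v).
Proof.
move=> hj; have h : expectation (fun phi => 2^-1 * phi v + (1 - 2^-1) *
   pickM B a v.2 L (fun A => noiseM j A v.1 (fun y1 => noiseM a set0 y1 (fun y2 =>
       phi (y2, sens f y2)))) : R).
  apply: expectation_mix; [by apply/andP; split; lra|exact: expectation_ret|].
  apply: (expectation_bind _ (fun A phi => noiseM j A v.1 (fun y1 => noiseM a set0 y1 (fun y2 =>
       phi (y2, sens f y2))))).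
    exact: expectation_pick.
  by move=> A; exact: expectation_base.
suff -> : phaseM (R := R) f B a j L v = fun phi => 2^-1 * phi v + (1 - 2^-1) *
   pickM B a v.2 L (fun A => noiseM j A v.1 (fun y1 => noiseM a set0 y1 (fun y2 =>
       phi (y2, sens f y2)))) by [].
by apply/funext => phi; rewrite /phaseM; lra.
Qed.

Lemma reach_tail j (y : cube n) (A : term n) : (1 <= j)%N ->
  reach (4^-1 ^+ (36 * scale) / 2 : R)
    (fun y1 => exists Z : {set 'I_n}, (#|Z| <= 12 * tau)%N /\ near_miss j.-1 (flips y1 Z, sens f (flips y1 Z)))
    (noiseM j A y) ->
  reach (4^-1 ^+ (36 * scale) / 2 * ((2^-1 ^+ a) ^+ (12 * tau) / 4) : R)
    (near_miss j.-1)
    (fun phi => noiseM j A y (fun y1 =>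
     noiseM a set0 y1 (fun y2 : cube n => phi (y2, sens f y2)))).
Proof.
move=> hj h.
have q0 : 0 <= 2^-1 ^+ a :> R by apply: exprn_ge0; lra.
apply: (reach_bind _ _ _ _ _ (fun y1 phi =>
     noiseM a set0 y1 (fun y2 : cube n => phi (y2, sens f y2))) _ h).
- by rewrite divr_ge0 // exprn_ge0.
- move=> y1 [Z [hZ hnm]] phi u phi0 u0 hu.
  have hn : (n <= 2 ^ a)%N by apply: leq_trans na; rewrite leq_pmull.
  by apply: (reach_flips a a1 y1 Z _ hn hZ) => // _ <-; apply: hu.
- exact: expectation_tail.
Qed.

(** Three cases by the distance from [T0] to the found terms. If one is within a quarter of
    [scale * 2 ^ j], the invariant already holds for [j - 1] and the phase is skipped, which is what
    its coin is for. If one is within half, the nearest is protected; otherwise the current term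
    is. *)
Lemma phase_reach j v : (1 <= j)%N -> near_miss j v ->
  reach (2^-1 ^+ phase_exp : R) (near_miss j.-1) (phaseM f B a j L v).
Proof.
case: v => y A hj [T0 [T0F T0G /= hy hcase]] phi u phi0 u0 hu.
have q0 : 0 <= 2^-1 ^+ a :> R by apply: exprn_ge0; lra.
have q1 : 2^-1 ^+ a <= 1 :> R by apply: exprn_ile1; lra.
set c0 : R := 4^-1 ^+ (36 * scale) / 2 * ((2^-1 ^+ a) ^+ (12 * tau) / 4).
have c00 : 0 <= c0 by rewrite mulr_ge0 // divr_ge0 // exprn_ge0 //; lra.
have hexp : 2^-1 ^+ phase_exp = c0 * (2^-1 ^+ a / 4) / 2 :> R.
  have -> : phase_exp = (36 * scale * 2 + 1 + (a * (12 * tau) + 2) + (a + 2) + 1)%N.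
    by rewrite /phase_exp; clear; lia.
  have e4 : 2^-1 ^+ 2 = 4^-1 :> R by rewrite expr2; field.
  have e72 : 2^-1 ^+ (36 * scale * 2) = 4^-1 ^+ (36 * scale) :> R.
    by rewrite mulnC exprM e4.
  rewrite !exprD /c0 -[(2^-1 ^+ a) ^+ _]exprM e72 e4 expr1.
  set x1 := 4^-1 ^+ _; set x2 := 2^-1 ^+ (a * _); set x3 := 2^-1 ^+ a.
  by ring.
have E1 (A' : term n) := expectation_base j y A' hj.
have posM (A' : term n) : 0 <= noiseM j A' y (fun y1 =>
     noiseM a set0 y1 (fun y2 : cube n => phi (y2, sens f y2))).
  by apply: (expectation_ge0 _ _ (E1 A')).
rewrite /phaseM /= hexp mulrAC ler_pM2r ?invr_gt0 ?ltr0n //.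
set X := pickM _ _ _ _ _.
have X0 : 0 <= X by apply: expectation_ge0 (expectation_pick _ _ _ _) _.
have hpick (A' : term n) : A' = A \/ A' \in found ->
    reach c0 (near_miss j.-1) (fun phi => noiseM j A' y (fun y1 =>
     noiseM a set0 y1 (fun y2 : cube n => phi (y2, sens f y2)))) ->
    c0 * (2^-1 ^+ a / 4) * u <= X.
  move=> hA' hr.
  have hr' : reach (2^-1 ^+ a / 4 : R) (eq A') (pickM B a A L).
    case: hA' => [->|]; last by rewrite inE => /andP[_]; exact: reach_pick.
    by apply: (@reach_le _ _ 4^-1); [lra|exact: reach_pick0].
  rewrite mulrAC mulrC; apply: hr' => //; first exact: mulr_ge0.
  by move=> _ <-; apply: hr.
have bound1 : c0 * (2^-1 ^+ a / 4) * u <= u.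
  have : c0 <= 1.
    rewrite /c0; apply: mulr_ile1; rewrite ?divr_ge0 ?exprn_ge0 //; try lra.
      have : 4^-1 ^+ (36 * scale) <= 1 :> R by apply: exprn_ile1; lra.
      lra.
    have : (2^-1 ^+ a) ^+ (12 * tau) <= 1 :> R by apply: exprn_ile1.
    lra.
  move=> c01; rewrite -[X in _ <= X]mul1r ler_wpM2r //.
  by apply: mulr_ile1 => //; lra.
case: (pselect (exists2 T', T' \in found & (4 * #|T' :\: T0| < scale * 2 ^ j)%N)).
  move=> [T' T'G hT'].
  have : u <= phi (y, A).
    apply: hu; exists T0; split => //; right; exists T' => //.
    have e : (scale * 2 ^ j = 2 * (scale * 2 ^ j.-1))%N.
      by rewrite -[in LHS](prednK hj) expnS mulnCA.
    by move: hT'; rewrite e; clear; lia.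
  lra.
move=> hno4.
have hlo T : T \in found -> (scale * 2 ^ j <= 4 * #|T :\: T0|)%N.
  by move=> TG; rewrite leqNgt; apply/negP => h; apply: hno4; exists T.
suff : c0 * (2^-1 ^+ a / 4) * u <= X by have := phi0 (y, A); lra.
case: (pselect (exists2 T', T' \in found & (2 * #|T' :\: T0| < scale * 2 ^ j)%N)).
  move=> [T2 T2G hT2].
  case: (arg_minnP (fun T : term n => #|T :\: T0|) T2G) => T' T'G hmin.
  apply: (hpick T'); first by right.
  apply: reach_tail => //; apply: (phase_near _ _ T0) => //; first exact: hlo.
  by have := hmin _ T2G; move: hT2; clear; lia.
move=> hno2; apply: (hpick A); first by left.
apply: reach_tail => //.
case: hcase => [[hA hAc]|]; last by move=> h; case: hno2.
apply: (phase_far _ _ _ T0) => // T TG.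
by rewrite leqNgt; apply/negP => h; apply: hno2; exists T.
Qed.

Definition attempt_exp : nat := (a * phase_exp + 36 * scale * a + a + 4)%N.

Lemma expectation_phases j v : expectation (phasesM (R := R) f B a j L v).
Proof.
elim: j v => [|j ih] v; first exact: expectation_ret.
by apply: (expectation_bind _ (phasesM f B a j L)); first exact: expectation_phase.
Qed.

Lemma reach_phases j v : near_miss j v ->
  reach ((2^-1 ^+ phase_exp) ^+ j : R) (near_miss 0) (phasesM f B a j L v).
Proof.
elim: j v => [|j ih] v hv; first by rewrite expr0; exact: reach_ret.
rewrite exprS /=; apply: (reach_bind _ _ (near_miss j) _ _ (phasesM f B a j L)).
- by rewrite !exprn_ge0 //; lra.
- exact: (phase_reach j.+1).
- exact: ih.
- exact: expectation_phases.
Qed.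

Lemma expectation_attempt x : expectation (attemptM (R := R) f B a x L).
Proof.
apply: (expectation_bind _ (fun v phi => pickM B a v.2 L (fun A => editM a A phi))).
  exact: expectation_phases.
move=> v; apply: (expectation_bind _ (fun A phi => editM a A phi)).
  exact: expectation_pick.
by move=> A; exact: expectation_edit.
Qed.

(** The empty term satisfies the invariant of phase [a] because [T0] has at most [2 * n <= 2 ^ a]
    literals. After phase 1, the current term or a found one differs from a missing term in at most
    [36 * scale] literals, few enough to guess the edit. *)
Lemma attempt_reach x (T0 : term n) : T0 \in Fc -> T0 \notin found -> term_eval T0 x ->
  reach (2^-1 ^+ attempt_exp : R) (fun T => T \in Fc :\: found)
    (attemptM f B a x L).
Proof.
move=> T0F T0G hx.
have q0 : 0 <= 2^-1 ^+ a :> R by apply: exprn_ge0; lra.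
have start : near_miss a (x, set0).
  exists T0; split => //; left; rewrite sub0set setD0; split => //.
  apply: leq_trans (card_term_leq T0) _; apply: leq_trans na _.
  by rewrite mulnA leq_pmull // /scale; clear; lia.
apply: (@reach_le _ _ ((2^-1 ^+ phase_exp) ^+ a *
    (2^-1 ^+ a / 4 * ((2^-1 ^+ a) ^+ (36 * scale) / 4)))).
  rewrite le_eqVlt; apply/orP; left; apply/eqP; rewrite -!exprM.
  have -> : attempt_exp = (phase_exp * a + (a + (a * (36 * scale) + 4)))%N.
    by rewrite /attempt_exp; clear; lia.
  rewrite !exprD; have -> : 2^-1 ^+ 4 = 4^-1 * 4^-1 :> R by rewrite !exprS expr0; field.
  ring.
apply: (reach_bind _ _ _ _ _ (fun v phi => pickM B a v.2 L (fun A => editM a A phi)) _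
   (reach_phases a _ start)).
- by rewrite mulr_ge0 // divr_ge0 // exprn_ge0.
- move=> [y A] [T1 [T1F T1G /= _ hc]].
  have [A' [hA' hd]] : exists A', (A' = A \/ A' \in found) /\
      (#|A' :\: T1| + #|T1 :\: A'| <= 36 * scale)%N.
    case: hc => [[hs hc]|[T' T'G hT']].
      exists A; split; first by left.
      by rewrite (eqP (_ : A :\: T1 == set0)) ?setD_eq0 // cards0 add0n; move: hc; rewrite expn0 muln1.
    exists T'; split; first by right.
    have T'F : T' \in Fc by move: T'G; rewrite inE => /andP[].
    rewrite (cardD_sym Fc k Fk T1 T') //; move: hT'; rewrite expn0 muln1 => h.
    by rewrite addnn -mul2n (leq_trans (ltnW h)) // leq_pmull.
  apply: (reach_bind _ _ (eq A') _ _ (fun A phi => editM a A phi)).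
  + by rewrite divr_ge0 // exprn_ge0.
  + case: hA' => [->|]; last by rewrite inE => /andP[_]; exact: reach_pick.
    have q1 : 2^-1 ^+ a <= 1 :> R by apply: exprn_ile1; lra.
    by apply: (@reach_le _ _ 4^-1); [lra|exact: reach_pick0].
  + move=> _ <-; apply: reach_sub (reach_edit a a1 A' T1 _ na hd) => _ <-.
    by rewrite inE T1F T1G.
  + by move=> v; exact: expectation_edit.
- move=> v; apply: (expectation_bind _ (fun A phi => editM a A phi)).
    exact: expectation_pick.
  by move=> A; exact: expectation_edit.
Qed.

End Phase.


(** * Learning a list of terms *)

(** [reach] speaks of nonnegative functions; subtracting the lower bound [c] extends it to a base
    value with an extra gain on [S]. *)
Lemma reach_shift {R : realType} {V : Type} (p c e : R) (S : V -> Prop)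
    (M : (V -> R) -> R) (phi : V -> R) :
  expectation M -> reach p S M -> 0 <= e ->
  (forall v, c <= phi v) -> (forall v, S v -> c + e <= phi v) ->
  c + p * e <= M phi.
Proof.
move=> hM hr e0 h1 h2; rewrite addrC.
have h : M (fun v => phi v - c) + c <= M phi by apply: hM.1 => v; rewrite subrK.
apply: le_trans h; rewrite lerD2r; apply: hr => // [v|v hv]; first by rewrite subr_ge0.
by rewrite lerBrDl h2.
Qed.

Lemma expectation_const {R : realType} {V : Type} (c : R) (M : (V -> R) -> R) phi :
  expectation M -> (forall v, c <= phi v) -> c <= M phi.
Proof.
move=> hM h; rewrite -[c]add0r -hM.2; apply: hM.1 => v; by rewrite add0r.
Qed.

(** * Validation of candidates and coverage of the positive examples *)

Section Learn.
Context {R : realType} {n : nat}.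
Variables (Fc : {set term n}) (k : nat).
Hypothesis Fk : forall T, T \in Fc -> #|T| = k.
Hypothesis Fsat : forall T, T \in Fc -> satisfiable T.
Variable f : cube n -> bool.
Hypothesis fE : forall x, f x = [exists T in Fc, term_eval T x].
Variable tau : nat.
Hypothesis Ftau : (#|Fc| < 2 ^ tau)%N.
Variables (B a : nat).
Hypothesis a1 : (1 <= a)%N.
Hypothesis na : (2 * n <= 2 ^ a)%N.
Implicit Types (T : term n) (L : dnf n) (x y z : cube n).

(** Random completions cannot be relied on to reject these terms; their number bounds the length of
    every list. *)
Definition near_terms : {set term n} :=
  [set T : term n | (#|T| == k) && [exists T' in Fc, (#|T' :\: T| <= tau)%N]].

Hypothesis near_a : (#|near_terms| <= 2 ^ a)%N.
Hypothesis near_B : (#|near_terms| <= B)%N.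

Lemma noise_masked j T y (phi : cube n -> R) c : (1 <= j)%N ->
  (forall z, (forall i, masked T i -> tnth z i = tnth y i) -> phi z = c) ->
  noiseM j T y phi = c.
Proof.
move=> hj hc; rewrite /noiseM.
have W1 : \sum_(z : cube n) \prod_i flip_weight j T y i (tnth z i) = 1 :> R.
  rewrite (sum_prod_cube (flip_weight j T y)) big1 // => i _.
  by rewrite big_bool /flip_weight; case: masked; case: (tnth y i) => /=; ring.
rewrite -[RHS]mul1r -[X in _ = X * _]W1 mulr_suml; apply: eq_bigr => z _.
case: (boolP [forall i, masked T i ==> (tnth z i == tnth y i)]) => [/forallP h|].
  by rewrite hc // => i hi; apply/eqP; have := h i; rewrite hi.
rewrite negb_forall => /existsP[i]; rewrite negb_imply => /andP[h1 h2].
by rewrite (bigD1 i) //= /flip_weight h1 (negbTE h2) !mul0r.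
Qed.

Lemma valid_true T (phi : bool -> R) : T \in Fc -> validM f B T phi = phi true.
Proof.
move=> TF; rewrite /validM; elim: B => //= m ih.
apply: noise_masked => // z hz.
suff -> : f z by exact: ih.
apply: (f_sat Fc f fE T z TF); apply/term_evalP => [[i b]] hl /=.
rewrite hz; last by have := in_vars T _ hl; rewrite inE.
rewrite tnth_mktuple; case: b hl => [->//|hl].
have := satisfiable_lit T i false (Fsat _ TF) hl; rewrite /= => /negbTE ->.
by rewrite hl.
Qed.

(** Every term of [F] has more than [tau] literals outside [T]; each is a fair coin, or false if [T]
    fixes the opposite value. Summing [2^-(tau + 1)] over fewer than [2 ^ tau] terms leaves at most
    1/2. *)
Lemma completion_false T : #|T| = k -> T \notin near_terms ->
  reach (2^-1 : R) (fun z => ~~ f z) (noiseM 1 T (override T zeros)).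
Proof.
move=> Tk; rewrite inE Tk eqxx /= negb_exists_in => /forall_inP hfar phi u phi0 u0 hu.
set y := override T zeros.
pose W (z : cube n) : R := \prod_i flip_weight 1 T y i (tnth z i).
have W0 z : 0 <= W z by apply: prodr_ge0 => i _; exact: flip_weight_ge0.
have W1 : \sum_z W z = 1.
  rewrite (sum_prod_cube (flip_weight 1 T y)) big1 // => i _.
  by rewrite big_bool /flip_weight; case: masked; case: (tnth y i) => /=; ring.
have hT T' : T' \in Fc -> \sum_z W z * (term_eval T' z)%:R <= 2^-1 ^+ tau.+1.
  move=> T'F.
  have -> : \sum_z W z * (term_eval T' z)%:R
     = \sum_(z : cube n) \prod_i (flip_weight 1 T y i (tnth z i) * ((i, ~~ tnth z i) \notin T')%:R).
    apply: eq_bigr => z _; rewrite big_split /= -/(W z); congr (_ * _).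
    case hz : (term_eval T' z).
      rewrite big1 // => i _; case h : (_ \in _) => //=.
      by have := elimT (term_evalP _ _) hz _ h; rewrite /=; case: (tnth z i).
    move/negbT: hz; rewrite term_eval_fals /fals sum_nat_eq0 negb_forall => /existsP[i].
    by rewrite /= eqb0 negbK => hi; rewrite (bigD1 i) //= hi mul0r.
  rewrite (sum_prod_cube (fun i b => flip_weight 1 T y i b * ((i, ~~ b) \notin T')%:R)).
  apply: (@le_trans _ _ (\prod_i (if i \in vars (T' :\: T) then 2^-1 else 1))).
    apply: ler_prod => i _; apply/andP; split.
      by apply: sumr_ge0 => b _; rewrite mulr_ge0 ?flip_weight_ge0 ?ler0n.
    rewrite big_bool inE /flip_weight /y tnth_mktuple /masked !inE expr1 /=.
    case: ((i, true) \in T); case: ((i, false) \in T);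
      case: ((i, true) \in T'); case: ((i, false) \in T') => /=;
      rewrite ?tnth_mktuple /=; lra.
  rewrite -big_mkcond prodr_const; apply: ler_wiXn2l; [lra|lra|].
  rewrite card_vars; last by apply: satisfiable_sub (Fsat _ T'F); exact: subsetDl.
  by rewrite ltnNge hfar.
have hf : \sum_z W z * (f z)%:R <= 2^-1.
  apply: (@le_trans _ _ (\sum_(T' in Fc) \sum_z W z * (term_eval T' z)%:R)).
    rewrite exchange_big /=; apply: ler_sum => z _; rewrite -mulr_sumr ler_wpM2l //.
    case hz : (f z) => /=; last by rewrite sumr_ge0.
    move: hz; rewrite fE => /exists_inP[T' T'F hT'].
    by rewrite (bigD1 T') //= hT' lerDl sumr_ge0.
  apply: (@le_trans _ _ (\sum_(T' in Fc) 2^-1 ^+ tau.+1)).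
    by apply: ler_sum => T' /hT.
  rewrite sumr_const exprS -mulrnAr -[X in _ <= X]mulr1 ler_wpM2l; [|lra|].
    by [].
  rewrite -[_ *+ #|_|]mulr_natl exprVn ler_pdivrMr ?exprn_gt0 // mul1r -natrX ler_nat.
  exact: ltnW.
apply: (@le_trans _ _ (\sum_z W z * (~~ f z)%:R * u)).
  rewrite -mulr_suml ler_wpM2r //.
  have : \sum_z W z * (f z)%:R + \sum_z W z * (~~ f z)%:R = 1.
    transitivity (\sum_z W z) => //; rewrite -big_split /=; apply: eq_bigr => z _.
    by rewrite -mulrDr; case: (f z); rewrite /= ?addr0 ?add0r mulr1.
  lra.
rewrite /noiseM; apply: ler_sum => z _; rewrite -/(W z) -mulrA ler_wpM2l //.
by case hz : (f z); rewrite /= ?mul0r ?mul1r //; apply: hu; rewrite hz.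
Qed.

Lemma expectation_valid T : expectation (validM (R := R) f B T).
Proof.
apply: expectation_loop => v; case: v; last exact: expectation_ret.
apply: (expectation_bind _ (fun z phi => phi (f z))); first exact: expectation_noise.
by move=> z; exact: expectation_ret.
Qed.

Lemma valid_false T : #|T| = k -> T \notin near_terms ->
  reach (1 - 2^-1 ^+ B : R) (eq false) (validM f B T).
Proof.
move=> Tk hT phi u phi0 u0 hu; rewrite /validM.
set g := (X in loopM _ X).
have hg m : loopM m g false phi = phi false by elim: m.
elim: B => [|m ih] /=; first by rewrite expr0 subrr mul0r.
have uf : u <= phi false by exact: hu.
have p0 : 0 <= 2^-1 ^+ m :> R by apply: exprn_ge0; lra.
rewrite exprS; have -> : (1 - 2^-1 * 2^-1 ^+ m) * u
    = (1 - 2^-1 ^+ m) * u + 2^-1 * (2^-1 ^+ m * u)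
  by set q := 2^-1 ^+ m; field.
apply: (reach_shift _ _ _ _ _ _ _ (completion_false _ Tk hT)).
- exact: expectation_noise.
- exact: mulr_ge0.
- move=> z; case: (f z); first exact: ih.
  by rewrite hg; apply: le_trans uf; rewrite ler_piMl //; lra.
- move=> z /negbTE ->; rewrite hg; apply: le_trans uf.
  by rewrite mulrBl mul1r subrK.
Qed.

(** Distinct near terms number at most [B], so on such lists [take B] is the identity. *)
Definition good_list L : Prop := uniq L /\ {subset L <= near_terms}.

Definition covered x L : bool := [exists T in Fc, (T \in L) && term_eval T x].

Lemma good_size L : good_list L -> (size L <= #|near_terms|)%N.
Proof. by move=> [h1 h2]; rewrite -(card_uniqP h1); apply/subset_leq_card/subsetP. Qed.

Lemma good_take L : good_list L -> take B L = L.
Proof. by move=> h; apply/take_oversize/(leq_trans (good_size _ h)). Qed.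

Lemma near_of_Fc T : T \in Fc -> T \in near_terms.
Proof.
move=> TF; rewrite inE Fk // eqxx /=; apply/exists_inP; exists T => //.
by rewrite setDv cards0.
Qed.

Lemma good_cons L T : good_list L -> T \notin L -> T \in near_terms ->
  good_list (T :: L).
Proof.
move=> [h1 h2] h3 h4; split; first by rewrite /= h3.
by move=> T'; rewrite in_cons => /orP[/eqP ->|/h2].
Qed.

Definition missing L : {set term n} := [set T in Fc | T \notin L].

(** A successful attempt may return a term of [F] that is false at [x]. That is still progress,
    because [missing] shrinks, and the exponential weight makes it a constant-factor drop. *)
Definition pot x L : R := if covered x L then 0 else 2 ^+ #|missing L|.

Lemma covered_sub x L L' : {subset L <= L'} -> covered x L -> covered x L'.
Proof.
move=> h /exists_inP[T TF /andP[TL hx]]; apply/exists_inP; exists T => //.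
by rewrite (h _ TL).
Qed.

Lemma pot_ge0 x L : 0 <= pot x L.
Proof. by rewrite /pot; case: ifP => // _; apply: exprn_ge0. Qed.

Lemma pot_cons x L T : pot x (T :: L) <= pot x L.
Proof.
have hs : {subset L <= T :: L} by move=> T' h; rewrite in_cons h orbT.
rewrite /pot; case: (boolP (covered x L)) => [/(covered_sub _ _ _ hs) -> //|_].
case: ifP => _; first by apply: exprn_ge0.
apply: ler_weXn2l; first by lra.
apply/subset_leq_card/subsetP => T'; rewrite !inE negb_or => /and3P[-> _ ->] //.
Qed.

Lemma pot_new x L T : T \in missing L -> pot x (T :: L) <= pot x L / 2.
Proof.
move=> hT; have hs : {subset L <= T :: L} by move=> T' h; rewrite in_cons h orbT.
rewrite /pot; case: (boolP (covered x L)) => [/(covered_sub _ _ _ hs) ->|_].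
  by rewrite mul0r.
case: ifP => _; first by rewrite divr_ge0 // exprn_ge0.
rewrite (cardsD1 T (missing L)) hT add1n exprSr mulfK ?pnatr_eq0 //.
apply: ler_weXn2l; first by lra.
apply/subset_leq_card/subsetP => T'; rewrite !inE negb_or => /and3P[-> -> ->] //.
Qed.

Let p : R := 2^-1 ^+ attempt_exp tau a.
Let delta : R := 2^-1 ^+ B.

Lemma p_bounds : 0 <= p <= 1.
Proof. by rewrite exprn_ge0 ?exprn_ile1 //; lra. Qed.

Lemma delta_bounds : 0 <= delta <= 1.
Proof. by rewrite exprn_ge0 ?exprn_ile1 //; lra. Qed.

Lemma expectation_trial k' x L : expectation (trialM (R := R) f B a k' x L).
Proof.
apply: (expectation_bind _ (fun T phi => if (#|T| == k') && (T \notin take B L)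
    then validM f B T (fun b => phi (if b then T :: L else L)) else phi L)).
  exact: expectation_attempt.
move=> T; case: ((#|T| == k') && (T \notin take B L)); last exact: expectation_ret.
apply: (expectation_bind _ (fun b phi => phi (if b then T :: L else L))).
  exact: expectation_valid.
by move=> b; exact: expectation_ret.
Qed.

(* The value of a run is at least [c] minus a multiple of the potential; an
   attempt loses [delta] on spurious terms and halves the potential with
   probability [p]. *)
Lemma trial_step x L (psi : dnf n -> R) (c w u : R) :
  good_list L -> f x -> (forall L', 0 <= psi L') -> c <= u -> 0 <= w -> 0 <= u ->
  (forall L', good_list L' -> {subset L <= L'} -> c - pot x L' * w <= psi L') ->
  c - delta * u - pot x L * (w * (1 - p / 2)) <= trialM f B a k x L psi.
Proof.
move=> gL hx psi0 cu w0 u0 hpsi.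
have /andP[d0 d1] := delta_bounds; have /andP[p0 p1] := p_bounds.
have P0 := pot_ge0 x L.
set A0 := c - pot x L * w.
have hL : A0 <= psi L by apply: hpsi.
have consL T : {subset L <= T :: L} by move=> T' h; rewrite in_cons h orbT.
have A0u : A0 <= u by rewrite /A0; have := mulr_ge0 P0 w0; lra.
have hcons T : T \notin L -> T \in near_terms -> A0 <= psi (T :: L).
  move=> h1 h2; apply: le_trans (hpsi _ (good_cons _ _ gL h1 h2) (consL T)).
  by rewrite /A0 lerD2l lerN2 ler_wpM2r // pot_cons.
rewrite /trialM (good_take _ gL).
set h := (X in attemptM _ _ _ _ _ X).
have hh T : A0 - delta * u <= h T.
  rewrite /h; case: ifP => [/andP[/eqP Tk TL]|_]; last first.
    by apply: le_trans hL; rewrite gerBl mulr_ge0.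
  case: (boolP (T \in near_terms)) => hT.
    apply: (expectation_const _ _ _ (expectation_valid T)) => b.
    apply: (@le_trans _ _ A0); first by rewrite gerBl mulr_ge0.
    by case: b => //; exact: hcons.
  (* A term outside [near_terms] is accepted with probability at most [delta], at a loss of at most
     [u]. If [A0] is negative, nonnegativity of [psi] suffices. *)
  have hr := valid_false T Tk hT (fun b => psi (if b then T :: L else L)).
  case: (lerP 0 A0) => hA.
    apply: le_trans (hr A0 _ hA _); last by move=> b <-.
      by rewrite -/delta mulrBl mul1r lerD2l lerN2 ler_wpM2l.
    by move=> b.
  apply: le_trans (expectation_ge0 _ _ (expectation_valid T) _); last by [].
  by have := mulr_ge0 d0 u0; lra.
case: (boolP (covered x L)) => hc.
  apply: le_trans (expectation_const _ _ h (expectation_attempt f B a L a1 x) hh).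
  by rewrite /A0 /pot hc !mul0r !subr0.
have [T0 T0F hT0] : exists2 T0, T0 \in Fc & term_eval T0 x.
  by move: hx; rewrite fE => /exists_inP[T0]; exists T0.
have T0n : T0 \notin found Fc B L.
  rewrite inE T0F good_take //=; apply: contra hc => hT0L.
  by apply/exists_inP; exists T0; rewrite // hT0L.
have La : (size (take B L) <= 2 ^ a)%N.
  by rewrite good_take //; apply: leq_trans (good_size _ gL) near_a.
have hr := @attempt_reach R n Fc k Fk Fsat f fE tau Ftau B a L a1 na La x T0 T0F T0n hT0.
have := reach_shift _ (A0 - delta * u) (pot x L * w / 2) _ _ h (expectation_attempt f B a L a1 x) hr.
have -> : A0 - delta * u + p * (pot x L * w / 2)
   = c - delta * u - pot x L * (w * (1 - p / 2)) by rewrite /A0; field.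
apply => //; first by rewrite divr_ge0 // mulr_ge0.
move=> T; rewrite !inE good_take // => /andP[hn TF].
have TL : T \notin L by move: hn; rewrite TF.
rewrite /h Fk // eqxx TL /= valid_true //.
apply: (@le_trans _ _ (c - pot x (T :: L) * w)); last first.
  by apply: hpsi => //; apply: good_cons => //; exact: near_of_Fc.
have : pot x (T :: L) * w <= pot x L / 2 * w.
  by rewrite ler_wpM2r // pot_new // inE TF.
by have := mulr_ge0 d0 u0; rewrite /A0; lra.
Qed.

Lemma trials_reach m x L : good_list L -> f x ->
  reach (1 - m%:R * delta - pot x L * (1 - p / 2) ^+ m)
    (fun L' => [/\ good_list L', {subset L <= L'} & covered x L'])
    (loopM m (trialM f B a k x) L).
Proof.
have /andP[d0 d1] := delta_bounds; have /andP[p0 p1] := p_bounds.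
move=> gL hx phi u phi0 u0 hu.
have hE j L' : expectation (loopM j (trialM (R := R) f B a k x) L').
  by apply: expectation_loop => L''; exact: expectation_trial.
suff main j L' : good_list L' -> {subset L <= L'} ->
   (1 - j%:R * delta) * u - pot x L' * ((1 - p / 2) ^+ j * u)
     <= loopM j (trialM f B a k x) L' phi.
  by apply: le_trans (main m L gL _) => //; rewrite le_eqVlt; apply/orP; left; apply/eqP; ring.
elim: j L' => [|j ih] L' gL' hL' /=.
  rewrite expr0 mul0r subr0 !mul1r.
  case: (boolP (covered x L')) => hc.
    by rewrite /pot hc mul0r subr0; apply: hu.
  rewrite /pot (negbTE hc); apply: le_trans (phi0 _).
  have : 1 <= 2 ^+ #|missing L'| :> R by apply: exprn_ege1; lra.
  by move=> h; rewrite subr_le0 ler_peMl.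
set w := (1 - p / 2) ^+ j * u.
have w0 : 0 <= w by rewrite mulr_ge0 // exprn_ge0 //; lra.
have c1 : (1 - j%:R * delta) * u <= u.
  by rewrite ler_piMl // gerBl mulr_ge0 // ler0n.
have := trial_step x L' (fun L'' => loopM j (trialM f B a k x) L'' phi)
  ((1 - j%:R * delta) * u) w u gL' hx _ c1 w0 u0.
have -> : (1 - j%:R * delta) * u - delta * u - pot x L' * (w * (1 - p / 2))
  = (1 - j.+1%:R * delta) * u - pot x L' * ((1 - p / 2) ^+ j.+1 * u).
  by rewrite /w exprS -natr1; ring.
apply => [L''|L'' gL'' hL''].
  exact: expectation_ge0.
by apply: ih => // T /hL'; exact: hL''.
Qed.

(** Bounds the failure probability at one example after [B] trials: a spurious acceptance, or a
    potential, initially at most [2 ^+ #|Fc|], that has not dropped enough. *)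
Definition learn_loss : R := B%:R * delta + 2 ^+ #|Fc| * (1 - p / 2) ^+ B.

Lemma learn_loss_ge0 : 0 <= learn_loss.
Proof.
have /andP[d0 d1] := delta_bounds; have /andP[p0 p1] := p_bounds.
rewrite addr_ge0 // mulr_ge0 // ?ler0n // exprn_ge0 //; lra.
Qed.

Lemma pot_le x L : pot x L <= 2 ^+ #|Fc|.
Proof.
rewrite /pot; case: ifP => _; first by apply: exprn_ge0.
apply: ler_weXn2l; first by lra.
by apply/subset_leq_card/subsetP => T; rewrite inE => /andP[].
Qed.

Lemma expectation_learn k' (S : seq (cube n * bool)) :
  expectation (learnM (R := R) f B a k' S).
Proof.
apply: expectation_fold => [[x b]] L; case: b => /=; last exact: expectation_ret.
by apply: expectation_loop => L'; exact: expectation_trial.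
Qed.

Lemma learn_reach (S : seq (cube n * bool)) :
  (forall e, e \in S -> e.2 = f e.1) -> (size S)%:R * learn_loss <= 1 ->
  reach (1 - (size S)%:R * learn_loss)
    (fun L => good_list L /\ forall e, e \in S -> e.2 -> covered e.1 L)
    (learnM f B a k S).
Proof.
move=> hS hl; rewrite /learnM.
have /andP[d0 d1] := delta_bounds; have /andP[p0 p1] := p_bounds.
have l0 := learn_loss_ge0.
set g := (X in foldM X).
have hg e L : expectation (g e L).
  case: e => x b; rewrite /g /=; case: b; last exact: expectation_ret.
  by apply: expectation_loop => L'; exact: expectation_trial.
suff main L : good_list L -> reach (1 - (size S)%:R * learn_loss)
    (fun L' => [/\ good_list L', {subset L <= L'} &
        forall e, e \in S -> e.2 -> covered e.1 L']) (foldM g S L).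
  by apply: reach_sub (main [::] _) => // L [].
elim: S L hS hl => [|[x b] S ih] L hS hl gL /=.
  by rewrite mul0r subr0; apply: reach_ret; split.
move: hl; rewrite /= -natr1 mulrDl mul1r => hl.
have s0 : 0 <= (size S)%:R * learn_loss by rewrite mulr_ge0 // ler0n.
have hS' e : e \in S -> e.2 = f e.1 by move=> h; apply: hS; rewrite in_cons h orbT.
have hl' : (size S)%:R * learn_loss <= 1 by lra.
pose S1 L' := [/\ good_list L', {subset L <= L'} & b -> covered x L'].
apply: (@reach_le _ _ ((1 - learn_loss) * (1 - (size S)%:R * learn_loss))).
  by have := mulr_ge0 l0 s0; lra.
apply: (reach_bind _ _ S1 _ (g (x, b) L) (foldM g S)).
- by lra.
- rewrite /g /=; case: b @S1 hS => S1 hS; last first.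
    by apply: (@reach_le _ _ 1); [lra|apply: reach_ret; split].
  have hx : f x by rewrite -(hS (x, true)) ?mem_head.
  apply: reach_le; last first.
    by apply: reach_sub (trials_reach B x L gL hx) => L' [h1 h2 h3]; split.
  have h : 0 <= (1 - p / 2) ^+ B by apply: exprn_ge0; lra.
  by rewrite /learn_loss -addrA -opprD lerD2l lerN2 lerD2l ler_wpM2r // pot_le.
- move=> L' [gL' hL' hx]; apply: reach_sub (ih L' hS' hl' gL').
  move=> L'' [h1 h2 h3]; split => //; first by move=> T /hL'; exact: h2.
  move=> e; rewrite in_cons => /orP[/eqP -> /= hb|]; last exact: h3.
  by apply: covered_sub h2 _; exact: hx.
- by move=> L'; apply: expectation_fold.
Qed.

(** Only the run with the right width counts; it is the one at index [k - 1], widths being [i.+1].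
    The other lists are arbitrary and cannot spoil the conclusion. *)
Lemma learnall_reach (S : seq (cube n * bool)) : (1 <= k <= n)%N ->
  (forall e, e \in S -> e.2 = f e.1) -> (size S)%:R * learn_loss <= 1 ->
  reach (1 - (size S)%:R * learn_loss)
    (fun Ls => exists2 L, L \in Ls &
       good_list L /\ forall e, e \in S -> e.2 -> covered e.1 L)
    (learnallM f B a S).
Proof.
move=> /andP[k1 kn] hS hl; rewrite /learnallM.
have kk : (k.-1 < n)%N by rewrite prednK.
set g := (X in foldM X).
pose good_in (Ls : seq (dnf n)) := exists2 L : dnf n, L \in Ls &
  good_list L /\ forall e, e \in S -> e.2 -> covered e.1 L.
have hgE i Ls : expectation (g i Ls).
  apply: (expectation_bind _ (fun L phi => phi (L :: Ls))).
    exact: expectation_learn.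
  by move=> L; exact: expectation_ret.
have hin : Ordinal kk \in rev (enum 'I_n) by rewrite mem_rev mem_enum.
have after (s : seq 'I_n) Ls phi u : (forall Ls, 0 <= phi Ls) -> 0 <= u ->
    (forall Ls, good_in Ls -> u <= phi Ls) -> good_in Ls -> u <= foldM g s Ls phi.
  move=> phi0 u0 hu; elim: s Ls => [|i s ih] Ls hLs /=; first exact: hu.
  rewrite /g; apply: (expectation_const _ _ _ (expectation_learn _ _)) => L.
  by apply: ih; case: hLs => L' h1 h2; exists L' => //; rewrite in_cons h1 orbT.
move=> phi u phi0 u0 hu; elim: (rev (enum 'I_n)) [::] hin => [//|i s ih] Ls.
rewrite in_cons => /orP[/eqP <-|hs] /=; last first.
  by rewrite {1}/g; apply: (expectation_const _ _ _ (expectation_learn _ _)) => L; exact: ih.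
rewrite {1}/g prednK //; apply: (learn_reach S hS hl) => // [L|L hL].
  by apply: expectation_ge0 => //; apply: expectation_fold.
by apply: after => //; exists L => //; rewrite mem_head.
Qed.

End Learn.


(** A set of at most [d] elements is the range of a map from ['I_d] to [option I], with [None] as
    padding. *)
Lemma card_small_sets (I : finType) d :
  (#|[set X : {set I} | #|X| <= d]| <= #|I|.+1 ^ d)%N.
Proof.
rewrite -card_option -{2}(card_ord d) -card_ffun.
pose h (g : {ffun 'I_d -> option I}) : {set I} := [set x | Some x \in codom g].
apply: leq_trans (leq_imset_card h predT).
apply/subset_leq_card/subsetP => X; rewrite inE => hX.
apply/imsetP; exists [ffun i : 'I_d => nth None (map Some (enum X)) i] => //.
apply/setP => x; rewrite inE; apply/idP/codomP => [xX|[i]].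
  have hi : (index x (enum X) < size (enum X))%N by rewrite index_mem mem_enum.
  have hd : (index x (enum X) < d)%N by apply: leq_trans hi _; rewrite -cardE.
  exists (Ordinal hd); rewrite ffunE (nth_map x) //= nth_index // mem_enum //.
rewrite ffunE => e; have hi : (i < size (enum X))%N.
  by rewrite ltnNge; apply/negP => h'; move: e; rewrite nth_default ?size_map.
move: e; rewrite (nth_map x) // => -[->].
by rewrite -[_ \in X]mem_enum mem_nth.
Qed.

(** A near term is recovered from a term of [F], the literals removed and the literals added; equal
    width bounds both differences by [tau]. *)
Lemma card_near_terms {n : nat} (Fc : {set term n}) k tau :
  (forall T, T \in Fc -> #|T| = k) ->
  (#|near_terms Fc k tau| <= #|Fc| * ((2 * n).+1 ^ tau) ^ 2)%N.
Proof.
move=> Fk; pose Sm := [set X : term n | (#|X| <= tau)%N].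
have hSm : (#|Sm| <= (2 * n).+1 ^ tau)%N.
  by apply: leq_trans (card_small_sets _ _) _; rewrite card_prod card_ord card_bool mulnC.
pose h (q : term n * (term n * term n)) : term n := (q.1 :\: q.2.1) :|: q.2.2.
apply: (@leq_trans #|setX Fc (setX Sm Sm)|); last first.
  by rewrite !cardsX leq_mul2l -mulnn leq_mul ?orbT.
apply: leq_trans (leq_imset_card h _).
apply/subset_leq_card/subsetP => T; rewrite inE => /andP[/eqP Tk /exists_inP[T' T'F hd]].
apply/imsetP; exists (T', (T' :\: T, T :\: T')).
  have e : #|T :\: T'| = #|T' :\: T|.
    apply/eqP; rewrite -(eqn_add2l #|T :&: T'|) cardsID Tk.
    by rewrite setIC cardsID Fk.
  by rewrite !inE /= T'F hd e hd.
apply/setP => l; rewrite !inE /=.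
by case: (l \in T); case: (l \in T').
Qed.

Lemma compl_pow_le {R : realType} (N : nat) : (0 < N)%N ->
  (1 - N%:R^-1) ^+ N <= 2^-1 :> R.
Proof.
move=> N0; have N1 : 1 <= N%:R :> R by rewrite ler1n.
have q0 : 0 <= N%:R^-1 :> R by rewrite invr_ge0 ler0n.
have q1 : N%:R^-1 <= 1 :> R by rewrite invf_le1 ?ltr0n.
set q : R := N%:R^-1 in q0 q1 *.
have h2 : 2 <= (1 + q) ^+ N.
  apply: le_trans (bernoulli _ _ q0).
  by rewrite /q divff ?pnatr_eq0 -?lt0n //; lra.
have h1 : (1 - q) ^+ N * (1 + q) ^+ N <= 1.
  by rewrite -exprMn; apply: exprn_ile1; nra.
have : 0 <= (1 - q) ^+ N by apply: exprn_ge0; lra.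
nra.
Qed.

(** * Greedy cover and generalization *)

Section Greedy.
Context {R : realType} {n : nat}.
Variables (B s : nat).
Hypothesis s0 : (0 < s)%N.
Variables (N U0 : seq (cube n)) (Ls : seq (dnf n)) (Good : seq (term n)).
Hypothesis U0B : (size U0 <= B)%N.
Hypothesis Good_in : forall T, T \in Good -> exists2 L, L \in Ls & T \in take B L.
Hypothesis Good_N : forall T, T \in Good -> consistent T N.
Hypothesis Good_s : (size Good <= s)%N.
Hypothesis Good_cover : forall x, x \in U0 -> has (fun T => term_eval T x) Good.
Implicit Types (T : term n) (U : seq (cube n)) (H : dnf n).

Definition best_inv U (v : seq (cube n) * seq (term n)) : Prop :=
  v = (U, [::]) \/ exists2 T, consistent T N & v = (uncovered B T U, [:: T]).

Lemma better_inv U v T : best_inv U v -> best_inv U (better B N U v T).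
Proof.
by rewrite /better; case: ifP => // /andP[h _] _; right; exists T.
Qed.

Lemma better_size U v T : (size (better B N U v T).1 <= size v.1)%N.
Proof. by rewrite /better; case: ifP => // /andP[_ /ltnW]. Qed.

Lemma better_min U v T : consistent T N ->
  (size (better B N U v T).1 <= size (uncovered B T U))%N.
Proof. by rewrite /better => -> /=; case: ltnP. Qed.

Lemma fold_better U v (L : seq (term n)) : best_inv U v ->
  [/\ best_inv U (foldl (better B N U) v L),
      (size (foldl (better B N U) v L).1 <= size v.1)%N &
      forall T, T \in L -> consistent T N ->
        (size (foldl (better B N U) v L).1 <= size (uncovered B T U))%N].
Proof.
elim: L v => [|T L ih] v hv //=.
have [h1 h2 h3] := ih _ (better_inv U v T hv); split => //.
  exact: leq_trans h2 (better_size _ _ _).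
move=> T'; rewrite in_cons => /orP[/eqP ->|h] hc; last exact: h3.
exact: leq_trans h2 (better_min _ _ _ hc).
Qed.

Lemma best_spec U :
  best_inv U (best B N Ls U) /\
  forall T, T \in Good -> (size (best B N Ls U).1 <= size (uncovered B T U))%N.
Proof.
suff main v Ls' : best_inv U v ->
    let w := foldl (fun v L => foldl (better B N U) v (take B L)) v Ls' in
    [/\ best_inv U w, (size w.1 <= size v.1)%N &
      forall T L, L \in Ls' -> T \in take B L -> consistent T N ->
        (size w.1 <= size (uncovered B T U))%N].
  have [h1 _ h2] := main (U, [::]) Ls (or_introl erefl); split => // T hT.
  by have [L hL hTL] := Good_in _ hT; apply: h2 hL hTL _; exact: Good_N.
elim: Ls' v => [|L Ls' ih] v hv //=.
have [a1 a2 a3] := fold_better U v (take B L) hv.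
have [b1 b2 b3] := ih _ a1; split => //; first exact: leq_trans b2 a2.
move=> T L'; rewrite in_cons => /orP[/eqP ->|h] hT hc; last exact: b3 h hT hc.
exact: leq_trans b2 (a3 _ hT hc).
Qed.

Definition greedy_inv (m : nat) (v : seq (cube n) * dnf n) : Prop :=
  [/\ perm_eq v.1 [seq x <- U0 | ~~ dnf_eval v.2 x],
      all (fun T => consistent T N) v.2, (size v.2 <= m)%N &
      (size v.1)%:R <= (1 - s%:R^-1) ^+ m * (size U0)%:R :> R].

Lemma pigeonhole U : {subset U <= U0} -> U != [::] ->
  exists2 T, T \in Good & (size U <= s * count (term_eval T) U)%N.
Proof.
move=> hU U1; apply: contrapT => hno.
have hlt T : T \in Good -> (s * count (term_eval T) U < size U)%N.
  by move=> hT; rewrite ltnNge; apply/negP => h; apply: hno; exists T.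
have hsum : (size U <= \sum_(T <- Good) count (term_eval T) U)%N.
  elim: U hU {U1 hno hlt} => [|x U ih] hU //=.
  rewrite big_split /= -add1n leq_add ?ih //; last first.
    by move=> y hy; apply: hU; rewrite in_cons hy orbT.
  have /hasP[T hT hx] := Good_cover x (hU x (mem_head _ _)).
  by rewrite (big_rem T) //= hx.
have Gs : (0 < size U)%N by case: U U1 {hU hno hlt hsum}.
have hle : (s * \sum_(T <- Good) count (term_eval T) U <= size Good * (size U - 1))%N.
  elim: (Good) hlt => [|T G ih] hlt; first by rewrite big_nil muln0.
  rewrite big_cons mulnDr mulSn leq_add //.
    by have := hlt T (mem_head _ _); rewrite subn1; case: (size U).
  by apply: ih => T' hT'; apply: hlt; rewrite in_cons hT' orbT.
have : (size Good * (size U - 1) <= s * (size U - 1))%N by rewrite leq_mul2r Good_s orbT.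
have : (s * size U <= s * \sum_(T <- Good) count (term_eval T) U)%N by rewrite leq_mul2l hsum orbT.
clear -hle Gs s0; nia.
Qed.

Lemma greedy_inv_step m v : greedy_inv m v -> greedy_inv m.+1 (greedy_step B N Ls v).
Proof.
case: v => U H [/= hp hN hH hU].
have UU0 : {subset U <= U0}.
  by move=> x; rewrite (perm_mem hp) mem_filter => /andP[].
have UB : (size U <= B)%N.
  rewrite (perm_size hp) size_filter; exact: leq_trans (count_size _ _) U0B.
have hun T : uncovered B T U = rev [seq x <- U | ~~ term_eval T x].
  by rewrite /uncovered take_oversize.
have [hinv hmin] := best_spec U.
have s1 : 1 <= s%:R :> R by rewrite ler1n.
have q1 : s%:R^-1 <= 1 :> R by rewrite invf_le1 ?ltr0n.
have hsize : (size (best B N Ls U).1)%:R <= (1 - s%:R^-1) ^+ m.+1 * (size U0)%:R :> R.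
  rewrite exprS -mulrA.
  apply: (@le_trans _ _ ((1 - s%:R^-1) * (size U)%:R)); last first.
    by rewrite ler_wpM2l // subr_ge0.
  case: (eqVneq U [::]) => [U0e|Une].
    have : (size (best B N Ls U).1 <= size U)%N.
      case: hinv => [->//|[T _ ->]] /=; rewrite hun size_rev size_filter; exact: count_size.
    by rewrite U0e leqn0 => /eqP ->; rewrite mulr0.
  have [T hT hc] := pigeonhole U UU0 Une.
  have := hmin T hT; rewrite hun size_rev size_filter => h.
  have : (size (best B N Ls U).1 + count (term_eval T) U <= size U)%N.
    rewrite -(count_predC (term_eval T) U) addnC leq_add2l; exact: h.
  rewrite -(ler_nat R) natrD => h1.
  have : (size U)%:R / s%:R <= (count (term_eval T) U)%:R :> R.
    by rewrite ler_pdivrMr ?ltr0n // mulrC -natrM ler_nat.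
  lra.
rewrite /greedy_step /=; case: hinv => [e|[T hT e]].
  rewrite e /=; split => //=; first exact: leqW.
  by move: hsize; rewrite e.
rewrite e /=; split => //=.
- rewrite hun perm_rev.
  have -> : [seq x <- U0 | ~~ (term_eval T x || dnf_eval H x)]
    = [seq x <- [seq x <- U0 | ~~ dnf_eval H x] | ~~ term_eval T x].
    by rewrite -filter_predI; apply: eq_filter => x /=; rewrite negb_or.
  exact: perm_filter.
- by rewrite hT.
- by move: hsize; rewrite e.
Qed.

Lemma greedy_spec m : greedy_inv m (greedy B m N Ls U0).
Proof.
rewrite /greedy; elim: m => [|m ih] /=; last exact: greedy_inv_step.
split => //=; last by rewrite expr0 mul1r.
by rewrite (eq_filter (a2 := predT)) ?filter_predT.
Qed.

End Greedy.

(** Chosen terms are consistent with the negative examples, so disagreements are uncovered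
    positives. Every round removes at least a fraction [1 / s] of these, so [s] rounds halve
    them. *)
Lemma greedy_error {R : realType} {n : nat} (f : cube n -> bool) (B s G : nat)
    (Ls : seq (dnf n)) (Fc : {set term n}) (L : dnf n) (S : seq (cube n * bool)) :
  (0 < s)%N -> (#|Fc| <= s)%N ->
  (forall x, f x = [exists T in Fc, term_eval T x]) ->
  (size S <= B)%N -> (forall e, e \in S -> e.2 = f e.1) ->
  L \in Ls -> (size L <= B)%N ->
  (forall e, e \in S -> e.2 -> covered Fc e.1 L) ->
  let H := (greedy B (G * s) (labelled false S) Ls (labelled true S)).2 in
  (size H <= G * s)%N /\
  (count (fun e => dnf_eval H e.1 != f e.1) S * 2 ^ G <= B)%N.
Proof.
move=> s0 Fs fE SB hS LLs LB hcov.
pose Good := [seq T <- enum Fc | T \in L].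
have lab b x : x \in labelled b S -> f x = b.
  rewrite mem_rev => /mapP[[y c]]; rewrite mem_filter /= => /andP[/eqP -> h] ->.
  by rewrite -(hS _ h).
have h1 T : T \in Good -> exists2 L, L \in Ls & T \in take B L.
  by rewrite mem_filter => /andP[hT _]; exists L; rewrite ?take_oversize.
have h2 T : T \in Good -> consistent T (labelled false S).
  rewrite mem_filter mem_enum => /andP[_ TF]; apply/hasPn => x /lab hx.
  by apply/negP => hTx; move: hx; rewrite (f_sat Fc f fE T x TF hTx).
have h3 : (size Good <= s)%N.
  by apply: leq_trans Fs; rewrite cardE size_filter; exact: count_size.
have h4 x : x \in labelled true S -> has (fun T => term_eval T x) Good.
  rewrite mem_rev => /mapP[e]; rewrite mem_filter => /andP[/eqP he hin] ->.
  have /exists_inP[T TF /andP[TL hT]] := hcov e hin (he : e.2).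
  by apply/hasP; exists T => //; rewrite mem_filter TL mem_enum.
have hU : (size (labelled true S) <= B)%N by apply: leq_trans (labelled_size _ _) SB.
have [] := @greedy_spec R n B s s0 (labelled false S) (labelled true S) Ls Good hU h1 h2 h3 h4 (G * s).
set v := greedy _ _ _ _ _ => hp hN hH hsz; split => //.
have -> : count (fun e => dnf_eval v.2 e.1 != f e.1) S = size v.1.
  rewrite (perm_size hp) size_filter /labelled count_rev count_map count_filter.
  apply: eq_in_count => [[x b]] hin /=; have := hS _ hin; rewrite /= => hb.
  rewrite -hb; case: b hb hin => hb hin; first by case: dnf_eval.
  rewrite andbF eqbF_neg negbK; apply/negbTE/hasPn => T hT.
  have := allP hN _ hT; rewrite /consistent => /hasPn; apply.
  rewrite mem_rev; apply/mapP; exists (x, false) => //.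
  by rewrite mem_filter.
have q : (1 - s%:R^-1) ^+ (G * s) <= 2^-1 ^+ G :> R.
  rewrite mulnC exprM; apply: lerXn2r; rewrite ?nnegrE; [|lra|exact: compl_pow_le].
  by apply: exprn_ge0; rewrite subr_ge0 invf_le1 ?ltr0n // ler1n.
rewrite -(ler_nat R) natrM natrX.
have : (size v.1)%:R <= 2^-1 ^+ G * B%:R :> R.
  apply: le_trans hsz _; apply: ler_pM => //; last by rewrite ler_nat.
  by apply: exprn_ge0; rewrite subr_ge0 invf_le1 ?ltr0n // ler1n.
by rewrite exprVn mulrC ler_pdivlMr ?exprn_gt0.
Qed.

(** * Occam bound for short disjunctions *)

Section Occam.
Context {R : realType} {n : nat}.
Variables (f : cube n -> bool) (D : cube n -> R).
Hypothesis hD : is_distr D.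

(** Enumerates the DNFs of size at most [m] by a finite type, as the union bound requires; [None]
    stands for an empty place. *)
Definition dnf_of {m : nat} (g : {ffun 'I_m -> option (term n)}) : dnf n :=
  pmap id [seq g i | i <- enum 'I_m].

Lemma dnf_of_surj m (H : dnf n) : (size H <= m)%N -> exists g, H = @dnf_of m g.
Proof.
move=> hH; exists [ffun i : 'I_m => nth None (map Some H) i]; rewrite /dnf_of.
under eq_map do rewrite ffunE.
rewrite (map_comp (nth None (map Some H)) (@nat_of_ord m)) val_enum_ord.
rewrite -(subnKC hH) iotaD map_cat pmap_cat add0n.
have -> : [seq nth None (map Some H) i | i <- iota 0 (size H)] = map Some H.
  by rewrite -[size H](size_map Some) map_nth_iota0 // take_size.
have -> : pmap id (map Some H) = H by elim: (H) => //= T H' ->.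
rewrite -[LHS]cats0; congr (_ ++ _); symmetry.
suff main q p : (size H <= p)%N ->
  pmap id [seq nth None (map Some H) i | i <- iota p q] = [::] by exact: main.
elim: q p => //= q ih p hp.
by rewrite nth_default ?size_map //=; apply: ih; exact: leqW.
Qed.

Definition disagreements (h : cube n -> bool) (S : seq (cube n * bool)) : nat :=
  count (fun e => h e.1 != f e.1) S.

Lemma error_half (h : cube n -> bool) :
  \sum_x D x * 2^-1 ^+ (h x != f x) = 1 - error D f h / 2.
Proof.
have [D0 D1] := hD.
rewrite /error [X in _ - X / _]big_mkcond /= mulr_suml -[X in _ = X - _]D1 -sumrB.
by apply: eq_bigr => x _; case: (h x != f x); rewrite ?expr0 ?expr1; field.
Qed.

(* Chernoff bound: [2 ^ v / 2 ^ disagreements] dominates the indicator of at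
   most [v] disagreements and has expectation [2 ^ v (1 - error / 2) ^ B]. *)
Lemma sample_bound (I : finType) (Bad : {set I}) (h : I -> cube n -> bool) v B
    (phi : seq (cube n * bool) -> R) c (eps : R) :
  0 <= c -> (forall S, 0 <= phi S) -> 0 <= eps ->
  (forall i, i \in Bad -> eps <= error D f (h i)) ->
  (forall S, size S = B -> (forall e, e \in S -> e.2 = f e.1) ->
     (forall i, i \in Bad -> v < disagreements (h i) S)%N -> c <= phi S) ->
  c * (1 - #|Bad|%:R * (2 ^+ v * (1 - eps / 2) ^+ B)) <= sampleM f D B phi.
Proof.
have [D0 D1] := hD; move=> c0 phi0 e0 herr hphi.
pose r i := 1 - error D f (h i) / 2.
have r0 i : 0 <= r i.
  by rewrite /r -error_half sumr_ge0 // => x _; rewrite mulr_ge0 // exprn_ge0 //; lra.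
set W := fun (i : I) (S : seq (cube n * bool)) => 2 ^+ v * 2^-1 ^+ disagreements (h i) S : R.
have W0 i S : 0 <= W i S by rewrite mulr_ge0 // exprn_ge0 //; lra.
have hpoint S : size S = B -> (forall e, e \in S -> e.2 = f e.1) ->
    c * (1 - \sum_(i in Bad) W i S) <= phi S.
  move=> hs hl; case: (boolP [forall i in Bad, (v < disagreements (h i) S)%N]).
    move=> /forall_inP hb; apply: le_trans (hphi S hs hl hb).
    by rewrite ler_piMr // gerBl sumr_ge0.
  rewrite negb_forall_in => /exists_inP[i hi]; rewrite -leqNgt => hlt.
  apply: le_trans (phi0 S); apply: mulr_ge0_le0 => //; rewrite subr_le0.
  rewrite (bigD1 i) //= -[X in X <= _]addr0; apply: lerD; last by rewrite sumr_ge0.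
  rewrite /W -(subnK hlt) exprD -mulrA -exprMn divff ?pnatr_eq0 // expr1n mulr1.
  by apply: exprn_ege1; lra.
rewrite /sampleM; set g := (X in loopM _ X).
(* Once the part [S] of the sample is drawn, [W i S * r i ^+ m] is the conditional mean of the final
   weight, because each remaining example contributes a factor of mean [r i]. *)
suff main m S : (m + size S = B)%N -> (forall e, e \in S -> e.2 = f e.1) ->
    c * (1 - \sum_(i in Bad) W i S * r i ^+ m) <= loopM m g S phi.
  apply: le_trans (main B [::] _ _) => //; last by rewrite addn0.
  rewrite ler_wpM2l // lerD2l lerN2 [X in _ <= X]mulr_natl -sumr_const; apply: ler_sum => i hi.
  rewrite /W /= expr0 mulr1 ler_wpM2l ?exprn_ge0 //.
  by apply: lerXn2r; rewrite ?nnegrE //; have := herr i hi; have := r0 i; rewrite /r; lra.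
elim: m S => [|m ih] S hs hl /=.
  by under eq_bigr do rewrite expr0 mulr1; apply: hpoint.
rewrite /g -/g.
apply: (@le_trans _ _ (\sum_x D x * (c * (1 - \sum_(i in Bad) W i ((x, f x) :: S) * r i ^+ m)))).
  rewrite le_eqVlt; apply/orP; left; apply/eqP.
  rewrite (eq_bigr (fun x => D x * c - c * \sum_(i in Bad)
      W i S * r i ^+ m * (D x * 2^-1 ^+ (h i x != f x)))) => [|x _]; last first.
    rewrite mulrCA mulrBr mulr1 mulrBr [c * D x]mulrC; congr (_ - c * _).
    rewrite mulr_sumr; apply: eq_bigr => i _; rewrite /W /disagreements /= exprD; ring.
  rewrite sumrB -mulr_suml D1 mul1r -mulr_sumr mulrBr mulr1; congr (_ - c * _).
  rewrite exchange_big /=; apply: eq_bigr => i _; rewrite -mulr_sumr error_half -/(r i).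
  by rewrite exprSr mulrA.
apply: ler_sum => x _; rewrite ler_wpM2l //; apply: ih; first by rewrite /= addnS.
by move=> e; rewrite in_cons => /orP[/eqP ->|/hl].
Qed.

End Occam.


(** The sample comes first: with probability at least 39/40 it refutes all short hypotheses of large
    error at once. For any such sample, learning succeeds with probability at least 19/20 over the
    coins alone, and the output may depend on the sample in any way. *)
Lemma main_reach {R : realType} {n : nat} (F : dnf n) (D : cube n -> R)
    (k s B a tau G : nat) (eps : R) (phi : dnf n -> R) :
  is_distr D -> (forall T, T \in F -> #|T| = k) -> (1 <= k <= n)%N ->
  size F = s -> (0 < s)%N -> (s < 2 ^ tau)%N ->
  (1 <= a)%N -> (2 * n <= 2 ^ a)%N ->
  (s * ((2 * n).+1 ^ tau) ^ 2 <= 2 ^ a)%N -> (s * ((2 * n).+1 ^ tau) ^ 2 <= B)%N ->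
  B%:R * (B%:R * 2^-1 ^+ B + 2 ^+ s * (1 - 2^-1 ^+ attempt_exp tau a / 2) ^+ B)
    <= 20^-1 :> R ->
  ((2 ^ (2 * n)).+1 ^ (G * s))%:R * (2 ^+ (B %/ 2 ^ G) * (1 - eps / 2) ^+ B)
    <= 40^-1 :> R ->
  0 <= eps <= 2 -> (forall H, 0 <= phi H) ->
  (forall H, error D (dnf_eval F) (dnf_eval H) <= eps -> (size H <= G * s)%N ->
     1 <= phi H) ->
  9 / 10 <= mainM (dnf_eval F) D B a (G * s) phi.
Proof.
move=> hD Fk kn sF s0 hs a1 na near_a near_B hloss hocc /andP[eps0 eps2] phi0 hphi.
set f := dnf_eval F.
(* Contradictory terms of [F] are discarded; the function stays the same. *)
pose Fc := [set T : term n | (T \in F) && satisfiable T].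
have FcF T : T \in Fc -> T \in F by rewrite inE => /andP[].
have Fck T : T \in Fc -> #|T| = k by move/FcF; exact: Fk.
have Fsat T : T \in Fc -> satisfiable T by rewrite inE => /andP[].
have fE x : f x = [exists T in Fc, term_eval T x].
  apply/hasP/exists_inP => [[T hT hx]|[T /FcF hT hx]]; last by exists T.
  by exists T; rewrite // inE hT (satisfiable_eval T x hx).
have Fcs : (#|Fc| <= s)%N.
  rewrite -sF; apply: leq_trans (card_size F).
  by apply/subset_leq_card/subsetP => T /FcF.
have Ftau : (#|Fc| < 2 ^ tau)%N by exact: leq_ltn_trans hs.
have near m : (s * ((2 * n).+1 ^ tau) ^ 2 <= m)%N -> (#|near_terms Fc k tau| <= m)%N.
  by apply: leq_trans; apply: leq_trans (card_near_terms _ _ tau Fck) _; rewrite leq_mul2r Fcs orbT.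
have p1 : 2^-1 ^+ attempt_exp tau a <= 1 :> R by apply: exprn_ile1; lra.
have p0 : 0 <= 2^-1 ^+ attempt_exp tau a :> R by apply: exprn_ge0; lra.
set loss := learn_loss (R := R) Fc tau B a.
have hl : B%:R * loss <= 20^-1.
  apply: le_trans hloss; rewrite ler_wpM2l // lerD2l ler_wpM2r //.
    by apply: exprn_ge0; lra.
  by apply: ler_weXn2l => //; lra.
pose I : finType := {ffun 'I_(G * s) -> option (term n)}.
pose h (g : I) := dnf_eval (dnf_of g).
pose Bad : {set I} := [set g | eps < error D f (h g)].
apply: (@le_trans _ _ (19 / 20 * (1 - #|Bad|%:R * (2 ^+ (B %/ 2 ^ G) * (1 - eps / 2) ^+ B)))).
  have hB : #|Bad|%:R <= ((2 ^ (2 * n)).+1 ^ (G * s))%:R :> R.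
    rewrite ler_nat; apply: leq_trans (max_card _) _.
    rewrite card_ffun card_option card_ord -cardsT -powersetT card_powerset cardsT.
    by rewrite card_prod card_ord card_bool mulnC.
  have w0 : 0 <= 2 ^+ (B %/ 2 ^ G) * (1 - eps / 2) ^+ B.
    by rewrite mulr_ge0 // exprn_ge0 //; lra.
  have := ler_wpM2r w0 hB; lra.
apply: (sample_bound f D hD I Bad h) => //; first lra.
- move=> S; apply: expectation_ge0 => //; apply: expectation_fold => i Ls.
  apply: (expectation_bind _ (fun L phi => phi (L :: Ls))).
    exact: expectation_learn.
  by move=> L; exact: expectation_ret.
- by move=> g; rewrite inE => /ltW.
move=> S SB hS hbad.
have hl1 : (size S)%:R * loss <= 1 by rewrite SB; lra.
have := learnall_reach Fc k Fck Fsat f fE tau Ftau B a a1 na (near _ near_a)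
  (near _ near_B) S kn hS hl1 (fun Ls => phi (greedy B (G * s) (labelled false S) Ls (labelled true S)).2) 1.
rewrite mulr1 SB => hr; apply: le_trans (hr _ _ _) => //; first by rewrite -/loss; lra.
move=> Ls [L LLs [gL hcov]].
have LB : (size L <= B)%N by apply: leq_trans (good_size _ _ _ _ gL) (near _ near_B).
have SB' : (size S <= B)%N by rewrite SB.
have [hsz herr] := @greedy_error R n f B s G Ls Fc L S s0 Fcs fE SB' hS LLs LB hcov.
set H := (greedy _ _ _ _ _).2 in hsz herr *.
(* An output of error above [eps] would be in [Bad] and disagree with more than [B %/ 2 ^ G]
   examples, which the greedy cover excludes. *)
apply: hphi => //; rewrite leNgt; apply/negP => hlt.
have [g hg] := dnf_of_surj _ _ hsz.
have := hbad g; rewrite inE /h -hg hlt => /(_ isT).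
by rewrite ltnNge leq_divRL ?expn_gt0 // herr.
Qed.


(** * The machine program *)

Definition ehalf (z : prog) : prog :=
  ETl (EFold 90 91 z (ECons ENil ENil)
    (EIf (EHd $91) (ECons ENil (ECons ENil (ETl $91))) (ECons etrue (ETl $91)))).

Definition ebitlen (z : prog) : prog :=
  ETl (ELoop 92 (ECons z ENil)
    (EIf (EHd $92) (ECons (ehalf (EHd $92)) (ECons ENil (ETl $92))) $92)).

Definition esizes : prog :=
  ECons (EFold 93 94 (ebitlen $6) (ebitlen $7) (ECons ENil $94)) (ebitlen $18).

(** Each nesting level repeats the inner program [B] times, so the counter grows by [B ^ c]; the
    depth [c] is a constant of the program. *)
Fixpoint eincr (c : nat) : prog :=
  if c is c'.+1 then ELoop 95 $95 (eincr c') else ECons ENil $95.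

Definition epow (c : nat) : prog := ELet 95 ENil (eincr c).

Definition bitlen (m : nat) : nat := up_log 2 m.+1.

Section Sizes.
Context {R : realType} {n : nat}.
Variables (f : cube n -> bool) (D : cube n -> R) (B : nat).
Local Notation wp := (wp f D B).
Local Notation computes := (computes f D B).

Lemma half_computes z r m : computes z r (enc_nat m) -> (m <= B)%N ->
  computes (ehalf z) r (enc_nat m./2).
Proof.
move=> hz mB.
pose eV (v : bool * nat) := Node (enc_bool v.1) (enc_nat v.2).
pose g (_ : nat) (v : bool * nat) := if v.1 then (false, v.2.+1) else (true, v.2).
suff h : computes (EFold 90 91 z (ECons ENil ENil)
    (EIf (EHd $91) (ECons ENil (ECons ENil (ETl $91))) (ECons etrue (ETl $91)))) r
    (eV (odd m, m./2)) by exact: tl_computes h.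
have -> : (odd m, m./2) = foldl (fun v t => g t v) (false, 0%N) (iota 0 m).
  elim: m {hz mB} => // m ih; rewrite -[in iota _ _]addn1 iotaD foldl_cat -ih /= /g /=.
  by rewrite uphalf_half; case: (odd m).
apply: (fold_computes f D B (fun _ => Leaf) eV g) => //.
- by move=> phi; rewrite hz -enc_nat_map size_iota.
- by rewrite size_iota.
- by move=> w t [[] v] phi.
Qed.

Global Opaque ehalf.

Lemma bitlen_computes z r m : computes z r (enc_nat m) -> (m <= B)%N ->
  computes (ebitlen z) r (enc_nat (bitlen m)).
Proof.
move=> hz mB.
pose eV (v : nat * nat) := Node (enc_nat v.1) (enc_nat v.2).
suff h : computes (ELoop 92 (ECons z ENil)
    (EIf (EHd $92) (ECons (ehalf (EHd $92)) (ECons ENil (ETl $92))) $92)) r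
    (eV (0%N, bitlen m)) by exact: tl_computes h.
move=> phi /=; rewrite hz -[Leaf]/(enc_nat 0) -[Node _ _]/(eV (m, 0%N)).
set h := (X in loopM _ X).
have h0 i psi : h (eV (0%N, i)) psi = psi (eV (0%N, i)) by [].
have h1 k i psi : (k.+1 <= B)%N ->
    h (eV (k.+1, i)) psi = psi (eV (k.+1./2, i.+1)).
  by move=> kB; rewrite /h /= (half_computes _ _ k.+1).
rewrite -[bitlen m]add0n; clearbody h.
suff main b k i : (k <= b)%N -> (b <= B)%N ->
    loopM b h (eV (k, i)) phi = phi (eV (0%N, i + bitlen k)%N) by exact: main.
elim: b k i => [|b ih] [|k] i // hk hb; rewrite [LHS]/= ?addn0.
- by [].
- by rewrite h0 ih ?addn0 // ltnW.
- rewrite h1 ?(leq_trans hk hb) // ih; last by rewrite ltnW.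
    by rewrite /bitlen [in RHS]up_log2S // addnS.
  by rewrite /= uphalf_half; move: (odd_double_half k); case: (odd k); lia.
Qed.

Lemma sizes_computes r s N :
  r 6%N = enc_nat n -> r 7%N = enc_nat s -> r 18%N = enc_nat N ->
  (n <= B)%N -> (s <= B)%N -> (N <= B)%N -> (bitlen n <= B)%N ->
  computes esizes r (Node (enc_nat (bitlen n + bitlen s)) (enc_nat (bitlen N))).
Proof.
move=> hn hs hN nB sB NB lB phi; rewrite /esizes.
set e1 := EFold _ _ _ _ _.
have h1 : computes e1 r (enc_nat (bitlen n + bitlen s)).
  have -> : (bitlen n + bitlen s)%N
      = foldl (fun v (_ : nat) => v.+1) (bitlen s) (iota 0 (bitlen n)).
    elim: (bitlen n) (bitlen s) (0%N) => // k ih j i /=.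
    by rewrite -ih addSnnS.
  apply: (fold_computes f D B (fun _ => Leaf) enc_nat (fun _ v => v.+1)) => //.
  - rewrite -enc_nat_map size_iota; apply: bitlen_computes => //.
    by move=> psi /=; rewrite hn.
  - by apply: bitlen_computes => // psi /=; rewrite hs.
  - by rewrite size_iota.
have h2 : computes (ebitlen $18) r (enc_nat (bitlen N)).
  by apply: bitlen_computes => // psi /=; rewrite hN.
by rewrite -[LHS]/(wp e1 r (fun u => wp (ebitlen $18) r (fun v => phi (Node u v)))) h1 h2.
Qed.

Lemma incr_computes c r m : r 95%N = enc_nat m ->
  computes (eincr c) r (enc_nat (B ^ c + m)).
Proof.
elim: c r m => [|c ih] r m hr phi /=; first by rewrite hr.
rewrite hr expnS; set h := (X in loopM _ X).
have hh k psi : h (enc_nat k) psi = psi (enc_nat (B ^ c + k)) by apply: ih.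
clearbody h; move: (B ^ c)%N hh => k hh; elim: (B) m {hr} => [|b ihb] m /=.
  by rewrite mul0n.
by rewrite hh ihb; congr (phi (enc_nat _)); rewrite mulSn -addnA addnCA.
Qed.

Lemma pow_computes c r : computes (epow c) r (enc_nat (B ^ c)).
Proof. by move=> phi /=; rewrite (incr_computes _ _ 0) ?addn0. Qed.

End Sizes.

Lemma deterministic_incr c : deterministic (eincr c).
Proof. by elim: c. Qed.

(** Each round joins variable 3 to itself in a single step, which doubles [nodes + 1]; hence the
    predecessor in the formula for [B]. *)
Definition grow (e : expr) : cmd :=
  Seq (Assign 9 e)
    (While (Var 9)
      (Seq (Assign 3 (Defs.Cons (Var 3) (Var 3))) (Assign 9 (Tl (Var 9))))).

Definition sizes_address (x : nat) : nat :=
  match x with 6 => 0 | 7 => 1 | 18 => 2 | _ => 6 end.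
Definition main_address (x : nat) : nat :=
  match x with 5 => 5 | 6 => 0 | 7 => 1 | 8 => 4 | _ => 6 end.

(* Variable 3, which fixes the length of all loops, successively holds the input
   [(n, (s, N))], the bit length [l] of the input in unary, and a complete tree.
   Its height is a power of [2 l + 1] plus twice the number of greedy rounds per
   term, so that its size is quasipolynomial in [n] and [s] and polynomial in [N]. *)
Definition learner (ca cb : nat) : cmd :=
  Seq (Assign 3 (Defs.Cons (Var 0) (Defs.Cons (Var 1) (Var 2))))
  (Seq (compile esizes sizes_address 10)
  (Seq (Assign 4 (Defs.Cons Defs.Nil (Defs.Cons Defs.Nil (Defs.Cons Defs.Nil (Tl (Var 10))))))
  (Seq (Assign 3 (Hd (Var 10)))
  (Seq (compile (ECons (epow ca) (epow cb)) sizes_address 10)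
  (Seq (Assign 5 (Hd (Var 10)))
  (Seq (Assign 3 Defs.Nil)
  (Seq (grow (Tl (Var 10)))
  (Seq (grow (Var 4))
  (Seq (grow (Var 4))
  (Seq (compile emain main_address 10)
    (Assign 0 (Var 10)))))))))))).

Definition learner_time (ca cb b0 l G B : nat) : nat :=
  (cost b0 esizes + cost l.*2.+1 (ECons (epow ca) (epow cb)) + cost B emain
   + 4 * l.*2.+1 ^ cb + 8 * G + 40)%N.

Lemma nodes_nat m : nodes (enc_nat m) = m.*2.+1.
Proof. by elim: m => //= m ->. Qed.

(** * Running the compiled program *)

Section Machine.
Context {R : realType} {n : nat}.
Variables (f : cube n -> bool) (D : cube n -> R).
Hypothesis hD : is_distr D.
Variable good : store -> Prop.
Local Notation guar := (guar f D good).

Lemma guar_seq t p q K st v :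
  guar t (p :: q :: K, st) v -> guar t.+1 (Seq p q :: K, st) v.
Proof. exact: guar_step. Qed.

Lemma guar_assign t x e K st v :
  guar t (K, upd st x (expr_eval e st)) v -> guar t.+1 (Assign x e :: K, st) v.
Proof. exact: guar_step. Qed.

(** For the deterministic segments that compute parameters: the value is known, so the continuation
    is examined at that value only. *)
Lemma guar_compute e del d st K t u v :
  (3 < d)%N -> (forall x, del x < d)%N -> deterministic e ->
  computes f D (nodes (st 3%N)) e (fun x => st (del x)) u ->
  (forall st', st' d = u -> agree d st st' -> guar t (K, st') v) ->
  guar (cost (nodes (st 3%N)) e + t) (compile e del d :: K, st) v.
Proof.
move=> hd hdel he hc h; rewrite -[v](hc (fun _ => v)).
apply: compile_sound => //.
by apply: (must_value f D _ _ _ u) => // st' h1 h2; apply: h.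
Qed.

Lemma guar_grow e m K st t v :
  expr_eval e st = enc_nat m ->
  (forall st', nodes (st' 3%N) = (2 ^ m * (nodes (st 3%N)).+1).-1 ->
     (forall i, i != 3%N -> i != 9%N -> st' i = st i) -> guar t (K, st') v) ->
  guar (4 * m + t + 3) (grow e :: K, st) v.
Proof.
move=> he h; rewrite addn3; apply/guar_seq/guar_assign; rewrite he.
set st1 := upd _ _ _.
have h9 : st1 9%N = enc_nat m by [].
have h3 : nodes (st 3%N) = nodes (st1 3%N) by [].
have hi i : i != 3%N -> i != 9%N -> st1 i = st i by move=> _; exact: upd_neq.
move: h; rewrite h3; clearbody st1; clear h3 he e => h.
have {h hi} : forall st', nodes (st' 3%N) = (2 ^ m * (nodes (st1 3%N)).+1).-1 ->
     (forall i, i != 3%N -> i != 9%N -> st' i = st1 i) -> guar t (K, st') v.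
  by move=> st' h1 h2; apply: h => // i i3 i9; rewrite h2 ?hi.
elim: m st1 h9 => [|m ih] st1 h9 h.
  rewrite muln0 add0n; apply: guar_step; first by rewrite /= h9.
  by apply: h => //; rewrite mul1n.
rewrite mulnS -addnA !addSn add0n -addSn.
apply: guar_step; first by rewrite /= h9.
apply/guar_seq/guar_assign/guar_assign; set st2 := upd _ _ _.
have h3 : st2 3%N = Node (st1 3%N) (st1 3%N) by [].
rewrite addSn; apply: ih => [|st' h1 h2].
  by rewrite /st2 /= /upd /= h9.
apply: h => [|i i3 i9]; last first.
  by rewrite h2 // /st2 /upd (negbTE i3) (negbTE i9).
by rewrite h1 h3 /= expnS; congr _.-1; lia.
Qed.

Lemma learner_guar (ca cb s N : nat) (st : store) (ok : tree -> Prop) :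
  good = (fun st => ok (st 0%N)) ->
  st 0%N = enc_nat n -> st 1%N = enc_nat s -> st 2%N = enc_nat N ->
  let b0 := (2 * (n + s + N) + 5)%N in
  let l := (bitlen n + bitlen s)%N in
  let G := (bitlen N + 3)%N in
  let a := (l.*2.+1 ^ ca)%N in
  let B := (2 ^ (l.*2.+1 ^ cb + 2 * G).+1).-1 in
  (bitlen n <= n)%N -> (2 * n <= B)%N -> (a <= B)%N -> (G <= B)%N -> (s <= B)%N ->
  guar (learner_time ca cb b0 l G B) ([:: learner ca cb], st)
    (mainM f D B a (G * s) (fun H => (`[< ok (enc_dnf H) >])%:R)).
Proof.
move=> hgood h0 h1 h2 b0 l G a B ln nB aB GB sB.
set T := learner_time _ _ _ _ _ _.
set v := mainM _ _ _ _ _ _.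
have hB0 st' : st' 3%N = Node (enc_nat n) (Node (enc_nat s) (enc_nat N)) ->
    nodes (st' 3%N) = b0.
  by move=> -> /=; rewrite !nodes_nat /b0; clear; lia.
pose t2 := ((4 * G + (cost B emain + 1).+1 + 3).+1)%N.
pose t1 := ((4 * l.*2.+1 ^ cb + (4 * G + t2 + 3).+1 + 3).+1)%N.
pose u := (cost l.*2.+1 (ECons (epow ca) (epow cb)) + t1.+4).+1%N.
apply: (@guar_leq _ _ _ _ hD _ ((cost b0 esizes + u.+4).+1.+2)%N).
  by rewrite /T /learner_time /u /t1 /t2; clear; lia.
apply/guar_seq/guar_assign/guar_seq; set st1 := upd st _ _.
have i1 i : i != 3%N -> st1 i = st i by exact: upd_neq.
have {hB0} e1 := hB0 st1; rewrite -[b0]e1; last by rewrite /st1 /upd /= h0 h1 h2.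
have {}e1 : nodes (st1 3%N) = b0 by rewrite e1 // /st1 /upd /= h0 h1 h2.
apply: guar_compute => //.
- by do 19 case => //.
- apply: (sizes_computes _ _ _ _ s N); rewrite ?e1 /= ?i1 //; rewrite /b0; move: ln; clear; lia.
move=> st2 v2 ag2.
have i2 i : (i < 3)%N -> st2 i = st i by move=> hi; rewrite ag2 ?i1 //; lia.
apply/guar_seq/guar_assign/guar_seq/guar_assign/guar_seq; set st3 := upd _ 3 _.
have i3 i : (i < 3)%N -> st3 i = st i by case: i => [|[|[|]]] // _; rewrite -i2.
have f3 : st3 4%N = enc_nat G.
  by rewrite /st3 /upd /= v2 /= /G !addnS addn0.
have e3 : nodes (st3 3%N) = l.*2.+1 by rewrite /st3 /upd /= v2 nodes_nat.
rewrite -[in cost _ _]e3; apply: (guar_compute _ _ _ _ _ _ (Node (enc_nat a) (enc_nat (l.*2.+1 ^ cb)))) => //.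
- by do 19 case => //.
- by rewrite /= !deterministic_incr.
- rewrite e3 => phi.
  rewrite -[LHS]/(wp f D _ (epow ca) _ (fun x => wp f D _ (epow cb) _ (fun y => phi (Node x y)))).
  by rewrite !pow_computes.
move=> st4 v4 ag4; rewrite /t1.
apply/guar_seq/guar_assign/guar_seq/guar_assign/guar_seq; set st5 := upd _ 3 _.
have i5 i : (i < 3)%N -> st5 i = st i by case: i => [|[|[|]]] // _; rewrite -i3 // -ag4.
have f5 : st5 4%N = enc_nat G by rewrite -f3 -ag4.
have g5 : st5 5%N = enc_nat a by rewrite /st5 /upd /= v4.
apply: guar_grow; first by rewrite /= /st5 /upd /= v4.
move=> st6 e6 h6; apply/guar_seq/guar_grow; first by rewrite /= h6.
move=> st7 e7 h7; rewrite /t2; apply/guar_seq/guar_grow; first by rewrite /= h7 // h6.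
move=> st8 e8 h8; apply/guar_seq.
have h58 i : i != 3%N -> i != 9%N -> st8 i = st5 i by move=> p q; rewrite h8 // h7 // h6.
have eB : nodes (st8 3%N) = B.
  rewrite e8 e7 e6 /B /= !prednK ?muln_gt0 ?expn_gt0 //.
  suff -> M g : (2 ^ (M + 2 * g).+1 = 2 ^ g * (2 ^ g * (2 ^ M * 2)))%N by [].
  by rewrite expnS expnD mulnC [(2 * g)%N]mul2n -addnn expnD; clear; ring.
have n_gt0 : (n <= B)%N by apply: leq_trans nB; clear; lia.
have B_gt0 : (1 <= B)%N by apply: leq_trans GB; rewrite /G addn3.
pose r x := st8 (main_address x).
have -> : v = wp f D B emain r (fun w => (`[< ok w >])%:R).
  rewrite (wp_main f D B n_gt0 nB a aB r G s) //; rewrite /r /= h58 ?f5 ?g5 ?i5 //.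
rewrite -eB; apply: (compile_sound f D hD good _ _ _ _ r) => //.
  by move=> x; split; [do 10 (case: x => [|x] //)|].
apply: must_all => w st9 h9 _; apply: guar_step; first by [].
by split=> //=; rewrite hgood /upd /= h9.
Qed.
End Machine.


(** * Parameters and running time *)

Lemma bitlen_gt m : (m < 2 ^ bitlen m)%N.
Proof. exact: up_logP. Qed.

Lemma bitlen_le m : (bitlen m <= m)%N.
Proof. by apply: up_log_min => //; exact: ltn_expl. Qed.

Lemma expn_bitlen_le m : (0 < m)%N -> (2 ^ bitlen m <= 2 * m)%N.
Proof.
move=> m0; have := @up_log_gtn 2 m.+1 isT m0; rewrite -/(bitlen m) ltnS.
have : (0 < bitlen m)%N by rewrite up_log_gt0.
by case: (bitlen m) => //= k _; rewrite expnS leq_mul2l.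
Qed.

(** With [a = l ^ 2] and [tau < l], the dominant term [tau * a ^ 2] has order [l ^ 5]; a further
    [l ^ 6 >= 5 ^ 6] absorbs the numerical constants, whence 11. *)
Lemma attempt_exp_lt tau l : (2 * tau < l)%N -> (5 <= l)%N ->
  (attempt_exp tau (l ^ 2) < l ^ 11)%N.
Proof.
move=> tl l5; have h6 : (25 * 625 <= l ^ 6)%N.
  by rewrite -[25%N]/(5 ^ 2)%N -[625%N]/(5 ^ 4)%N -expnD leq_exp2r.
rewrite -[11%N]/(6 + 5)%N expnD; apply: leq_trans (leq_mul h6 (leqnn _)).
have p k : (k <= 5)%N -> (l ^ k <= l ^ 5)%N.
  by move=> hk; apply: leq_pexp2l => //; apply: leq_trans l5.
have := p 0%N isT; have := p 2%N isT; have := p 3%N isT; have := p 4%N isT.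
rewrite /attempt_exp /phase_exp /scale; move: l5 tl; clear.
have e2 : (l ^ 2 = l * l)%N by rewrite -mulnn.
have e3 : (l ^ 3 = l * l ^ 2)%N by rewrite expnS.
have e4 : (l ^ 4 = l * l ^ 3)%N by rewrite expnS.
have e5 : (l ^ 5 = l ^ 2 * l ^ 3)%N by rewrite -expnD.
move=> l5 tl h4 h3 h2; rewrite expn0 => h0.
set a := (l ^ 2)%N in h2 e3 e5 *.
have h1 : (tau * (a * a) <= l ^ 5)%N.
  have -> : (l ^ 5 = l * (a * a))%N by rewrite e5 e3; clear; ring.
  by apply: leq_mul => //; lia.
have h1' : (2 * (tau * a) <= l ^ 3)%N by rewrite e3 mulnA leq_mul // ltnW.
have h2' : (5 * a <= l ^ 3)%N by rewrite e3 leq_mul.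
have h6 : (a * a = l ^ 4)%N by rewrite e4 e3 /a e2; clear; ring.
have h7 : (a * (12 * tau * a + 72 * (16 * (13 * tau + 3)) + a + 6)
  + 36 * (16 * (13 * tau + 3)) * a + a + 4
  = 12 * (tau * (a * a)) + 72 * 312 * (tau * a) + a * a + 29 * 179 * a + 4)%N.
  clear; ring.
rewrite h7; rewrite h6 in h1 *; move: h0 h1 h1' h2' h3 h4; clear.
move: (tau * l ^ 4)%N (tau * a)%N (l ^ 3)%N (l ^ 4)%N (l ^ 5)%N => ????? ; clear; lia.
Qed.

(** Used with [X = l ^ 11]: against a trial success probability of about [2 ^ -X], a budget of
    [2 ^ (l * X + 2 * G)] leaves a surplus that beats the factors [B] and [2 ^ s] in the loss. This
    is why the exponent of [l] in the budget is 12. *)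
Lemma budget_dominates l G X : (5 <= l)%N -> (l <= X)%N ->
  (l * X + 2 * G + 2 ^ l + 7 <= 2 ^ (l * X + 2 * G - X))%N.
Proof.
move=> l5 lX.
apply: (@leq_trans (2 ^ (4 * X + 2 * G))%N); last first.
  by rewrite leq_exp2l //; nia.
rewrite expnD.
have hu : (X < 2 ^ X)%N by exact: ltn_expl.
have hw : (2 * G < 2 ^ (2 * G))%N by exact: ltn_expl.
have hl : (2 ^ l <= 2 ^ X)%N by rewrite leq_exp2l.
have h32 : (32 <= 2 ^ X)%N by rewrite (@leq_exp2l 2 5) // (leq_trans l5).
have -> : (2 ^ (4 * X) = (2 ^ X * 2 ^ X) ^ 2)%N.
  by rewrite -expnD -expnM; congr (2 ^ _)%N; clear; lia.
have hX : (l * X <= 2 ^ X * 2 ^ X)%N by apply: leq_mul; lia.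
move: (2 ^ l)%N (2 ^ X)%N (2 ^ (2 * G))%N hX hl hu hw h32; clear => p u w *.
have h1 : (32 * u <= u * u)%N by rewrite leq_mul2r; lia.
have h2 : (1024 * (u * u) <= (u * u) ^ 2)%N.
  by rewrite -mulnn leq_mul2r; apply/orP; right; exact: (@leq_mul 32 32).
have h3 : (w + (u * u) ^ 2 <= 1 + w * (u * u) ^ 2)%N.
  by have : (0 < (u * u) ^ 2)%N; [lia|nia].
lia.
Qed.

Section Numerics.
Context {R : realType}.

Lemma compl_half_pow (j m B : nat) : (m * 2 ^ j <= B)%N ->
  (1 - 2^-1 ^+ j) ^+ B <= 2^-1 ^+ m :> R.
Proof.
move=> h; have q1 : 2^-1 ^+ j <= 1 :> R by apply: exprn_ile1; lra.
have q0 : 0 <= 2^-1 ^+ j :> R by apply: exprn_ge0; lra.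
apply: (@le_trans _ _ ((1 - 2^-1 ^+ j) ^+ (2 ^ j * m))).
  by apply: ler_wiXn2l; [lra|lra|rewrite mulnC].
rewrite exprM; apply: lerXn2r; rewrite ?nnegrE; last exact: pow2_compl_le.
  by apply: exprn_ge0; lra.
by lra.
Qed.

Lemma pow_half_le (x y : nat) : (x + 6 <= y)%N -> 2 ^+ x * 2^-1 ^+ y <= 40^-1 :> R.
Proof.
move=> h; apply: (@le_trans _ _ (2 ^+ x * 2^-1 ^+ (x + 6))).
  rewrite ler_wpM2l ?exprn_ge0 //; apply: ler_wiXn2l => //; lra.
by rewrite exprD mulrA -exprMn divff ?pnatr_eq0 // expr1n mul1r; lra.
Qed.

Lemma loss_le (s l G g B : nat) :
  let K := (l ^ 12 + 2 * G)%N in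
  B = (2 ^ K.+1).-1 -> (5 <= l)%N -> (s <= 2 ^ l)%N -> (g < l ^ 11)%N ->
  B%:R * (B%:R * 2^-1 ^+ B + 2 ^+ s * (1 - 2^-1 ^+ g / 2) ^+ B) <= 20^-1 :> R.
Proof.
move=> K eB l5 sl gl.
have lX : (l <= l ^ 11)%N by rewrite -{1}[l]expn1 leq_pexp2l // (leq_trans _ l5).
have hdom := @budget_dominates l G _ l5 lX.
have hK : (l * l ^ 11 + 2 * G = K)%N by rewrite -expnS.
rewrite hK in hdom; set m := (2 ^ (K - l ^ 11))%N in hdom.
have KX : (l ^ 11 <= K)%N by rewrite -hK; move: l5; clear; nia.
have hB : (2 ^ K <= B)%N by rewrite eB expnS; have : (0 < 2 ^ K)%N; [rewrite expn_gt0|lia].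
have hm : (m * 2 ^ g.+1 <= B)%N.
  apply: leq_trans hB; rewrite /m -[X in (_ <= 2 ^ X)%N](subnK KX) expnD.
  by rewrite leq_mul2l leq_exp2l // gl orbT.
have BK : (B%:R : R) <= 2 ^+ K.+1.
  by rewrite -natrX ler_nat eB leq_pred.
have K5 : (5 <= K)%N by apply: leq_trans l5 (leq_trans lX KX).
have K2 : (2 * K + 8 <= 2 ^ K)%N.
  move: K5; clear; elim: (K) => // k ih; rewrite leq_eqVlt => /orP[/eqP <- //|].
  by rewrite ltnS => /ih; rewrite expnS; lia.
have t1 : B%:R * (B%:R * 2^-1 ^+ B) <= 40^-1 :> R.
  apply: (@le_trans _ _ (2 ^+ (K.+1 + K.+1) * 2^-1 ^+ B)); last first.
    by apply: pow_half_le; apply: leq_trans hB; lia.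
  rewrite exprD mulrA ler_wpM2r ?exprn_ge0 ?invr_ge0 ?ler0n //.
  by rewrite ler_pM ?ler0n.
have t2 : B%:R * (2 ^+ s * (1 - 2^-1 ^+ g / 2) ^+ B) <= 40^-1 :> R.
  apply: (@le_trans _ _ (2 ^+ (K.+1 + s) * 2^-1 ^+ m)); last first.
    by apply: pow_half_le; move: hdom sl; clear; lia.
  rewrite exprD mulrA; apply: ler_pM.
  - by rewrite mulr_ge0 ?exprn_ge0 ?ler0n.
  - apply: exprn_ge0; have : 2^-1 ^+ g <= 1 :> R by apply: exprn_ile1; lra.
    lra.
  - by rewrite ler_wpM2r ?exprn_ge0 ?ler0n.
  - by rewrite -exprSr; exact: compl_half_pow.
rewrite mulrDr; lra.
Qed.

(** The 3 in [G] makes the sampling factor at most [2 ^ -(4 * v)], with [v] the allowed number of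
    disagreements; it outweighs [2 ^ v] from the Chernoff bound and another [2 ^ v] for the count of
    hypotheses. *)
Lemma occam_le (n s l e B : nat) (eps : R) :
  let G := (e + 3)%N in
  let K := (l ^ 12 + 2 * G)%N in
  B = (2 ^ K.+1).-1 -> (5 <= l)%N -> ((2 * n).+1 * s <= 2 ^ l)%N ->
  2^-1 ^+ e <= eps -> eps <= 2 ->
  ((2 ^ (2 * n)).+1 ^ (G * s))%:R * (2 ^+ (B %/ 2 ^ G) * (1 - eps / 2) ^+ B)
    <= 40^-1 :> R.
Proof.
move=> G K eB l5 nsl he eps2.
have hB : (2 ^ K <= B)%N by rewrite eB expnS; have : (0 < 2 ^ K)%N; [rewrite expn_gt0|lia].
set v := (B %/ 2 ^ G)%N.
have vB : (v * 2 ^ G <= B)%N by exact: leq_divM.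
(* One [G] of [2 * G] is spent on the division by [2 ^ G]; the other absorbs the factor [G] in the
   hypothesis size. *)
have hv : (2 ^ (l ^ 12 + G) <= v)%N.
  rewrite /v leq_divRL ?expn_gt0 // -expnD; apply: leq_trans hB.
  by rewrite leq_exp2l // /K; clear; lia.
have h4 : (4 * v * 2 ^ e.+1 <= B)%N.
  by apply: leq_trans vB; rewrite /G expnD expnS; clear; lia.
have Gs : ((2 * n).+1 * (G * s) <= v)%N.
  apply: leq_trans hv; rewrite mulnCA mulnC expnD leq_mul //.
    apply: leq_trans nsl _; rewrite leq_exp2l // -{1}[l]expn1.
    by rewrite leq_pexp2l // (leq_trans _ l5).
  by apply: ltnW; exact: ltn_expl.
have v6 : (6 <= 2 * v)%N.
  have : (2 ^ 3 <= v)%N; last by clear; lia.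
  by apply: leq_trans hv; rewrite leq_exp2l // /G; clear; lia.
apply: (@le_trans _ _ (2 ^+ ((2 * n).+1 * (G * s) + v) * 2^-1 ^+ (4 * v))); last first.
  by apply: pow_half_le; move: Gs v6; clear; lia.
rewrite exprD -mulrA ler_pM ?ler0n //.
- by rewrite mulr_ge0 ?exprn_ge0 //; lra.
- rewrite -natrX ler_nat [X in (_ <= X)%N]expnM; case: (G * s)%N => // i; rewrite leq_exp2r //.
  by rewrite expnS; have : (0 < 2 ^ (2 * n))%N; [rewrite expn_gt0|clear; lia].
rewrite ler_wpM2l ?exprn_ge0 //; apply: le_trans (compl_half_pow _ _ _ h4).
apply: lerXn2r; rewrite ?nnegrE; first lra.
  have : 2^-1 ^+ e.+1 <= 1 :> R by apply: exprn_ile1; lra.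
  lra.
by rewrite exprSr; lra.
Qed.
End Numerics.

Lemma learner_time_poly ca cb : exists c, forall b0 l G B,
  (b0 <= B)%N -> (l.*2.+1 <= B)%N -> (l.*2.+1 ^ cb <= B)%N -> (G <= B)%N ->
  (learner_time ca cb b0 l G B <= c * B.+1 ^ c)%N.
Proof.
have [c1 h1] := cost_poly esizes; have [c2 h2] := cost_poly (ECons (epow ca) (epow cb)).
have [c3 h3] := cost_poly emain; exists (c1 + c2 + c3 + 52)%N => b0 l G B hb hl hlc hG.
set c := (c1 + c2 + c3 + 52)%N; set P := (B.+1 ^ c)%N.
have mono k b e : (k <= c)%N -> (b <= B)%N -> (cost b e <= k * b.+1 ^ k)%N ->
    (cost b e <= k * P)%N.
  move=> kc bB /leq_trans; apply; rewrite leq_mul2l; apply/orP; right.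
  apply: (@leq_trans (B.+1 ^ k)); last exact: leq_pexp2l.
  by case: (k) => // k'; rewrite leq_exp2r.
have BP : (B < P)%N by rewrite -{1}[B.+1]expn1 leq_pexp2l // /c addnS.
have q1 : (cost b0 esizes <= c1 * P)%N by apply: mono => //; rewrite /c; lia.
have q2 : (cost l.*2.+1 (ECons (epow ca) (epow cb)) <= c2 * P)%N.
  by apply: mono => //; rewrite /c; lia.
have q3 : (cost B emain <= c3 * P)%N by apply: mono => //; rewrite /c; lia.
rewrite /learner_time {1}/c !mulnDl; move: q1 q2 q3 BP hlc hG; clear.
move: (cost b0 _) (cost _ (ECons _ _)) (cost B _) => t1 t2 t3; lia.
Qed.

Section Growth.
Context {R : realType}.

(** Crude change of base: [expR (l / 2) <= 2 ^ l <= 4 * z <= expR (2 + ln z)]. *)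
Lemma log_le (l : nat) (z : R) : 1 <= z -> (2 ^ l)%:R <= 4 * z ->
  l%:R <= 2 * ln z + 4.
Proof.
move=> z1 hl; have z0 : 0 < z by apply: lt_le_trans z1.
have e2 : expR 2^-1 <= 2 :> R.
  have h := expR_ge1Dx (- 2^-1 : R); rewrite expRN in h.
  have := expR_gt0 (2^-1 : R); set w := expR _ in h * => w0.
  have : w * (1 - 2^-1) <= w * w^-1 by rewrite ler_pM2l //.
  by rewrite divff ?gt_eqF //; lra.
have e4 : 4 <= expR 2 :> R.
  have h := expR_ge1Dx (1 : R); rewrite -[X in expR X]mulr1 expRM_natl expr2.
  by apply: (@le_trans _ _ (2 * 2)); [lra|apply: ler_pM; lra].
suff : l%:R * 2^-1 <= 2 + ln z by lra.
rewrite -ler_expR expRM_natl expRD lnK ?posrE //.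
apply: (@le_trans _ _ (4 * z)); last by rewrite ler_pM2r.
apply: le_trans hl; rewrite natrX; apply: lerXn2r => //; rewrite nnegrE //.
exact: expR_ge0.
Qed.

(** One more power of [y] swallows the constants once [y] is large, which gives the exponent 13 in
    the running time; [K] covers the bounded range. The threshold [y0] is at least 9, so that
    [4 * y + 9 <= 5 * y], and exceeds the resulting coefficient [2 * c * 5 ^ 12]. *)
Lemma quasipoly_le (c : nat) : exists2 K : R, 0 <= K &
  forall (y : R) (l : nat), 0 <= y -> l%:R <= 4 * y + 9 ->
    2 ^+ (c * (l ^ 12).+1) <= K * expR (y ^+ 13).
Proof.
pose y0 : R := 2 * c%:R * 5 ^+ 12 + 9.
have c0 : 0 <= c%:R :> R by [].
have y09 : 9 <= y0 by rewrite /y0 lerDr !mulr_ge0 ?exprn_ge0.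
exists (expR (c%:R * ((4 * y0 + 9) ^+ 12 + 1))); first exact: expR_ge0.
move=> y l hy hl.
have l0 : 0 <= l%:R :> R by [].
have h0 m : 2 ^+ m <= expR m%:R :> R.
  rewrite -[m%:R]mulr1 expRM_natl.
  by apply: lerXn2r; rewrite ?nnegrE ?expR_ge0 //; have := expR_ge1Dx (1 : R); lra.
have h1 := h0 (c * (l ^ 12).+1)%N; rewrite natrM -[(l ^ 12).+1%:R]natr1 natrX in h1.
apply: le_trans h1 _; rewrite -expRD ler_expR.
have y13 : 0 <= y ^+ 13 by exact: exprn_ge0.
have [yy|/ltW yy] := lerP y y0.
  apply: (@le_trans _ _ (c%:R * ((4 * y0 + 9) ^+ 12 + 1))); last by rewrite lerDl.
  by rewrite ler_wpM2l // lerD2r; apply: lerXn2r; rewrite ?nnegrE //; lra.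
apply: (@le_trans _ _ (y ^+ 13)); last first.
  rewrite lerDr mulr_ge0 // addr_ge0 // exprn_ge0 //; lra.
apply: (@le_trans _ _ (c%:R * (2 * (5 * y) ^+ 12))).
  rewrite ler_wpM2l //.
  have h : l%:R ^+ 12 <= (5 * y) ^+ 12.
    by apply: lerXn2r; rewrite ?nnegrE //; lra.
  have : 1 <= (5 * y) ^+ 12 by apply: exprn_ege1; lra.
  by move: h; set p := (5 * y) ^+ 12; lra.
rewrite exprMn exprS.
have -> : c%:R * (2 * (5 ^+ 12 * y ^+ 12)) = (2 * c%:R * 5 ^+ 12) * y ^+ 12 by ring.
rewrite ler_wpM2r ?exprn_ge0 //; apply: le_trans yy.
by rewrite /y0 lerDl.
Qed.
End Growth.


Lemma log_sizes_le {R : realType} (n s : nat) : (0 < n)%N -> (0 < s)%N ->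
  (bitlen n + bitlen s).*2.+1%:R <= 4 * ln (n * s)%:R + 9 :> R.
Proof.
move=> n0 s0; set l := (bitlen n + bitlen s)%N.
have h : (2 ^ l <= 4 * (n * s))%N.
  apply: (@leq_trans (2 * n * (2 * s))); last by rewrite mulnACA.
  by rewrite expnD; apply: leq_mul; apply: expn_bitlen_le.
have : l%:R <= 2 * ln (n * s)%:R + 4 :> R.
  apply: log_le; first by rewrite ler1n muln_gt0 n0.
  by rewrite -natrM ler_nat.
by rewrite -[l.*2.+1%:R]natr1 -muln2 natrM; lra.
Qed.

Lemma expn_accuracy_le {R : realType} (N : nat) (x : R) : (0 < N)%N -> N%:R <= x + 1 ->
  (2 ^ (bitlen N + 3))%:R <= 16 * (x + 1).
Proof.
move=> N0 Nx; have : (2 ^ (bitlen N + 3) <= 16 * N)%N.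
  by rewrite expnD; have := expn_bitlen_le _ N0; lia.
by rewrite -(ler_nat R) natrM; lra.
Qed.

Theorem theorem9p1 (R : realType) :
  exists (P : cmd) (c : nat) (p : {poly R}) (C : R),
    forall (n s : nat) (eps : R) (F : dnf n) (D : cube n -> R),
      (0 < s)%N -> 0 < eps -> size F = s -> exact_dnf F -> is_distr D ->
      exists t : nat,
        [/\ t%:R <= expR (ln (n * s)%:R ^+ c) * p.[eps^-1],
            halts_within (dnf_eval F) t (init P n s eps)
          & 9 / 10 <= success_prob (dnf_eval F) D
                        (good_output F s eps D C) t (init P n s eps)].
Proof.
have [c hc] := learner_time_poly 2 12; have [K0 K00 hK0] := @quasipoly_le R c.
(* [B.+1] equals [2 ^ (L ^ 12).+1] times [(2 ^ G) ^ 2], and [2 ^ G] is at most 16 times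
   [eps^-1 + 1]; its power [c] gives the polynomial. *)
exists (learner 2 12), 13%N, ((c%:R * K0) *: ((16 *: ('X + 1%:P)) ^+ (2 * c))), 9.
move=> n s eps F D s0 eps0 sF [k [kn Fk]] hD.
have n0 : (0 < n)%N by case/andP: kn => k0; apply: leq_trans.
set x := eps^-1; have x0 : 0 < x by rewrite invr_gt0.
set N := `|Num.ceil x|%N.
have [xN Nx] : x <= N%:R /\ N%:R <= x + 1.
  have hN : (N%:R : R) = (Num.ceil x)%:~R.
    by rewrite /N natr_absz ger0_norm // ltW // ceil_gt0.
  rewrite hN; split; first exact: ceil_ge.
  have := ceilB1_lt x; rewrite intrB; lra.
have N0 : (0 < N)%N by rewrite -(ltr_nat R); apply: lt_le_trans xN.
pose l := (bitlen n + bitlen s)%N; pose e := bitlen N; pose G := (e + 3)%N.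
pose L := l.*2.+1; pose K := (L ^ 12 + 2 * G)%N; pose B := (2 ^ K.+1).-1.
have bn0 : (0 < bitlen n)%N by rewrite up_log_gt0.
have bs0 : (0 < bitlen s)%N by rewrite up_log_gt0.
have L5 : (5 <= L)%N by rewrite /L /l; lia.
have nl := bitlen_gt n; have sl := bitlen_gt s; have Nl := bitlen_gt N.
have El : (2 ^ l = 2 ^ bitlen n * 2 ^ bitlen s)%N by rewrite expnD.
have n2l : ((2 * n).+1 <= 2 ^ (bitlen n).+1)%N by rewrite expnS; lia.
have KB : (2 ^ K <= B)%N.
  by rewrite /B expnS; have : (0 < 2 ^ K)%N; [rewrite expn_gt0|lia].
have LX j : (1 <= j)%N -> (L <= L ^ j)%N.
  by move=> hj; rewrite -{1}[L]expn1 leq_pexp2l.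
have LjB j : (j <= 12)%N -> (2 ^ (L ^ j) <= B)%N.
  move=> hj; apply: leq_trans KB; rewrite leq_exp2l // /K.
  by apply: leq_trans (leq_addr _ _); rewrite leq_pexp2l.
have LB j : (j <= 12)%N -> (L ^ j <= B)%N.
  by move=> hj; apply: leq_trans (LjB j hj); apply: ltnW; exact: ltn_expl.
have b0B : (2 * (n + s + N) + 5 <= B)%N.
  apply: leq_trans KB; apply: (@leq_trans (2 ^ (l + 2 * G))); last first.
    by rewrite leq_exp2l // leq_add2r; apply: leq_trans (LX 12%N isT); rewrite /L; lia.
  have -> : (2 ^ (l + 2 * G) = 2 ^ bitlen n * 2 ^ bitlen s * (2 ^ e * 2 ^ e * 64))%N.
    by rewrite -El -[64%N]/(2 ^ 6)%N -!expnD; congr (2 ^ _)%N; rewrite /G; lia.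
  have : (2 <= 2 ^ e)%N by apply: leq_ltn_trans Nl.
  have : (2 <= 2 ^ bitlen n)%N by apply: leq_ltn_trans nl.
  have : (2 <= 2 ^ bitlen s)%N by apply: leq_ltn_trans sl.
  move: nl sl Nl; rewrite -/e.
  move: (2 ^ bitlen n)%N (2 ^ bitlen s)%N (2 ^ e)%N; clear => u v w.
  move=> *.
  have : (u + v <= u * v + 1)%N by nia.
  have : (w <= w * w)%N by nia.
  have : (w * w + u * v <= w * w * (u * v) + 1)%N by nia.
  lia.
have GB : (G <= B)%N.
  apply: leq_trans KB; apply: leq_trans (ltnW (ltn_expl G (isT : 1 < 2)%N)) _.
  by rewrite leq_exp2l // /K; lia.
have n2B : (2 * n <= B)%N by apply: leq_trans b0B; clear; lia.
have sB : (s <= B)%N by apply: leq_trans b0B; clear; lia.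
(* The Occam bound needs accuracy at most 2, while [eps] is arbitrary; learning to accuracy [eps']
   is at least as good. *)
pose eps' : R := Num.min eps 1.
have e_eps : 2^-1 ^+ e <= eps'.
  rewrite le_min exprn_ile1 ?andbT; try lra.
  rewrite -[eps]invrK exprVn lef_pV2 ?posrE ?exprn_gt0 //.
  by apply: le_trans xN _; rewrite -natrX ler_nat ltnW.
pose good := good_output F s eps D 9.
pose ok v := good (fun _ => v).
have hguar := @learner_guar R n (dnf_eval F) D hD good 2 12 s N
  (init (learner 2 12) n s eps).2 ok
  erefl erefl erefl erefl (bitlen_le n) n2B (LB 2%N isT) GB sB.
have [hhalt hsucc] := hguar.
set t := learner_time _ _ _ _ _ _ in hhalt hsucc.
exists t; split; [|exact: hhalt|].
  have tB : (t <= c * B.+1 ^ c)%N by apply: hc => //; [exact: (LB 1%N)|exact: LB].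
  have BE : ((B.+1 ^ c) = 2 ^ (c * (L ^ 12).+1) * (2 ^ G) ^ (2 * c))%N.
    rewrite /B prednK ?expn_gt0 // -!expnM -expnD; congr (2 ^ _)%N; rewrite /K; ring.
  have y0 : 0 <= ln (n * s)%:R :> R by apply: ln_ge0; rewrite ler1n muln_gt0 n0.
  have Gx : (2 ^ G)%:R <= 16 * (x + 1) by exact: expn_accuracy_le.
  apply: (@le_trans _ _ ((c * B.+1 ^ c)%:R)); first by rewrite ler_nat.
  rewrite hornerZ horner_exp hornerZ hornerD hornerX hornerC.
  rewrite BE natrM [(_ * _ ^ (2 * c))%:R]natrM natrX [((2 ^ G) ^ _)%:R]natrX.
  have h1 := hK0 _ _ y0 (log_sizes_le _ _ n0 s0).
  have h2 := lerXn2r (2 * c) (ler0n R _ : _ \is Num.nneg) (le_trans (ler0n R _) Gx) Gx.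
  have h3 := ler_pM (exprn_ge0 _ (ler0n R 2)) (exprn_ge0 _ (ler0n R _)) h1 h2.
  apply: le_trans (ler_wpM2l (ler0n R c) h3) _.
  by rewrite le_eqVlt; apply/orP; left; apply/eqP; clear; ring.
apply: (le_trans _ hsucc); rewrite -/l -/e -/G -/L -/K -/B.
have near : (s * ((2 * n).+1 ^ bitlen s) ^ 2 <= 2 ^ (L ^ 2))%N.
  apply: (@leq_trans (2 ^ bitlen s * ((2 ^ (bitlen n).+1) ^ bitlen s) ^ 2)).
    by rewrite leq_mul ?(ltnW sl) // leq_exp2r // leq_exp2r.
  by rewrite -!expnM -expnD leq_exp2l // -mulnn /L /l; move: bn0 bs0; clear; nia.
have eps'1 : eps' <= 1 by rewrite ge_min lexx orbT.
have eps'0 : 0 < eps' by rewrite lt_min eps0 ltr01.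
apply: (@main_reach R n F D k s B (L ^ 2) (bitlen s) G eps') => //.
- apply: leq_trans (leqnSn _) _; apply: leq_trans n2l _; rewrite leq_exp2l //.
  by apply: leq_trans (LX 2%N isT); rewrite /L /l; move: bs0; clear; lia.
- by apply: leq_trans near (LjB 2%N isT).
- apply: (loss_le s L G (attempt_exp (bitlen s) (L ^ 2)) B) => //.
    apply: ltnW (leq_trans sl _); rewrite leq_exp2l // /L /l; clear; lia.
  by apply: attempt_exp_lt => //; rewrite /L /l; clear; lia.
- apply: (occam_le n s L e B) => //; last by apply: le_trans eps'1 _; rewrite ler1n.
  apply: (@leq_trans (2 ^ (bitlen n).+1 * 2 ^ bitlen s)).
    by rewrite leq_mul // ltnW.
  by rewrite -expnD leq_exp2l // /L /l; move: bn0; clear; lia.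
- by rewrite (ltW eps'0) (le_trans eps'1) // ler1n.
move=> H herr hsize; rewrite ler1n lt0b; apply/asboolP; exists H; split=> //.
  by apply: le_trans herr _; rewrite ge_min lexx.
(* With [m] the maximum, [bitlen N] is at most [2 * m + 4]; the shift 3 and [m >= 1] give 9. *)
have hG : G%:R <= 9 * Num.max 1 (ln x) :> R.
  have m1 : 1 <= Num.max 1 (ln x) by rewrite le_max lexx.
  have : e%:R <= 2 * Num.max 1 (ln x) + 4.
    suff [z z1 hz] : exists2 z : R, 1 <= z & (2 ^ e)%:R <= 4 * z /\ ln z <= Num.max 1 (ln x).
      by apply: le_trans (log_le e z z1 hz.1) _; move: hz.2; clear; lra.
    have h2 : (2 ^ e)%:R <= 2 * N%:R :> R by rewrite -natrM ler_nat expn_bitlen_le.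
    have [x1|x1] := lerP 1 x.
      exists x => //; split; last by rewrite le_max lexx orbT.
      by move: h2 Nx x1; clear; lra.
    exists 1 => //; split; last by rewrite ln1 (le_trans _ m1) // ler01.
    by move: h2 Nx x1; clear; lra.
  by rewrite /G natrD; move: m1; clear; lra.
apply: (@le_trans _ _ (G * s)%:R); first by rewrite ler_nat.
by rewrite natrM mulrAC ler_wpM2r.
Qed.
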